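(* Let $K$ be a complete discrete valuation field with ring of integers $\mathcal{O}_K$. There is a randomized algorithm which, given $M \in M_n(\mathcal{O}_K)$ such that $\mathrm{Disc}(\chi_M) \neq 0$, computes $\mathrm{Com}(X-M) \pmod{\chi_M}$ in average complexity $O\tilde{~}(n^3)$ operations in $K$, and in which the only divisions occur in taking gcds and inverses modulo $\chi_M$.
   Context: $\chi_M = \det(X I_n - M)$ is the characteristic polynomial of $M$ and $\mathrm{Disc}$ denotes the discriminant of a polynomial. $X - M$ means $XI_n - M$, and $\mathrm{Com}(A)$ is the comatrix (adjugate) of $A$, so that $A\cdot\mathrm{Com}(A) = \det(A)I_n$. $f(n) = O\tilde{~}(g(n))$ means $f(n) = O(g(n)\log(n)^k)$ for some $k\in\mathbb{N}$. The average is over the random choices made by the algorithm (random elements of $\mathcal{O}_K$ used as coefficients of linear combinations of rows and of columns, redrawn until a gcd test succeeds). ''Divisions in taking gcds and inverses modulo $\chi_M$'' refers to gcd computations with $\chi_M$ in $K[X]$ and to inversion in $K[X]/(\chi_M)$; any other division is only by invertible elements of $\mathcal{O}_K$ or is an exact division staying in $\mathcal{O}_K$. *)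

(* Defs.v *)
From mathcomp Require Import all_boot all_order all_algebra.

Set Implicit Arguments.
Unset Strict Implicit.
Unset Printing Implicit Defensive.

Import Order.TTheory GRing.Theory Num.Theory.
Local Open Scope ring_scope.

(** * Complete discrete valuation fields *)

Section Valuation.

Variables (K : fieldType) (v : K -> int).

(* The value of [v] at 0 is junk: the convention v(0) = +oo is built into
   [val_ge] and [val_le], which are the only ways [v] is used. *)
Definition val_ge (x : K) (m : int) : bool := (x == 0) || (m <= v x).

Definition val_le (x y : K) : bool :=
  (y == 0) || ((x != 0) && (v x <= v y)).

Definition integral (x : K) : bool := val_ge x 0.

Definition val_cauchy (u : nat -> K) : Prop :=
  forall m : int, exists N : nat,
    forall i j : nat, (N <= i)%N -> (N <= j)%N -> val_ge (u i - u j) m.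

Definition val_converges (u : nat -> K) (l : K) : Prop :=
  forall m : int, exists N : nat,
    forall i : nat, (N <= i)%N -> val_ge (u i - l) m.

Record complete_discrete_valuation : Prop := CompleteDiscreteValuation {
  valM : forall x y, x != 0 -> y != 0 -> v (x * y) = v x + v y;
  valD : forall x y, x != 0 -> y != 0 -> x + y != 0 ->
         Num.min (v x) (v y) <= v (x + y);
  val_uniformizer : exists2 p, p != 0 & v p = 1;
  val_complete : forall u, val_cauchy u -> exists l, val_converges u l
}.

(* In general O_K carries no canonical probability measure (it is not compact
   when the residue field is infinite), so a "random element of O_K" is drawn
   uniformly from a set of N distinct elements of O_K.  The sets are given by
   an arbitrary family [src]; the size N is chosen by the algorithm. *)
Definition random_source (src : nat -> seq K) : Prop :=
  forall N : nat, [/\ size (src N) = N, uniq (src N) & all integral (src N)].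

End Valuation.

(* The discriminant (-1)^(n(n-1)/2) a^(-1) Res_(n,n-1)(p, p'), with n = deg p,
   a the leading coefficient and p' seen in formal degree n - 1: the power of
   a accounts for the drop of deg p' in positive characteristic.  The order of
   the arguments is due to [resultant p q] being (-1)^(deg p * deg q) times the
   resultant defined by the usual Sylvester matrix. *)
Definition discriminant (K : fieldType) (p : {poly K}) : K :=
  let n := (size p).-1 in
  (-1) ^+ 'C(n, 2) * (lead_coef p)^-1 *
  (lead_coef p ^+ (n.-1 - (size p^`()).-1) * resultant p^`() p).

(** * A programming language for algorithms over K *)

(* A first-order functional language with recursive functions of one argument,
   computing on binary trees whose atoms are elements of K.  A program is a
   finite list of function bodies, the first one being the entry point.  Its
   syntax mentions neither K nor the dimension n of the input, so that a
   program is one algorithm for all n.  Variables are de Bruijn indices.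
   The empty tree is false and any [Cons] is true; lists and unary integers are
   right combs. *)

Inductive arith_op := Add | Sub | Mul | Div.

Inductive task := Gcd | Inverse.

Inductive expr :=
  | EVar of nat
  | ELet of expr & expr                (* the body binds one variable *)
  | ENil
  | ECons of expr & expr
  | ECase of expr & expr & expr        (* the last branch binds head and tail,
                                          as variables 0 and 1 *)
  | ECall of nat & expr
  | EZero
  | EOne
  | EArith of arith_op & expr & expr
  | EIsZero of expr
  | EValLe of expr & expr
  | EDraw of expr                      (* the argument is the unary N above *)
  | EModChi of task & nat & expr & expr.

Definition program := seq expr.

Inductive data (K : Type) :=
  | Nil
  | Elt of K
  | Cons of data K & data K.
Arguments Nil {K}.

Section Encoding.

Variable K : fieldType.

Definition data_of_seq (A : Type) (enc : A -> data K) (s : seq A) : data K :=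
  foldr (fun a d => Cons (enc a) d) Nil s.

(* Coefficients in increasing degrees, without trailing zeros. *)
Definition data_of_poly (p : {poly K}) : data K := data_of_seq (@Elt K) p.

Definition data_of_matrix (A : Type) (enc : A -> data K) (m n : nat)
    (M : 'M[A]_(m, n)) : data K :=
  data_of_seq (data_of_seq enc)
    [seq [seq M i j | j <- enum 'I_n] | i <- enum 'I_m].

Fixpoint seq_of_data (d : data K) : option (seq K) :=
  match d with
  | Nil => Some [::]
  | Cons (Elt x) t => omap (cons x) (seq_of_data t)
  | _ => None
  end.

Fixpoint data_size (d : data K) : nat :=
  if d is Cons _ t then (data_size t).+1 else 0%N.

Definition data_of_bool (b : bool) : data K := if b then Cons Nil Nil else Nil.

End Encoding.

Inductive outcome (K : Type) :=
  | Done of data K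
  | Fault                    (* stuck, or forbidden division *)
  | Timeout.                 (* fuel exhausted *)
Arguments Fault {K}.
Arguments Timeout {K}.

(* A run is a finitely supported distribution, given as a list of triples
   (probability, number of operations in K, outcome). *)
Definition run (K : Type) := seq (rat * nat * outcome K).

Section Semantics.

Variables (K : fieldType) (v : K -> int) (src : nat -> seq K).
Variable (chi : {poly K}).

Definition ret (o : outcome K) : run K := [:: (1, 0%N, o)].

(* One operation in K. *)
Definition op (d : data K) : run K := [:: (1, 1%N, Done d)].

Definition bind (m : run K) (k : data K -> run K) : run K :=
  flatten [seq
    match x with
    | (w, c, Done d) =>
        [seq let: (w', c', o) := y in (w * w', (c + c')%N, o) | y <- k d]
    | _ => [:: x]
    end | x <- m].

Definition with_elt (d : data K) (k : K -> run K) : run K :=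
  if d is Elt x then k x else ret Fault.

(* [free] holds inside the computations of gcds and of inverses modulo chi,
   where any division by a nonzero element is allowed.  Outside, one can only
   divide by a unit of O_K, or exactly in O_K. *)
Definition legal_div (free : bool) (x y : K) : bool :=
  (y != 0) &&
  [|| free,
      integral v y && integral v y^-1
    | [&& integral v x, integral v y & integral v (x / y)]].

Definition run_arith (free : bool) (o : arith_op) (x y : K) : run K :=
  match o with
  | Add => op (Elt (x + y))
  | Sub => op (Elt (x - y))
  | Mul => op (Elt (x * y))
  | Div => if legal_div free x y then op (Elt (x / y)) else ret Fault
  end.

Definition run_draw (N : nat) : run K :=
  if N is 0%N then ret Fault
  else [seq (N%:R^-1, 1%N, Done (Elt x)) | x <- src N].

(* [r] is the monic gcd of [p] and chi, resp. the inverse of [p] in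
   K[X]/(chi), provided that [q] is chi. *)
Definition certified (t : task) (p q r : data K) : bool :=
  match seq_of_data p, seq_of_data q, seq_of_data r with
  | Some p, Some q, Some r =>
    [&& q == chi :> seq K, r == Poly r :> seq K
      & match t with
        | Gcd => (Poly r \is monic) && (Poly r %= gcdp (Poly p) chi)
        | Inverse =>
            (size r < size chi)%N && ((Poly p * Poly r) %% chi == 1 %% chi)
        end]
  | _, _, _ => false
  end.

Section Eval.

Variable call : bool -> nat -> data K -> run K.

Fixpoint eval (free : bool) (env : seq (data K)) (e : expr) : run K :=
  match e with
  | EVar i => if onth env i is Some d then ret (Done d) else ret Fault
  | ELet e1 e2 => bind (eval free env e1) (fun d => eval free (d :: env) e2)
  | ENil => ret (Done Nil)
  | ECons e1 e2 =>
      bind (eval free env e1) (fun d1 =>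
      bind (eval free env e2) (fun d2 => ret (Done (Cons d1 d2))))
  | ECase e0 e1 e2 =>
      bind (eval free env e0) (fun d =>
        match d with
        | Nil => eval free env e1
        | Cons h t => eval free [:: h, t & env] e2
        | Elt _ => ret Fault
        end)
  | ECall f e1 => bind (eval free env e1) (call free f)
  | EZero => ret (Done (Elt 0))
  | EOne => ret (Done (Elt 1))
  | EArith o e1 e2 =>
      bind (eval free env e1) (fun d1 =>
      bind (eval free env e2) (fun d2 =>
      with_elt d1 (fun x => with_elt d2 (fun y => run_arith free o x y))))
  | EIsZero e1 =>
      bind (eval free env e1) (fun d =>
      with_elt d (fun x => op (data_of_bool K (x == 0))))
  | EValLe e1 e2 =>
      bind (eval free env e1) (fun d1 =>
      bind (eval free env e2) (fun d2 =>
      with_elt d1 (fun x => with_elt d2 (fun y =>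
      op (data_of_bool K (val_le v x y))))))
  | EDraw e1 => bind (eval free env e1) (fun d => run_draw (data_size d))
  (* The function [f], run with free divisions, must compute the gcd of its
     arguments p and chi, or the inverse of p modulo chi, and nothing else:
     only this canonical result is passed to the rest of the program. *)
  | EModChi t f e1 e2 =>
      bind (eval free env e1) (fun p =>
      bind (eval free env e2) (fun q =>
      bind (call true f (Cons p q)) (fun r =>
      ret (if certified t p q r then Done r else Fault))))
  end.

End Eval.

(* [fuel] bounds the depth of nested calls. *)
Fixpoint call (P : program) (fuel : nat) (free : bool) (f : nat) (d : data K)
    : run K :=
  if fuel is fuel'.+1 then
    if onth P f is Some body then eval (call P fuel') free [:: d] body
    else ret Fault
  else ret Timeout.

Definition exec (P : program) (fuel : nat) (input : data K) : run K :=
  call P fuel false 0 input.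

End Semantics.

Section LasVegas.

Variable K : fieldType.

Definition is_timeout (o : outcome K) : bool :=
  if o is Timeout then true else false.

Definition timeout_probability (m : run K) : rat :=
  \sum_(x <- m | is_timeout x.2) x.1.1.

Definition average_cost (m : run K) : rat :=
  \sum_(x <- m) x.1.1 * x.1.2%:R.

(* [m fuel] is the execution truncated at [fuel]; the operations performed
   before the truncation are counted, so that the average cost of the execution
   is the supremum of the nondecreasing sequence [average_cost (m fuel)]. *)
Definition almost_surely_terminates (m : nat -> run K) : Prop :=
  forall eps : rat, 0 < eps ->
    exists fuel : nat, timeout_probability (m fuel) < eps.

Definition only_returns (m : nat -> run K) (d : data K) : Prop :=
  forall (fuel i : nat) (w : rat) (c : nat) (o : outcome K),
    onth (m fuel) i = Some (w, c, o) -> o = Done d \/ o = Timeout.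

Definition average_cost_le (m : nat -> run K) (B : rat) : Prop :=
  forall fuel : nat, average_cost (m fuel) <= B.

End LasVegas.

(* f(n) = O(g(n) log(n)^k) for some k; [trunc_log 2 n] is the integral part of
   the binary logarithm of n. *)
Definition soft_O (f g : nat -> rat) : Prop :=
  exists (k : nat) (C : rat) (n0 : nat),
    forall n : nat, (n0 <= n)%N ->
      `|f n| <= C * `|g n * (trunc_log 2 n)%:R ^+ k|.

Definition comatrix_mod_char_poly (K : fieldType) (n : nat) (M : 'M[K]_n)
    : 'M[{poly K}]_n :=
  map_mx (fun p => p %% char_poly M) (\adj (char_poly_mx M)).

(* Main.v *)
From Stdlib Require Import Classical.
From Stdlib Require List.
Require Import Defs.
From mathcomp Require Import all_boot all_order all_algebra.
From mathcomp Require Import perm qpoly.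
From mathcomp Require Import zify ring lra.
Import Defs.

Set Implicit Arguments.
Unset Strict Implicit.
Unset Printing Implicit Defensive.

Import Order.TTheory GRing.Theory Num.Theory.
Local Open Scope ring_scope.

(** The comatrix of [X - M] is the polynomial in [X] whose coefficient of
    degree [b] is the sum over [l] of [chi_(b + l + 1) M^l]: this is Horner's
    scheme for [chi] at [M], and follows from Cayley-Hamilton
    ([adj_char_poly_mx]).  It is therefore enough to know the powers [M^l],
    [l < n], and [chi]: each entry of the comatrix is then obtained from the
    corresponding entries of the powers by one correlation with the
    coefficients of [chi], that is, by a product of polynomials.

    The powers are obtained from a cyclic vector.  Let [u] be a vector, [W_k =
    M^k u], and let [V] be the Krylov matrix with columns [W_0 .. W_(n-1)].
    If [V] is invertible, [M^b = (M^b V) V^-1], and the columns of [M^b V] are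
    [W_b .. W_(b+n-1)].  For fixed [i] and [j] the entries [(M^b)_(i,j)] for
    all [b] are thus the correlation of the sequence [(W_k)_i], [k <= 2n],
    with column [j] of [V^-1].  In all there are [2 n^2] correlations of length
    [O(n)], besides the cubic computation of the [W_k] and of [V^-1].

    - Divisions.  A Gauss-Jordan elimination without divisions ([gjP]) applied
      to [V] extended by the identity returns [D != 0] and [N] with [N V = D],
      both integral.  The only divisions left are of integral multiples of
      [D], which are exact since the powers of [M] and [chi] are integral, and
      of integral multiples of a power of [p], explained next.

    - Products of polynomials.  Over an arbitrary field there are no roots of
      unity to use, and the transform of Schoenhage is used: to multiply modulo
      [X^(p^k) - 1], cut the polynomials into [p^(k-h)] blocks of length
      [p^h], with [h] half of [k], and see them as polynomials in [Z = X^(p^h)]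
      over [K[X] / (1 + Y + .. + Y^(p-1))], where [Y = X^(p^(h+1))].
      There [X] is a root of unity of order [p^(h+2)], whose powers act by
      rotations, and the product modulo [Z^(p^(k-h)) - 1] is computed by a
      transform of radix [p] ([biv_mul_tree]) with recursive products at its
      leaves.  The inverse transform would divide by [p]; without that
      division, the result is multiplied by a power of [p] that depends only
      on [k] ([Poly_cyc]).  It is divided out at the end, exactly; this only
      requires [p] to be nonzero in [K], so that [p = 2] or [p = 3] will do.

    - Choice of [u].  Take [u = (1, t, .., t^(n-1))].  As a polynomial in [t]
      the determinant of [V] has degree at most [n (n - 1)].  It is not zero
      when [chi] is separable ([det_krylov_poly_n0]): a relation between the
      columns would be a multiple of each irreducible factor of [chi], because
      no such factor divides the adjugate of [Y - M].  So for [t] drawn among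
      [2 n^2 + 1] elements, the probability that [V] is singular is at most one
      half; drawing again until it is not costs at most two trials on average
      ([loop_step]).

    The program is run symbolically.  [returns f d r c] says that function [f]
    maps [d] to [r] with at most [c] operations for any large enough bound on
    the depth of calls, and that a smaller bound may only cut the computation
    off at a cost of at most [c]; the lemmas [returns_*] identify
    each function of the program with a function on lists, and the rest of the
    file is about these functions. *)

(** * Deterministic runs *)

Section Deterministic.

Variable K : fieldType.
Implicit Types (d r : data K) (m : nat -> run K).

Definition halts_with (x : run K) d c : Prop :=
  exists2 c', (c' <= c)%N & x = [:: (1, c', Done d)].

Definition cut_off (x : run K) c : Prop :=
  exists2 c', (c' <= c)%N & x = [:: (1, c', Timeout)].

(** A deterministic computation returns the same value for all large enough fuel;
    its cost is bounded at any fuel, since a truncated run is charged too. *)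
Definition computes m d c : Prop :=
  (forall fuel, halts_with (m fuel) d c \/ cut_off (m fuel) c) /\
  exists fuel0, forall fuel, (fuel0 <= fuel)%N -> halts_with (m fuel) d c.

Lemma computes_leq m d c c' :
  computes m d c -> (c <= c')%N -> computes m d c'.
Proof.
move=> [all_m [f0 lim_m]] le_cc'.
have wh x : halts_with x d c -> halts_with x d c'.
  by move=> [c1 le1 ->]; exists c1 => //; apply: leq_trans le_cc'.
split; last by exists f0 => f le_f; apply/wh/lim_m.
move=> f; case: (all_m f) => [/wh|[c1 le1 ->]]; first by left.
by right; exists c1 => //; apply: leq_trans le_cc'.
Qed.

Lemma computes_ret d : computes (fun _ => ret (Done d)) d 0.
Proof. by split; [move=> f; left; exists 0%N|exists 0%N => f _; exists 0%N]. Qed.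

Lemma computes_op d : computes (fun _ => op d) d 1.
Proof. by split; [move=> f; left; exists 1%N|exists 0%N => f _; exists 1%N]. Qed.

Definition delay c (x : run K) : run K :=
  [seq let: (w, c', o) := y in (w, (c + c')%N, o) | y <- x].

Lemma bind_done c d (k : data K -> run K) :
  bind [:: (1, c, Done d)] k = delay c (k d).
Proof.
rewrite /bind /= cats0; apply: eq_map => -[[w c'] o].
by rewrite mul1r.
Qed.

Lemma computes_bind m (k : nat -> data K -> run K) d r c1 c2 :
  computes m d c1 -> computes (fun f => k f d) r c2 ->
  computes (fun f => bind (m f) (k f)) r (c1 + c2).
Proof.
move=> [all_m [f1 lim_m]] [all_k [f2 lim_k]].
have ok f : halts_with (m f) d c1 ->
    (halts_with (k f d) r c2 -> halts_with (bind (m f) (k f)) r (c1 + c2)) /\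
    (cut_off (k f d) c2 -> cut_off (bind (m f) (k f)) (c1 + c2)).
  move=> [c le_c ->]; rewrite bind_done.
  by split=> -[c' le_c' ->]; exists (c + c')%N; rewrite ?leq_add.
split.
  move=> f; case: (all_m f) => [/ok [hh hc]|[c le_c ->]].
    by case: (all_k f) => [/hh|/hc]; [left|right].
  by right; exists c => //; apply: leq_trans le_c (leq_addr _ _).
exists (maxn f1 f2) => f; rewrite geq_max => /andP[le1 le2].
by case: (ok f (lim_m f le1)) => hh _; apply/hh/lim_k.
Qed.

Lemma computes_ext m1 m2 d c : m1 =1 m2 -> computes m1 d c -> computes m2 d c.
Proof.
by move=> e [a [f0 l]]; split=> [f|]; [|exists f0 => f]; rewrite -e; auto.
Qed.

End Deterministic.

(** * Evaluation rules *)

Section Rules.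

Variables (K : fieldType) (v : K -> int) (src : nat -> seq K).
Variables (chi : {poly K}) (P : program).
Implicit Types (d r : data K) (env : seq (data K)) (e : expr).

Definition evaluates env e d c : Prop :=
  computes (fun fuel => eval v src chi (call v src chi P fuel) false env e) d c.

Definition returns f d r c : Prop :=
  computes (fun fuel => call v src chi P fuel false f d) r c.

Lemma evaluates_sub env e d d' c c' :
  evaluates env e d c -> d = d' -> (c <= c')%N -> evaluates env e d' c'.
Proof. by move=> ev <- /(computes_leq ev). Qed.

Lemma returns_sub f a d d' c c' :
  returns f a d c -> d = d' -> (c <= c')%N -> returns f a d' c'.
Proof. by move=> ev <- /(computes_leq ev). Qed.

Lemma evaluates_var env i d :
  onth env i = Some d -> evaluates env (EVar i) d 0.
Proof.
move=> env_i; apply: computes_ext (computes_ret d) => f /=.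
by rewrite env_i.
Qed.

Lemma evaluates_let env e1 e2 d1 d2 c1 c2 :
  evaluates env e1 d1 c1 -> evaluates (d1 :: env) e2 d2 c2 ->
  evaluates env (ELet e1 e2) d2 (c1 + c2).
Proof.
move=> ev1 ev2.
exact: (computes_bind (k := fun f d1 => eval v src chi (call v src chi P f)
  false (d1 :: env) e2) ev1 ev2).
Qed.

Lemma evaluates_nil env : evaluates env ENil Nil 0.
Proof. exact: computes_ret. Qed.

Lemma evaluates_zero env : evaluates env EZero (Elt 0) 0.
Proof. exact: computes_ret. Qed.

Lemma evaluates_one env : evaluates env EOne (Elt 1) 0.
Proof. exact: computes_ret. Qed.

Lemma evaluates_cons env e1 e2 d1 d2 c1 c2 :
  evaluates env e1 d1 c1 -> evaluates env e2 d2 c2 ->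
  evaluates env (ECons e1 e2) (Cons d1 d2) (c1 + c2).
Proof.
move=> ev1 ev2; rewrite -[c2]addn0.
pose k2 := fun d1 d2 : data K => ret (Done (Cons d1 d2)).
pose k1 f d1 := bind (eval v src chi (call v src chi P f) false env e2) (k2 d1).
apply: (computes_bind (k := k1)) ev1 _.
apply: (computes_bind (k := fun=> k2 d1)) ev2 _.
exact: computes_ret.
Qed.

(** A name for the case analysis lets it be reduced without unfolding the other
    occurrences of the analysed value, which stays in the environment. *)
Definition by_case d0 (in_nil : Prop) (in_cons : data K -> data K -> Prop) :=
  match d0 with
  | Nil => in_nil
  | Cons h t => in_cons h t
  | Elt _ => False
  end.

Lemma evaluates_case env e0 e1 e2 d0 d c0 c :
  evaluates env e0 d0 c0 ->
  by_case d0 (evaluates env e1 d c)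
    (fun h t => evaluates [:: h, t & env] e2 d c) ->
  evaluates env (ECase e0 e1 e2) d (c0 + c).
Proof.
move=> ev0 ev.
pose k f d := match d with
  | Nil => eval v src chi (call v src chi P f) false env e1
  | Cons h t => eval v src chi (call v src chi P f) false [:: h, t & env] e2
  | Elt _ => ret Fault end.
apply: (computes_bind (k := k)) ev0 _.
by case: d0 ev => // h t ev.
Qed.

Lemma evaluates_call env f e d r c1 c2 :
  evaluates env e d c1 -> returns f d r c2 ->
  evaluates env (ECall f e) r (c1 + c2).
Proof.
move=> ev1 ev2.
exact: (computes_bind (k := fun fuel => call v src chi P fuel false f) ev1 ev2).
Qed.

Lemma computes_with_elt env e1 x c1 (k : nat -> K -> run K) r c :
  evaluates env e1 (Elt x) c1 -> computes (fun f => k f x) r c ->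
  computes (fun f => bind (eval v src chi (call v src chi P f) false env e1)
    (fun d => with_elt d (k f))) r (c1 + c).
Proof.
move=> ev1 ev; exact: (computes_bind (k := fun f d => with_elt d (k f)) ev1 ev).
Qed.

Lemma evaluates_arith env o e1 e2 x y z c1 c2 :
  evaluates env e1 (Elt x) c1 -> evaluates env e2 (Elt y) c2 ->
  run_arith v false o x y = op (Elt z) ->
  evaluates env (EArith o e1 e2) (Elt z) (c1 + (c2 + 1)).
Proof.
move=> ev1 ev2 op_z.
pose k2 d1 d2 := with_elt d1 (fun x => with_elt d2 (fun y => run_arith v false o x y)).
pose k1 f d1 := bind (eval v src chi (call v src chi P f) false env e2) (k2 d1).
apply: (computes_bind (k := k1)) ev1 _.
apply: (computes_bind (k := fun=> k2 (Elt x))) ev2 _.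
by rewrite /= op_z; apply: computes_op.
Qed.

Lemma evaluates_add env e1 e2 x y c1 c2 :
  evaluates env e1 (Elt x) c1 -> evaluates env e2 (Elt y) c2 ->
  evaluates env (EArith Add e1 e2) (Elt (x + y)) (c1 + (c2 + 1)).
Proof. by move=> ev1 ev2; apply: evaluates_arith ev1 ev2 _. Qed.

Lemma evaluates_sub_op env e1 e2 x y c1 c2 :
  evaluates env e1 (Elt x) c1 -> evaluates env e2 (Elt y) c2 ->
  evaluates env (EArith Sub e1 e2) (Elt (x - y)) (c1 + (c2 + 1)).
Proof. by move=> ev1 ev2; apply: evaluates_arith ev1 ev2 _. Qed.

Lemma evaluates_mul env e1 e2 x y c1 c2 :
  evaluates env e1 (Elt x) c1 -> evaluates env e2 (Elt y) c2 ->
  evaluates env (EArith Mul e1 e2) (Elt (x * y)) (c1 + (c2 + 1)).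
Proof. by move=> ev1 ev2; apply: evaluates_arith ev1 ev2 _. Qed.

Lemma evaluates_div env e1 e2 x y c1 c2 :
  evaluates env e1 (Elt x) c1 -> evaluates env e2 (Elt y) c2 ->
  legal_div v false x y ->
  evaluates env (EArith Div e1 e2) (Elt (x / y)) (c1 + (c2 + 1)).
Proof.
by move=> ev1 ev2 leg; apply: evaluates_arith ev1 ev2 _; rewrite /= leg.
Qed.

Lemma evaluates_iszero env e x c :
  evaluates env e (Elt x) c ->
  evaluates env (EIsZero e) (data_of_bool K (x == 0)) (c + 1).
Proof.
move=> ev.
apply: (computes_with_elt (k := fun _ x => op (data_of_bool K (x == 0)))) ev _.
exact: computes_op.
Qed.

Lemma returns_body f body d r c :
  onth P f = Some body -> evaluates [:: d] body r c -> returns f d r c.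
Proof.
move=> P_f [all_e [f0 lim_e]].
pose m fuel := eval v src chi (call v src chi P fuel) false [:: d] body.
have callS fuel : call v src chi P fuel.+1 false f d = m fuel.
  by rewrite /= P_f.
split=> [[|fuel]|]; first by right; exists 0%N.
  by rewrite callS; apply: all_e.
by exists f0.+1 => -[|fuel] // le_f; rewrite callS; apply: lim_e.
Qed.

End Rules.

(** * The program *)

(** Expressions with named variables: an expression is abstracted over the
    number of variables in scope, and a bound variable is given by its binding
    level, from which its de Bruijn index is recovered at each occurrence. *)
Definition hexpr := nat -> expr.

Definition hvar (level : nat) : hexpr := fun depth => EVar (depth - level.+1).
Definition hnil : hexpr := fun=> ENil.
Definition hzero : hexpr := fun=> EZero.
Definition hone : hexpr := fun=> EOne.
Definition hcons (a b : hexpr) : hexpr := fun n => ECons (a n) (b n).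
Definition hcall (f : nat) (a : hexpr) : hexpr := fun n => ECall f (a n).
Definition harith o (a b : hexpr) : hexpr := fun n => EArith o (a n) (b n).
Definition hiszero (a : hexpr) : hexpr := fun n => EIsZero (a n).
Definition hdraw (a : hexpr) : hexpr := fun n => EDraw (a n).
Definition hlet (a : hexpr) (b : hexpr -> hexpr) : hexpr :=
  fun n => ELet (a n) (b (hvar n) n.+1).
Definition hcase (a b : hexpr) (c : hexpr -> hexpr -> hexpr) : hexpr :=
  fun n => ECase (a n) (b n) (c (hvar n.+1) (hvar n) n.+2).
Definition hpair (a : hexpr) (b : hexpr -> hexpr -> hexpr) := hcase a hnil b.

Definition unary_expr (n : nat) : expr := iter n (ECons ENil) ENil.
Definition hunary (n : nat) : hexpr := fun=> unary_expr n.

(** The arguments of a function are a right comb, the last one being its tail. *)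
Definition fn1 (b : hexpr -> hexpr) : expr := b (hvar 0) 1.
Definition fn2 b := fn1 (fun a => hpair a b).
Definition fn3 b := fn1 (fun a => hpair a (fun x a => hpair a (b x))).
Definition fn4 b := fn1 (fun a => hpair a (fun x a => hpair a (fun y a =>
  hpair a (b x y)))).
Definition fn5 b := fn1 (fun a => hpair a (fun x a => hpair a (fun y a =>
  hpair a (fun z a => hpair a (b x y z))))).

Declare Scope prog_scope.
Delimit Scope prog_scope with prog.
Bind Scope prog_scope with hexpr.

Notation "a ::: b" := (hcons a b) (at level 60, right associativity) : prog_scope.
Notation "f @@ a" := (hcall f a) (at level 30, no associativity) : prog_scope.
Notation "'LET' x ':=' a 'IN' b" := (hlet a (fun x => b))
  (at level 200, x name, a at level 100, b at level 200) : prog_scope.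
Notation "a :+: b" := (harith Add a b) (at level 50) : prog_scope.
Notation "a :-: b" := (harith Sub a b) (at level 50) : prog_scope.
Notation "a :*: b" := (harith Mul a b) (at level 40) : prog_scope.
Notation "a :/: b" := (harith Div a b) (at level 40) : prog_scope.

(** Bodies are closed, so that what [b] depends on besides the entry of the
    list has to be passed along, as the first argument. *)
Definition fmap (f : nat) (b : hexpr -> hexpr -> hexpr) : expr :=
  fn2 (fun e l => hcase l hnil (fun x l => b e x ::: f @@ (e ::: l))%prog).

(** Functions are numbered by their positions in [prog]. *)
Definition f_main := 0%N. Definition f_app := 1%N. Definition f_catrev := 2%N.
Definition f_take := 3%N. Definition f_drop := 4%N. Definition f_rot := 5%N.
Definition f_chunk := 6%N. Definition f_mulu := 7%N. Definition f_pow := 8%N.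
Definition f_div := 9%N. Definition f_log := 10%N. Definition f_half := 11%N.
Definition f_zeros := 12%N. Definition f_pad := 13%N. Definition f_padd := 14%N.
Definition f_addl := 15%N. Definition f_rotl := 16%N. Definition f_rotrl := 17%N.
Definition f_horner := 18%N. Definition f_suml := 19%N. Definition f_rotzip := 20%N.
Definition f_combine := 21%N. Definition f_exps := 22%N. Definition f_mt := 23%N.
Definition f_mtall := 24%N. Definition f_padall := 25%N. Definition f_comb := 26%N.
Definition f_redall := 27%N. Definition f_overlap := 28%N. Definition f_naive := 29%N.
Definition f_cyc := 30%N. Definition f_corr := 31%N. Definition f_dot := 32%N.
Definition f_mv := 33%N. Definition f_kry := 34%N. Definition f_pows := 35%N.
Definition f_zipc := 36%N. Definition f_trans := 37%N. Definition f_piv := 38%N.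
Definition f_elim := 39%N. Definition f_gj := 40%N. Definition f_cons0 := 41%N.
Definition f_ident := 42%N. Definition f_divall := 43%N. Definition f_trim := 44%N.
Definition f_outrow := 45%N. Definition f_outmat := 46%N. Definition f_trial := 47%N.

Section Program.

Variable p : nat.

Local Open Scope prog_scope.

Definition main_body : expr :=
  fn1 (fun M =>
    LET t := hdraw (hnil ::: f_mulu @@ (M ::: f_app @@ (M ::: M))) IN
    hcase (f_trial @@ (M ::: t)) (f_main @@ M) (fun o _ => o)).

Definition app_body : expr :=
  fn2 (fun s t => hcase s t (fun x s => x ::: f_app @@ (s ::: t))).

Definition catrev_body : expr :=
  fn2 (fun s t => hcase s t (fun x s => f_catrev @@ (s ::: x ::: t))).

Definition take_body : expr :=
  fn2 (fun u s => hcase u hnil (fun _ u => hcase s hnil (fun x s =>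
    x ::: f_take @@ (u ::: s)))).

Definition drop_body : expr :=
  fn2 (fun u s => hcase u s (fun _ u => hcase s hnil (fun x s =>
    f_drop @@ (u ::: s)))).

Definition rot_body : expr :=
  fn2 (fun u s => f_app @@ (f_drop @@ (u ::: s) ::: f_take @@ (u ::: s))).

Definition chunk_body : expr :=
  fn2 (fun u s => hcase s hnil (fun _ _ =>
    f_take @@ (u ::: s) ::: f_chunk @@ (u ::: f_drop @@ (u ::: s)))).

Definition mulu_body : expr :=
  fn2 (fun u s => hcase u hnil (fun _ u =>
    f_app @@ (s ::: f_mulu @@ (u ::: s)))).

Definition pow_body : expr :=
  fn1 (fun k => hcase k (hunary 1) (fun _ k =>
    f_mulu @@ (hunary p ::: f_pow @@ k))).

Definition div_body : expr :=
  fn1 (fun u => hcase (f_drop @@ (hunary p.-1 ::: u)) hnil (fun _ u =>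
    hnil ::: f_div @@ u)).

Definition log_body : expr :=
  fn1 (fun u => hcase u hnil (fun _ _ => hnil ::: f_log @@ (f_div @@ u))).

Definition half_body : expr :=
  fn1 (fun k => hcase k hnil (fun _ k => hcase k hnil (fun _ k =>
    hnil ::: f_half @@ k))).

Definition zeros_body : expr :=
  fn1 (fun u => hcase u hnil (fun _ u => hzero ::: f_zeros @@ u)).

Definition pad_body : expr :=
  fn2 (fun u s => f_take @@ (u ::: f_app @@ (s ::: f_zeros @@ u))).

Definition padd_body : expr :=
  fn2 (fun x y => hcase x y (fun a x' => hcase y x (fun b y' =>
    (a :+: b) ::: f_padd @@ (x' ::: y')))).

Definition addl_body : expr :=
  fn2 (fun x y => hcase x y (fun a x' => hcase y x (fun b y' =>
    f_padd @@ (a ::: b) ::: f_addl @@ (x' ::: y')))).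

Definition rotl_body : expr :=
  fmap f_rotl (fun e x => f_rot @@ (e ::: x)).

Definition rotrl_body : expr :=
  fmap f_rotrl (fun e x => f_rot @@ (f_drop @@ (e ::: x) ::: x)).

Definition horner_body : expr :=
  fn2 (fun e l => hcase l hnil (fun x l =>
    f_addl @@ (x ::: f_rotrl @@ (e ::: f_horner @@ (e ::: l))))).

Definition suml_body : expr :=
  fn1 (fun l => hcase l hnil (fun x l => f_addl @@ (x ::: f_suml @@ l))).

Definition rotzip_body : expr :=
  fn2 (fun es l => hcase es hnil (fun e es => hcase l hnil (fun x l =>
    f_rotl @@ (e ::: x) ::: f_rotzip @@ (es ::: l)))).

Definition combine_body : expr :=
  fn3 (fun u es l => hcase u hnil (fun _ u =>
    f_app @@ (f_suml @@ l :::
                f_combine @@ (u ::: es ::: f_rotzip @@ (es ::: l))))).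

Definition exps_body : expr :=
  fn3 (fun u m e => hcase u hnil (fun _ u =>
    e ::: f_exps @@ (u ::: m ::: f_app @@ (m ::: e)))).

Definition mt_body : expr :=
  fn5 (fun c s e x y => hcase s
    (hcase x hnil (fun a _ => hcase y hnil (fun b _ =>
      hpair c (fun _ k => f_cyc @@ (k ::: a ::: b) ::: hnil))))
    (fun _ s => hpair c (fun m _ =>
      LET es := f_exps @@ (hunary p ::: m ::: f_div @@ e) IN
      LET n := f_pow @@ s IN
      f_combine @@ (hunary p ::: es :::
        f_mtall @@ (c ::: s ::: es ::: f_chunk @@ (n ::: x) :::
                      f_chunk @@ (n ::: y)))))).

Definition mtall_body : expr :=
  fn5 (fun c s es x y => hcase es hnil (fun e es =>
    f_mt @@ (c ::: s ::: e ::: f_horner @@ (e ::: x) ::: f_horner @@ (e ::: y)) :::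
    f_mtall @@ (c ::: s ::: es ::: x ::: y))).

Definition padall_body : expr :=
  fmap f_padall (fun u x => f_pad @@ (u ::: x)).

Definition comb_body : expr :=
  fn4 (fun a b x y => hcase x hnil (fun xi x => hcase y hnil (fun yi y =>
    (a :*: xi :+: b :*: yi) ::: f_comb @@ (a ::: b ::: x ::: y)))).

Definition redall_body : expr :=
  fmap f_redall (fun m h =>
    f_comb @@ (hone ::: hzero :-: hone ::: h ::: f_mulu @@ (hunary p :::
      f_drop @@ (f_mulu @@ (hunary p.-1 ::: m) ::: h)))).

Definition overlap_body : expr :=
  fn2 (fun m l => hcase l hnil (fun h l =>
    f_app @@ (f_take @@ (m ::: h) :::
                f_padd @@ (f_drop @@ (m ::: h) ::: f_overlap @@ (m ::: l))))).

Definition naive_body : expr :=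
  fn2 (fun y x => hcase x (f_zeros @@ y) (fun a x =>
    f_comb @@ (a ::: hone ::: y :::
      f_rot @@ (f_drop @@ (hunary 1 ::: y) ::: f_naive @@ (y ::: x))))).

Definition cyc_body : expr :=
  fn3 (fun k x y => hcase (f_drop @@ (hunary 4 ::: k)) (f_naive @@ (y ::: x))
    (fun _ _ =>
    LET h := f_half @@ k IN
    LET m := f_pow @@ h IN
    LET m1 := f_pow @@ (hnil ::: h) IN
    LET m2 := f_pow @@ (hnil ::: hnil ::: h) IN
    LET n := f_pow @@ k IN
    LET z := f_mt @@ ((m1 ::: hnil ::: hnil ::: h) ::: f_drop @@ (h ::: k) ::: hnil :::
      f_padall @@ (m2 ::: f_chunk @@ (m ::: x)) :::
      f_padall @@ (m2 ::: f_chunk @@ (m ::: y))) IN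
    LET t := f_overlap @@ (m ::: f_redall @@ (m1 ::: z)) IN
    f_pad @@ (n ::: f_padd @@ (f_take @@ (n ::: t) ::: f_drop @@ (n ::: t))))).

Definition corr_body : expr :=
  fn3 (fun k h q => hcase q hnil (fun _ q' =>
    LET n := f_pow @@ k IN
    f_take @@ (q ::: f_drop @@ (q' ::: f_cyc @@ (k ::: f_pad @@ (n ::: h) :::
      f_pad @@ (n ::: f_catrev @@ (q ::: hnil))))))).

Definition dot_body : expr :=
  fn2 (fun x y => hcase x hzero (fun a x => hcase y hzero (fun b y =>
    a :*: b :+: f_dot @@ (x ::: y)))).

Definition mv_body : expr :=
  fmap f_mv (fun x r => f_dot @@ (r ::: x)).

Definition kry_body : expr :=
  fn3 (fun u m x => hcase u hnil (fun _ u =>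
    x ::: f_kry @@ (u ::: m ::: f_mv @@ (x ::: m)))).

Definition pows_body : expr :=
  fn3 (fun u t x => hcase u hnil (fun _ u =>
    x ::: f_pows @@ (u ::: t ::: t :*: x))).

Definition zipc_body : expr :=
  fn2 (fun x t => hcase x hnil (fun a x => hcase t
    ((a ::: hnil) ::: f_zipc @@ (x ::: hnil))
    (fun r t => (a ::: r) ::: f_zipc @@ (x ::: t)))).

Definition trans_body : expr :=
  fn1 (fun l => hcase l hnil (fun x l => f_zipc @@ (x ::: f_trans @@ l))).

Definition piv_body : expr :=
  fn1 (fun l => hcase l hnil (fun r l => hpair r (fun x _ =>
    hcase (hiszero x) (r ::: l) (fun _ _ =>
    hcase (f_piv @@ l) hnil (fun q l => q ::: r ::: l))))).

Definition elim_body : expr :=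
  fmap f_elim (fun r s => hpair r (fun a r => hpair s (fun b s =>
    f_comb @@ (a ::: hzero :-: b ::: s ::: r)))).

Definition gj_body : expr :=
  fn4 (fun u d l r => hcase u (d ::: l) (fun _ u =>
    hcase (f_piv @@ r) hnil (fun q r => hpair q (fun a b =>
    f_gj @@ (u ::: a :*: d :::
      f_app @@ (f_elim @@ (q ::: l) :::
                  f_comb @@ (d ::: hzero ::: b ::: b) ::: hnil) :::
      f_elim @@ (q ::: r)))))).

Definition cons0_body : expr :=
  fmap f_cons0 (fun _ r => hzero ::: r).

Definition ident_body : expr :=
  fn1 (fun u => hcase u hnil (fun _ u =>
    (hone ::: f_zeros @@ u) ::: f_cons0 @@ (hnil ::: f_ident @@ u))).

Definition divall_body : expr :=
  fmap f_divall (fun y x => x :/: y).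

Definition trim_body : expr :=
  fn1 (fun s => hcase s hnil (fun a s =>
    LET t := f_trim @@ s IN
    hcase t (hcase (hiszero a) (a ::: hnil) (fun _ _ => hnil))
      (fun _ _ => a ::: t))).

Definition outrow_body : expr :=
  fmap f_outrow (fun e q =>
    hpair e (fun k e => hpair e (fun c e => hpair e (fun ka e =>
    hpair e (fun kd h =>
    f_trim @@ (f_divall @@ (ka ::: f_corr @@ (k ::: c :::
      f_divall @@ (kd ::: f_corr @@ (k ::: h ::: q)))))))))).

Definition outmat_body : expr :=
  fmap f_outmat (fun e h =>
    hpair e (fun k e => hpair e (fun c e => hpair e (fun ka e =>
    hpair e (fun kd l =>
    f_outrow @@ ((k ::: c ::: ka ::: kd ::: h) ::: l)))))).

Definition trial_body : expr :=
  fn2 (fun M t =>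
    LET W := f_kry @@ (f_app @@ (M ::: f_app @@ (M ::: hunary 1)) ::: M :::
                          f_pows @@ (M ::: t ::: hone)) IN
    hcase (f_gj @@ (M ::: hone ::: hnil :::
             f_trans @@ (f_app @@ (f_take @@ (M ::: W) ::: f_ident @@ M))))
      hnil (fun D L =>
    LET k := f_log @@ (f_app @@ (M ::: W)) IN
    LET o := f_pad @@ (f_pow @@ k ::: hone ::: hnil) IN
    hpair (f_cyc @@ (k ::: o ::: o)) (fun ka _ =>
    hpair (f_drop @@ (M ::: W)) (fun wn _ =>
    hpair (f_app @@ (f_divall @@ (hzero :-: D ::: f_mv @@ (wn ::: L)) :::
                       hone ::: hnil)) (fun _ c =>
    f_outmat @@ ((k ::: c ::: ka ::: ka :*: D ::: f_trans @@ L) ::: f_trans @@ W)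
      ::: hnil))))).

Definition prog : program := [::
  main_body; app_body; catrev_body; take_body; drop_body; rot_body;
  chunk_body; mulu_body; pow_body; div_body; log_body; half_body;
  zeros_body; pad_body; padd_body; addl_body; rotl_body; rotrl_body;
  horner_body; suml_body; rotzip_body; combine_body; exps_body; mt_body;
  mtall_body; padall_body; comb_body; redall_body; overlap_body;
  naive_body; cyc_body; corr_body; dot_body; mv_body; kry_body; pows_body;
  zipc_body; trans_body; piv_body; elim_body; gj_body; cons0_body;
  ident_body; divall_body; trim_body; outrow_body; outmat_body;
  trial_body
].

End Program.

(** * Symbolic execution *)

Create HintDb run_db.

(** [n] as a list of empty trees; any list can stand for its length. *)
Definition unary (K : fieldType) (n : nat) : data K :=
  data_of_seq (fun _ : unit => Nil) (nseq n tt).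

Arguments data_of_seq {K A} : simpl never.

Section SeqData.
Variable K : fieldType.

Lemma data_of_seq_nil A (enc : A -> data K) : data_of_seq enc [::] = Nil.
Proof. by []. Qed.

Lemma data_of_seq_cons A (enc : A -> data K) x s :
  data_of_seq enc (x :: s) = Cons (enc x) (data_of_seq enc s).
Proof. by []. Qed.

Lemma data_of_seq_map A B (enc : B -> data K) (g : A -> B) s :
  data_of_seq enc (map g s) = data_of_seq (fun x => enc (g x)) s.
Proof. by elim: s => //= x s IHs; rewrite !data_of_seq_cons IHs. Qed.

Lemma unaryS n : unary K n.+1 = Cons Nil (unary K n).
Proof. by []. Qed.

Lemma data_size_seq A (enc : A -> data K) s :
  data_size (data_of_seq enc s) = size s.
Proof. by elim: s => //= x s ->. Qed.

End SeqData.

Lemma flatten_nseq (A : Type) (a b : nat) (x : A) :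
  flatten (nseq a (nseq b x)) = nseq (a * b) x.
Proof. by elim: a => //= a ->; rewrite mulSn nseqD. Qed.

Ltac find_case :=
  lazymatch goal with
  | |- by_case (Cons ?x ?s) _ ?c => change (c x s); cbv beta
  | |- by_case Nil ?n _ => change n
  | |- by_case (data_of_seq ?enc (?x :: ?s)) _ ?c =>
      change (c (enc x) (data_of_seq enc s)); cbv beta
  | |- by_case (data_of_seq _ [::]) ?n _ => change n
  | |- by_case (unary _ 0) ?n _ => change n
  | |- by_case (unary ?K ?n.+1) _ ?c => change (c Nil (unary K n)); cbv beta
  | |- by_case (data_of_bool _ true) _ ?c => change (c Nil Nil); cbv beta
  | |- by_case (data_of_bool _ false) ?n _ => change n
  | |- by_case (data_of_seq _ _) _ _ => idtac
  | |- by_case ?d ?n ?c =>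
      let d' := eval hnf in d in
      lazymatch d' with
      | Cons ?x ?s => change (c x s); cbv beta
      | Nil => change n
      | _ => idtac
      end
  | |- _ => idtac
  end.

(* Runs an expression as far as the known functions allow; what is left are the
   calls and the case analyses that need an argument. *)
Ltac sym :=
  lazymatch goal with
  | |- evaluates _ _ _ _ _ (EVar _) _ _ =>
      eapply evaluates_var; reflexivity
  | |- evaluates _ _ _ _ _ ENil _ _ => eapply evaluates_nil
  | |- evaluates _ _ _ _ _ EZero _ _ => eapply evaluates_zero
  | |- evaluates _ _ _ _ _ EOne _ _ => eapply evaluates_one
  | |- evaluates _ _ _ _ _ (ECons _ _) _ _ => eapply evaluates_cons; [sym|sym]
  | |- evaluates _ _ _ _ _ (ELet _ _) _ _ => eapply evaluates_let; [sym|sym]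
  | |- evaluates _ _ _ _ _ (EArith Add _ _) _ _ =>
      eapply evaluates_add; [sym|sym]
  | |- evaluates _ _ _ _ _ (EArith Sub _ _) _ _ =>
      eapply evaluates_sub_op; [sym|sym]
  | |- evaluates _ _ _ _ _ (EArith Mul _ _) _ _ =>
      eapply evaluates_mul; [sym|sym]
  | |- evaluates _ _ _ _ _ (EArith Div _ _) _ _ =>
      eapply evaluates_div; [sym|sym|]
  | |- evaluates _ _ _ _ _ (EIsZero _) _ _ => eapply evaluates_iszero; sym
  | |- evaluates _ _ _ _ _ (ECall _ _) _ _ =>
      eapply evaluates_call; [sym|try solve [eauto 3 with run_db nocore]]
  | |- evaluates _ _ _ _ _ (ECase _ _ _) _ _ =>
      eapply evaluates_case; [sym|sym]
  | |- by_case _ _ _ => try (progress find_case; sym)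
  | |- evaluates _ _ _ _ _ (unary_expr _) _ _ => eauto with run_db nocore
  | |- _ => idtac
  end.

(** Function bodies are computed from the program, but not the constants of
    [unary_expr], whose values depend on the prime [p]. *)
Ltac body_of P f k :=
  let b := eval lazy -[unary_expr predn] in (onth P f) in
  lazymatch b with Some ?b => k b end.

Ltac enter :=
  lazymatch goal with
  | |- returns ?v ?src ?chi ?P ?f ?d ?r ?c =>
    body_of P f ltac:(fun b =>
      apply: (@returns_body _ v src chi P f b d r c); [reflexivity|])
  end.

Ltac run_expr :=
  eapply evaluates_sub; [sym|..];
  try (match goal with |- ?G => tryif has_evar G then fail else by [] end).

Ltac run := enter; run_expr.

Section Map.

Variables (K : fieldType) (v : K -> int) (src : nat -> seq K).
Variables (chi : {poly K}) (P : program).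
Local Notation evaluates := (evaluates v src chi P).
Local Notation returns := (returns v src chi P).
Local Notation dseq := (@data_of_seq K _).

Definition map_body (f : nat) (b : expr) : expr :=
  ECase (EVar 0) ENil (ECase (EVar 1) ENil
    (ECons b (ECall f (ECons (EVar 2) (EVar 1))))).

Lemma returns_map (A : eqType) B (encA : A -> data K) (encB : B -> data K)
    f b e (g : A -> B) c s :
  onth P f = Some (map_body f b) ->
  {in s, forall x l r, evaluates [:: encA x, l, e & r] b (encB (g x)) c} ->
  returns f (Cons e (dseq encA s)) (dseq encB (map g s)) (c * size s).
Proof.
move=> P_f; elim: s => [|x s IHs] ev_b; apply: (returns_body P_f).
  by eapply evaluates_sub; [rewrite /map_body; sym|..].
eapply evaluates_sub; [rewrite /map_body; sym|..].
- by apply: ev_b; rewrite mem_head.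
- by apply: IHs => y y_in; apply: ev_b; rewrite inE y_in orbT.
- by [].
- by rewrite /=; lia.
Qed.

End Map.

Ltac run_map c :=
  lazymatch goal with
  | |- returns ?v ?src ?chi ?P ?f ?d ?r ?c' =>
    body_of P f ltac:(fun b => lazymatch b with
      ECase _ _ (ECase _ _ (ECons ?b' _)) =>
        eapply returns_sub;
          [eapply (@returns_map _ v src chi P _ _ _ _ f b' _ _ c); [reflexivity|]
          |reflexivity|rewrite ?mul0n; try by []] end)
  end.

Section ListFunctions.

Variables (K : fieldType) (v : K -> int) (src : nat -> seq K).
Variables (chi : {poly K}) (p : nat).
Hypothesis p_gt1 : (1 < p)%N.

Local Notation P := (prog p).
Local Notation evaluates := (evaluates v src chi P).
Local Notation returns := (returns v src chi P).
Local Notation dseq := (@data_of_seq K _).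

Lemma evaluates_unary env n : evaluates env (unary_expr n) (unary K n) 0.
Proof.
elim: n => [|n IHn]; first exact: evaluates_nil.
exact: (evaluates_cons (evaluates_nil _ _ _ _ _) IHn).
Qed.
Hint Resolve evaluates_unary : run_db.

Lemma returns_app A (enc : A -> data K) s t :
  returns f_app (Cons (dseq enc s) (dseq enc t)) (dseq enc (s ++ t)) 0.
Proof. by elim: s => [|x s IHs]; run. Qed.
Hint Resolve returns_app : run_db.

Lemma returns_catrev A (enc : A -> data K) s t :
  returns f_catrev (Cons (dseq enc s) (dseq enc t)) (dseq enc (catrev s t)) 0.
Proof.
elim: s t => [|x s IHs] t; run.
by rewrite -data_of_seq_cons; apply: IHs.
all: by [].
Qed.
Hint Resolve returns_catrev : run_db.

Lemma returns_take A B (encA : A -> data K) (enc : B -> data K) u s :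
  returns f_take (Cons (dseq encA u) (dseq enc s)) (dseq enc (take (size u) s)) 0.
Proof. by elim: u s => [|z u IHu] [|x s]; run. Qed.
Hint Resolve returns_take : run_db.

Lemma returns_drop A B (encA : A -> data K) (enc : B -> data K) u s :
  returns f_drop (Cons (dseq encA u) (dseq enc s)) (dseq enc (drop (size u) s)) 0.
Proof. by elim: u s => [|z u IHu] [|x s]; run. Qed.
Hint Resolve returns_drop : run_db.

Lemma returns_rot A B (encA : A -> data K) (enc : B -> data K) u s :
  returns f_rot (Cons (dseq encA u) (dseq enc s)) (dseq enc (rot (size u) s)) 0.
Proof. by run. Qed.
Hint Resolve returns_rot : run_db.

Lemma returns_chunk A B (encA : A -> data K) (enc : B -> data K) u s r :
  (0 < size u)%N -> size s = (r * size u)%N ->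
  returns f_chunk (Cons (dseq encA u) (dseq enc s))
    (dseq (dseq enc) (reshape (nseq r (size u)) s)) 0.
Proof.
move=> u_gt0; elim: r s => [|r IHr] s; first by move/size0nil=> ->; run.
case: s => [|x s] sz; first by rewrite mulSn /= in sz; case: (size u) u_gt0 sz.
run.
by apply: IHr; rewrite size_drop sz mulSn addKn.
all: by [].
Qed.

Lemma returns_mulu A B (encA : A -> data K) (enc : B -> data K) u s :
  returns f_mulu (Cons (dseq encA u) (dseq enc s))
    (dseq enc (flatten (nseq (size u) s))) 0.
Proof. by elim: u => [|z u IHu]; run. Qed.
Hint Resolve returns_mulu : run_db.

Lemma returns_pow A (enc : A -> data K) k :
  returns f_pow (dseq enc k) (unary K (p ^ size k)) 0.
Proof.
elim: k => [|z k IHk]; run.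
by rewrite size_nseq flatten_nseq /= expnS.
Qed.
Hint Resolve returns_pow : run_db.

Lemma returns_div A (enc : A -> data K) u :
  returns f_div (dseq enc u) (unary K (size u %/ p)) 0.
Proof.
have [n] := ubnP (size u); elim: n => // n IHn in u *; rewrite ltnS => le_u.
case def_d: (drop p.-1 u) => [|y u'].
  have lt_u : (size u < p)%N.
    by have := size_drop p.-1 u; rewrite def_d /=; lia.
  run; first by rewrite size_nseq def_d; sym.
    by rewrite divn_small.
  by [].
have sz_u : size u = (p + size u')%N.
  by have := size_drop p.-1 u; rewrite def_d /=; lia.
run.
- rewrite size_nseq def_d; sym.
  by apply: IHn; lia.
- by rewrite sz_u divnDl ?dvdnn // divnn (ltnW p_gt1).
- by [].
Qed.
Hint Resolve returns_div : run_db.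

(** Any power of [p] that is larger than the length and of the same order will
    do, as the length of the convolutions. *)
Lemma returns_log A (enc : A -> data K) u :
  exists k, [/\ returns f_log (dseq enc u) (unary K k) 0,
    (size u < p ^ k)%N & (p ^ k <= maxn 1 (p * size u))%N].
Proof.
have [n] := ubnP (size u); elim: n => // n IHn in A enc u *; rewrite ltnS => le_u.
case: u => [|x u] in le_u *; first by exists 0%N; split; [run|rewrite expn0|lia].
pose u' := nseq (size (x :: u) %/ p) tt.
have [|k [run_k lt_k le_k]] := IHn _ (fun=> Nil) u'.
  rewrite size_nseq; apply: leq_trans le_u; exact: ltn_Pdiv.
rewrite size_nseq /= in lt_k le_k.
exists k.+1; split.
- by run.
- rewrite expnSr; move: lt_k; rewrite ltn_divLR //; exact: ltnW.
- have := leq_divM (size (x :: u)) p; rewrite expnS [size _]/=.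
  by move: (_ %/ p)%N le_k => n' le_k le_n'; nia.
Qed.

Lemma returns_half A (enc : A -> data K) u :
  returns f_half (dseq enc u) (unary K (size u)./2) 0.
Proof.
have [n] := ubnP (size u); elim: n => // n IHn in u *; rewrite ltnS => le_u.
case: u => [|x [|y u]] in le_u *; run.
  by apply: IHn; apply: ltnW.
all: by [].
Qed.
Hint Resolve returns_half : run_db.

Lemma returns_zeros A (enc : A -> data K) u :
  returns f_zeros (dseq enc u) (dseq (@Elt K) (nseq (size u) 0)) 0.
Proof. by elim: u => [|x u IHu]; run. Qed.
Hint Resolve returns_zeros : run_db.

Definition pad n (s : seq K) := take n (s ++ nseq n 0).

Lemma returns_pad A (enc : A -> data K) u s :
  returns f_pad (Cons (dseq enc u) (dseq (@Elt K) s))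
    (dseq (@Elt K) (pad (size u) s)) 0.
Proof. by run. Qed.
Hint Resolve returns_pad : run_db.

Fixpoint padd (x y : seq K) : seq K :=
  match x, y with
  | [::], _ => y
  | _, [::] => x
  | a :: x', b :: y' => a + b :: padd x' y'
  end.

Lemma returns_padd x y :
  returns f_padd (Cons (dseq (@Elt K) x) (dseq (@Elt K) y))
    (dseq (@Elt K) (padd x y)) (minn (size x) (size y)).
Proof.
elim: x y => [|a x IHx] [|b y]; run.
rewrite /=; lia.
Qed.

Fixpoint addl (x y : seq (seq K)) : seq (seq K) :=
  match x, y with
  | [::], _ => y
  | _, [::] => x
  | a :: x', b :: y' => padd a b :: addl x' y'
  end.

Local Notation poly_data := (dseq (@Elt K)).
Local Notation mat_data := (dseq poly_data).

Lemma returns_addl x y :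
  returns f_addl (Cons (mat_data x) (mat_data y)) (mat_data (addl x y))
    (sumn (shape x)).
Proof.
elim: x y => [|a x IHx] [|b y]; run.
  apply: returns_sub (returns_padd _ _) _ (geq_minl _ _).
all: by [].
Qed.
Hint Resolve returns_addl : run_db.

End ListFunctions.

(** * Fast convolution: the functions and their cost *)

Section ConvModel.

Variables (K : fieldType) (p : nat).
Implicit Types (x y : seq K) (F G : seq (seq K)).

(** A list of lists is a polynomial in [Z] with coefficients in [K[X]], modulo
    ['X^w - 1], where rotating a list is multiplying by a power of ['X].  This is
    the value at ['X^e] of a polynomial in [Z^n] whose coefficients are the [n]
    blocks, that is, a remainder modulo [Z^n - 'X^e]. *)
Definition horner_rot e (l : seq (seq (seq K))) : seq (seq K) :=
  foldr (fun F acc => addl F (map (rotr e) acc)) [::] l.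

Definition suml (l : seq (seq (seq K))) : seq (seq K) := foldr (@addl K) [::] l.

(** [rot e] divides by ['X^e], so that after [r] passes the remainders are divided by
    ['X^(r * e)], as needed in the block of index [r] of [combine]. *)
Definition rotzip (es : seq nat) (l : seq (seq (seq K))) :=
  [seq map (rot eF.1) eF.2 | eF <- zip es l].

(** Chinese remaindering along [Z^(p * n) - 'X^(p * e)], the product of the
    [Z^n - 'X^e'] for [e'] in [es], up to a factor [p]: the block of index [r] is
    the sum over [e'] of the remainders times ['X^(- r * e')]. *)
Fixpoint combine u es l : seq (seq K) :=
  if u is u'.+1 then suml l ++ combine u' es (rotzip es l) else [::].

Fixpoint exps u m e : seq nat := if u is u'.+1 then e :: exps u' m (m + e)%N else [::].

Section MulTree.
Variables (leaf : seq K -> seq K -> seq K) (m : nat).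
(** The product modulo [Z^(p ^ s) - 'X^e], up to a factor [p ^ s].  The exponents
    [es] are the [e'] such that [p * e'] is [e] modulo [p * m]. *)
Fixpoint mul_tree s e F G : seq (seq K) :=
  if s is s'.+1 then
    let es := exps p m (e %/ p)%N in
    let cut := reshape (nseq p (p ^ s')%N) in
    combine p es [seq mul_tree s' e' (horner_rot e' (cut F)) (horner_rot e' (cut G))
                 | e' <- es]
  else [:: leaf (head [::] F) (head [::] G)].
End MulTree.

Fixpoint comb (a b : K) x y : seq K :=
  match x, y with
  | xi :: x', yi :: y' => a * xi + b * yi :: comb a b x' y'
  | _, _ => [::]
  end.

(** Remainder modulo [1 + Y + .. + Y^(p-1)], with [Y = 'X^m], of a polynomial of
    degree less than [p * m]: its last block is subtracted from all of them. *)
Definition reduce m x : seq K :=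
  comb 1 (0 - 1) x (flatten (nseq p (drop (p.-1 * m)%N x))).

(** The value at ['X^m] of the polynomial with coefficients [F]: blocks longer than
    [m] overlap. *)
Definition overlap m F : seq K :=
  foldr (fun x acc => take m x ++ padd (drop m x) acc) [::] F.

Definition naive y x : seq K :=
  foldr (fun a acc => comb a 1 y (rotr 1 acc)) (nseq (size y) 0) x.

(** The blocks are padded to length [p ^ h.+2]: a product of blocks then has degree
    less than [2 * p ^ h], hence less than the degree [(p - 1) * p ^ h.+1] of the
    cyclotomic polynomial, and no information is lost modulo that polynomial.  The
    recursion needs [h.+2 < k]; products of size up to [p ^ 4] are naive.  The last
    line folds the result modulo ['X^(p ^ k) - 1]. *)
Fixpoint cyc fuel k x y : seq K :=
  if fuel isn't fuel'.+1 then naive y x else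
  if (k <= 4)%N then naive y x else
  let h := k./2 in
  let prepare x := map (pad (p ^ h.+2)%N) (reshape (nseq (p ^ (k - h))%N (p ^ h)%N) x) in
  let F := mul_tree (cyc fuel' h.+2) (p ^ h.+1)%N (k - h)%N 0%N (prepare x) (prepare y) in
  let t := overlap (p ^ h)%N (map (reduce (p ^ h.+1)%N) F) in
  pad (p ^ k)%N (padd (take (p ^ k)%N t) (drop (p ^ k)%N t)).

(** The total size of the recursive products is [p ^ 2] times the size of the
    product, while [k - 3] is divided by at least [3 / 2].  The exponent [8] is such
    that [(3 / 2) ^ 8] exceeds [9 >= p ^ 2], with room for the linear terms. *)
Definition cyc_cost k := (3 * p ^ 4 * p ^ k * maxn (k - 3) 1 ^ 8)%N.

End ConvModel.

Section Shapes.
Variable (K : fieldType) (p : nat).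
Hypothesis p_gt1 : (1 < p)%N.
Implicit Types (F G : seq (seq K)).

Lemma size_padd (x y : seq K) : size (padd x y) = maxn (size x) (size y).
Proof.
by elim: x y => [|a x IHx] [|b y] //=; rewrite ?max0n ?maxn0 ?IHx ?maxnSS.
Qed.

Lemma shape_addl r w F G :
  shape F = nseq r w -> shape G = nseq r w -> shape (addl F G) = nseq r w.
Proof.
elim: F G r => [|x F IHF] [|y G] [|r] //= [sx sF] [sy sG].
by rewrite size_padd sx sy maxnn (IHF _ r).
Qed.

Lemma shape_map (f : seq K -> seq K) F :
  (forall x, size (f x) = size x) -> shape (map f F) = shape F.
Proof. by move=> sz_f; rewrite /shape -map_comp; apply: eq_map. Qed.

Lemma shape_horner_rot e r w l : l != [::] ->
  all (fun F => shape F == nseq r w) l -> shape (horner_rot e l) = nseq r w.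
Proof.
elim: l => [|F [|G l] IHl] //= _ /andP[/eqP sF sl].
  by case: (F) sF.
by apply: shape_addl => //; rewrite shape_map ?IHl // => x; rewrite size_rotr.
Qed.

Lemma shape_suml r w l : l != [::] ->
  all (fun F => shape F == nseq r w) l -> shape (suml l) = nseq r w.
Proof.
elim: l => [|F [|G l] IHl] //= _ /andP[/eqP sF sl].
  by case: (F) sF.
by apply: shape_addl; rewrite ?IHl.
Qed.

Lemma shape_rotzip es r w (l : seq (seq (seq K))) :
  all (fun F => shape F == nseq r w) l ->
  all (fun F => shape F == nseq r w) (rotzip es l).
Proof.
elim: l es => [|F l IHl] [|e es] //= /andP[sF sl].
by rewrite shape_map ?sF ?IHl // => x; rewrite size_rot.
Qed.

Lemma size_rotzip es (l : seq (seq (seq K))) :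
  size es = size l -> size (rotzip es l) = size l.
Proof. by move=> sz; rewrite size_map size_zip sz minnn. Qed.

Lemma shape_combine u es r w l : l != [::] -> size es = size l ->
  all (fun F => shape F == nseq r w) l ->
  shape (combine u es l) = nseq (u * r) w.
Proof.
elim: u l => //= u IHu l l_n0 sz sl.
rewrite /shape map_cat -/(shape (suml l)) -/(shape (combine u _ _)).
rewrite mulSn nseqD (shape_suml l_n0 sl) IHu //.
- by rewrite -size_eq0 size_rotzip // size_eq0.
- by rewrite size_rotzip.
- exact: shape_rotzip.
Qed.

Lemma shape_reshape n r w F : shape F = nseq (n * r) w ->
  all (fun F => shape F == nseq r w) (reshape (nseq n r) F).
Proof.
elim: n F => //= n IHn F sF.
have sz_F : size F = (n.+1 * r)%N by rewrite -(size_map size) -/(shape F) sF size_nseq.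
rewrite /shape map_take -/(shape F) sF IHn ?andbT.
  by rewrite take_nseq ?mulSn ?leq_addr.
by rewrite /shape map_drop -/(shape F) sF drop_nseq mulSn addKn.
Qed.

Lemma size_exps u m e : size (exps u m e) = u.
Proof. by elim: u e => //= u IHu e; rewrite IHu. Qed.

Lemma shape_mul_tree leaf m w s e F G :
  (forall x y, size x = w -> size y = w -> size (leaf x y) = w) ->
  shape F = nseq (p ^ s) w -> shape G = nseq (p ^ s) w ->
  shape (mul_tree p leaf m s e F G) = nseq (p ^ s) w.
Proof.
move=> size_leaf; elim: s e F G => [|s IHs] e F G.
  case: F G => [|x [|? ?]] [|y [|? ?]] //= [sx] [sy].
  by rewrite size_leaf.
rewrite expnS => sF sG; rewrite /= (@shape_combine _ _ (p ^ s) w) //.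
- by rewrite -size_eq0 size_map size_exps; case: (p) p_gt1.
- by rewrite size_map.
apply/allP => _ /mapP[e' _ ->]; apply/eqP; apply: IHs.
  by apply: shape_horner_rot; [case: (p) p_gt1|apply: shape_reshape].
by apply: shape_horner_rot; [case: (p) p_gt1|apply: shape_reshape].
Qed.

Lemma size_comb (a b : K) x y : size (comb a b x y) = minn (size x) (size y).
Proof. by elim: x y => [|c x IHx] [|d y] //=; rewrite IHx minnSS. Qed.

Lemma size_naive (x y : seq K) : size (naive y x) = size y.
Proof.
elim: x => [|a x IHx] /=; first by rewrite size_nseq.
by rewrite size_comb size_rotr IHx minnn.
Qed.

Lemma size_pad n (x : seq K) : size (pad n x) = n.
Proof. by rewrite size_takel // size_cat size_nseq leq_addl. Qed.

Lemma shape_map_pad w F : shape (map (pad w) F) = nseq (size F) w.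
Proof. by elim: F => //= x F IHF; rewrite size_pad IHF. Qed.

Lemma size_cyc fuel k (x y : seq K) : size y = (p ^ k)%N ->
  size (cyc p fuel k x y) = (p ^ k)%N.
Proof.
by move=> sy; case: fuel => [|f] /=; last case: ifP; rewrite ?size_naive ?size_pad.
Qed.

End Shapes.

Section ConvCost.

Variables (K : fieldType) (v : K -> int) (src : nat -> seq K).
Variables (chi : {poly K}) (p : nat).
Hypothesis p_gt1 : (1 < p)%N.

Local Notation P := (prog p).
Local Notation evaluates := (evaluates v src chi P).
Local Notation returns := (returns v src chi P).
Local Notation dseq := (@data_of_seq K _).
Local Notation poly_data := (dseq (@Elt K)).
Local Notation mat_data := (dseq poly_data).

Hint Resolve evaluates_unary returns_app returns_catrev returns_take
  returns_drop returns_rot returns_mulu returns_pow returns_div returns_half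
  returns_zeros returns_pad returns_padd returns_addl : run_db.

Lemma returns_rotl A (enc : A -> data K) e x :
  returns f_rotl (Cons (dseq enc e) (mat_data x))
    (mat_data (map (rot (size e)) x)) 0.
Proof. by run_map 0%N => // y _ l r; run_expr. Qed.
Hint Resolve returns_rotl : run_db.

Lemma returns_rotrl A (enc : A -> data K) e x :
  returns f_rotrl (Cons (dseq enc e) (mat_data x))
    (mat_data (map (rotr (size e)) x)) 0.
Proof.
by run_map 0%N => // y _ l r; run_expr; rewrite /rotr size_drop.
Qed.
Hint Resolve returns_rotrl : run_db.

Definition volume (l : seq (seq (seq K))) := sumn [seq sumn (shape F) | F <- l].

Lemma returns_horner A (enc : A -> data K) e l :
  returns f_horner (Cons (dseq enc e) (dseq mat_data l))
    (mat_data (horner_rot (size e) l)) (volume l).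
Proof. by elim: l => [|F l IHl]; run; rewrite /volume /=; lia. Qed.

Lemma returns_suml l :
  returns f_suml (dseq mat_data l) (mat_data (suml l)) (volume l).
Proof. by elim: l => [|F l IHl]; run; rewrite /volume /=; lia. Qed.

Lemma returns_rotzip es l :
  returns f_rotzip (Cons (dseq (unary K) es) (dseq mat_data l))
    (dseq mat_data (rotzip es l)) 0.
Proof.
elim: es l => [|e es IHe] [|F l]; run.
by rewrite size_nseq.
Qed.
Hint Resolve returns_rotzip : run_db.

Lemma volume_shape r w (l : seq (seq (seq K))) :
  all (fun F => shape F == nseq r w) l -> volume l = (size l * (r * w))%N.
Proof.
elim: l => //= F l IHl /andP[/eqP sF sl].
by rewrite /volume /= sF sumn_nseq -/(volume l) IHl // mulSn mulnC.
Qed.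

Lemma returns_combine u es r w l : size es = size l ->
  all (fun F => shape F == nseq r w) l ->
  returns f_combine (Cons (unary K u) (Cons (dseq (unary K) es) (dseq mat_data l)))
    (mat_data (combine u es l)) (u * (size l * (r * w))).
Proof.
elim: u l => [|u IHu] l sz sl; run.
- exact: returns_suml.
- by apply: IHu; rewrite ?size_rotzip //; apply: shape_rotzip.
- by [].
- by rewrite size_rotzip // (volume_shape sl) /=; lia.
Qed.

Lemma returns_exps u m e :
  returns f_exps (Cons (unary K u) (Cons (unary K m) (unary K e)))
    (dseq (unary K) (exps u m e)) 0.
Proof.
elim: u e => [|u IHu] e; run.
  by rewrite -nseqD; apply: IHu.
all: by [].
Qed.
Hint Resolve returns_exps : run_db.

Lemma returns_comb a b (x y : seq K) :
  returns f_comb (Cons (Elt a) (Cons (Elt b) (Cons (poly_data x) (poly_data y))))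
    (poly_data (comb a b x y)) (3 * minn (size x) (size y)).
Proof. by elim: x y => [|c x IHx] [|d y]; run; rewrite /=; lia. Qed.

Hint Resolve returns_comb : run_db.

Lemma returns_padall A (enc : A -> data K) w (F : seq (seq K)) :
  returns f_padall (Cons (dseq enc w) (mat_data F))
    (mat_data (map (pad (size w)) F)) 0.
Proof. by run_map 0%N => // y _ l r; run_expr. Qed.
Hint Resolve returns_padall : run_db.

Lemma returns_redall m (F : seq (seq K)) :
  {in F, forall x, size x = (p * m)%N} ->
  returns f_redall (Cons (unary K m) (mat_data F))
    (mat_data (map (reduce p m) F)) ((3 * (p * m)).+1 * size F).
Proof.
move=> sz_F; run_map (3 * (p * m)).+1%N => // x /sz_F sz_x l r; run_expr.
  by rewrite /reduce !size_nseq flatten_nseq size_nseq.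
by rewrite sz_x; lia.
Qed.

Lemma returns_overlap A (enc : A -> data K) m w (F : seq (seq K)) :
  {in F, forall x, size x <= w}%N ->
  returns f_overlap (Cons (dseq enc m) (mat_data F))
    (poly_data (overlap (size m) F)) (w * size F).
Proof.
elim: F => [|x F IHF] sz_F; run.
  by apply: IHF => y y_in; apply: sz_F; rewrite inE y_in orbT.
- by [].
- have := sz_F x (mem_head _ _); rewrite size_drop /= mulnS.
  set y := overlap _ _; lia.
Qed.

Lemma returns_naive (x y : seq K) : (0 < size y)%N ->
  returns f_naive (Cons (poly_data y) (poly_data x)) (poly_data (naive y x))
    (3 * size y * size x).
Proof.
move=> sz_y; elim: x => [|a x IHx]; run.
  by rewrite size_drop /= /rotr size_naive.
by rewrite size_rot size_naive /=; lia.
Qed.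

Section MulTreeCost.

Variables (leaf : seq K -> seq K -> seq K) (m k w T : nat).
Hypothesis size_leaf :
  forall x y, size x = w -> size y = w -> size (leaf x y) = w.
Hypothesis returns_leaf : forall x y, size x = w -> size y = w ->
  returns f_cyc (Cons (unary K k) (Cons (poly_data x) (poly_data y)))
    (poly_data (leaf x y)) T.

Local Notation context := (Cons (unary K m) (unary K k)).

Lemma returns_mul_tree s e F G :
  shape F = nseq (p ^ s) w -> shape G = nseq (p ^ s) w ->
  returns f_mt
    (Cons context (Cons (unary K s) (Cons (unary K e)
      (Cons (mat_data F) (mat_data G)))))
    (mat_data (mul_tree p leaf m s e F G)) (p ^ s * (T + 3 * p * (s * w))).
Proof.
elim: s e F G => [|s IHs] e F G.
  case: F G => [|x [|? ?]] [|y [|? ?]] //= [sx] [sy].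
  run; last by lia.
have p_gt0 : (0 < p)%N by apply: ltnW.
rewrite expnS => sF sG.
have ps_gt0 : (0 < p ^ s)%N by rewrite expn_gt0 p_gt0.
have sz_shape (H : seq (seq K)) n : shape H = nseq n w -> size H = n.
  by move=> sH; rewrite -(size_map size) -/(shape H) sH size_nseq.
pose cut := @reshape (seq K) (nseq p (p ^ s)%N).
have scut H : shape H = nseq (p * p ^ s) w ->
    all (fun H => shape H == nseq (p ^ s) w) (cut H) by apply: shape_reshape.
have vcut H : shape H = nseq (p * p ^ s) w -> volume (cut H) = (p * (p ^ s * w))%N.
  by move=> sH; rewrite (volume_shape (scut H sH)) size_reshape size_nseq.
have shapeH e' H : shape H = nseq (p * p ^ s) w ->
    shape (horner_rot e' (cut H)) = nseq (p ^ s) w.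
  move=> sH; apply: shape_horner_rot (scut H sH).
  by rewrite -size_eq0 size_reshape size_nseq -lt0n.
set cost := (p ^ s * (T + 3 * p * (s * w)))%N in IHs.
have returns_mtall es :
  returns f_mtall (Cons context (Cons (unary K s) (Cons (dseq (unary K) es)
      (Cons (dseq mat_data (cut F)) (dseq mat_data (cut G))))))
    (dseq mat_data [seq mul_tree p leaf m s e' (horner_rot e' (cut F))
       (horner_rot e' (cut G)) | e' <- es])
    (size es * (cost + 2 * (p * (p ^ s * w)))).
  elim: es => [|e' es IHes]; run.
  - by apply: returns_horner.
  - by apply: returns_horner.
  - by rewrite size_nseq; apply: IHs; apply: shapeH.
  - by [].
  - by rewrite !vcut //=; lia.
have returns_cut H : shape H = nseq (p * p ^ s) w ->
    returns f_chunk (Cons (unary K (p ^ size (nseq s tt))) (mat_data H))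
      (dseq mat_data (cut H)) 0.
  move=> sH; eapply returns_sub; [apply: (@returns_chunk _ _ _ _ _ _ _ _ _ _ _ p)|..].
  - by rewrite !size_nseq.
  - by rewrite !size_nseq (sz_shape _ _ sH).
  - by rewrite !size_nseq.
  - by [].
run.
- apply: (@returns_combine _ _ (p ^ s) w); first by rewrite size_map.
  apply/allP => _ /mapP[e' _ ->]; apply/eqP.
  by apply: shape_mul_tree => //; apply: shapeH.
- by rewrite /= size_nseq.
- by rewrite size_map !size_exps  /cost ?size_nseq; nia.
Qed.

End MulTreeCost.

Lemma size_reduce m (x : seq K) : size x = (p * m)%N -> size (reduce p m x) = (p * m)%N.
Proof.
move=> sz_x; rewrite size_comb (size_flatten, sumn_nseq) /shape map_nseq sumn_nseq.
rewrite size_drop sz_x -mulnBl.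
have -> : (p - p.-1 = 1)%N by lia.
by rewrite mul1n mulnC minnn.
Qed.

Hypothesis p_le3 : (p <= 3)%N.

(** The three terms are the transform with its recursive products, the reductions
    and overlapping additions, and the final folding. *)
Lemma cyc_costS k : (4 < k)%N ->
  (p ^ (k - k./2) * (cyc_cost p k./2.+2 + 3 * p * ((k - k./2) * p ^ k./2.+2)) +
   5 * p ^ (k - k./2) * p ^ k./2.+2 + p ^ k <= cyc_cost p k)%N.
Proof.
move=> k_gt4; rewrite /cyc_cost.
set h := k./2; have h_ge2 : (2 <= h)%N by rewrite /h; lia.
have k_ge : (h.*2 <= k)%N by rewrite /h; lia.
have -> : (maxn (h.+2 - 3) 1 = h.-1)%N by lia.
have -> : (maxn (k - 3) 1 = k - 3)%N by lia.
have pk : (p ^ (k - h) * p ^ h.+2 = p ^ 2 * p ^ k)%N.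
  by rewrite -!expnD; congr (_ ^ _)%N; lia.
have C_ge : (48 <= 3 * p ^ 4)%N by rewrite -[48%N]/(3 * 2 ^ 4)%N leq_mul2l leq_exp2r.
have p2 : (p ^ 2 <= 9)%N by rewrite -[9%N]/(3 ^ 2)%N leq_exp2r.
(* 25 is less than (3 / 2) ^ 8, and h - 1 at most 2 (k - 3) / 3 as k > 4. *)
have bigAB : (25 * h.-1 ^ 8 <= (k - 3) ^ 8)%N.
  rewrite -(@leq_pmul2l (2 ^ 8)) // mulnA -expnMn.
  apply: (@leq_trans (3 ^ 8 * h.-1 ^ 8)); first by rewrite leq_mul2r orbT.
  by rewrite -expnMn leq_exp2r //; lia.
have bigB : (128 * (k - 3) <= (k - 3) ^ 8)%N.
  rewrite [leqRHS](expnSr _ 7) leq_mul2r -[128%N]/(2 ^ 7)%N leq_exp2r //.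
  by apply/orP; right; lia.
set C := (3 * p ^ 4)%N in C_ge *; set A := (h.-1 ^ 8)%N in bigAB *.
set B := ((k - 3) ^ 8)%N in bigAB bigB *.
have -> : (p ^ (k - h) * (C * p ^ h.+2 * A + 3 * p * ((k - h) * p ^ h.+2)) +
    5 * p ^ (k - h) * p ^ h.+2 + p ^ k =
    (p ^ (k - h) * p ^ h.+2) * (C * A + 3 * p * (k - h) + 5) + p ^ k)%N by ring.
rewrite pk.
have -> : (p ^ 2 * p ^ k * (C * A + 3 * p * (k - h) + 5) + p ^ k =
   p ^ k * (p ^ 2 * (C * A + 3 * p * (k - h) + 5) + 1))%N by ring.
have -> : (C * p ^ k * B = p ^ k * (C * B))%N by ring.
rewrite leq_mul2l; apply/orP; right.
have CA : (25 * (C * A) <= C * B)%N.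
  by rewrite !(mulnCA _ C) leq_mul2l bigAB orbT.
have CB : (48 * B <= C * B)%N by rewrite leq_mul2r C_ge orbT.
apply: (@leq_trans (9 * (C * A + 9 * k + 5) + 1)).
  rewrite leq_add2r; apply: leq_mul => //; rewrite leq_add2r leq_add2l.
  by apply: leq_mul; rewrite ?leq_subr // (@leq_mul 3 _ 3 3).
clear bigAB; clearbody A B C.
by move: (C * A)%N (C * B)%N CA CB => ? ? ? ?; lia.
Qed.

Lemma returns_cyc_small k (x y : seq K) : (k <= 4)%N ->
  size x = (p ^ k)%N -> size y = (p ^ k)%N ->
  returns f_cyc (Cons (unary K k) (Cons (poly_data x) (poly_data y)))
    (poly_data (naive y x)) (cyc_cost p k).
Proof.
move=> le_k4 sx sy; have p_gt0 : (0 < p)%N by apply: ltnW.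
run.
- rewrite !size_nseq drop_oversize ?size_nseq //; sym.
  by apply: returns_naive; rewrite sy expn_gt0 p_gt0.
- by [].
rewrite sx sy /cyc_cost.
have le_pk : (p ^ k <= p ^ 4)%N by rewrite leq_exp2l.
have B_gt0 : (0 < maxn (k - 3) 1 ^ 8)%N by rewrite expn_gt0; lia.
move: (p ^ k)%N (p ^ 4)%N (maxn _ _ ^ 8)%N le_pk B_gt0 => a b c ? ?.
have : (a * a <= a * b * c)%N by rewrite -mulnA leq_mul2l; nia.
nia.
Qed.

Lemma returns_powS h :
  returns f_pow (Cons Nil (unary K h)) (unary K (p ^ h.+1)) 0.
Proof.
rewrite -unaryS; eapply returns_sub; [apply: returns_pow|..] => //.
by rewrite size_nseq.
Qed.

Lemma returns_powSS h :
  returns f_pow (Cons Nil (Cons Nil (unary K h))) (unary K (p ^ h.+2)) 0.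
Proof. by rewrite -unaryS; apply: returns_powS. Qed.

Lemma returns_pow_unary k : returns f_pow (unary K k) (unary K (p ^ k)) 0.
Proof.
eapply returns_sub; [apply: returns_pow|..] => //; by rewrite size_nseq.
Qed.

Lemma returns_half_unary k : returns f_half (unary K k) (unary K k./2) 0.
Proof.
eapply returns_sub; [apply: returns_half|..] => //; by rewrite size_nseq.
Qed.

Lemma returns_chunk_unary r n (x : seq K) : size x = (p ^ (r + n))%N ->
  returns f_chunk (Cons (unary K (p ^ n)) (poly_data x))
    (mat_data (reshape (nseq (p ^ r)%N (p ^ n)%N) x)) 0.
Proof.
move=> sz; eapply returns_sub; [apply: (returns_chunk _ _ _ _ _ _ (r := (p ^ r)%N))|..].
- by rewrite size_nseq expn_gt0 ltnW.
- by rewrite size_nseq -expnD.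
- by rewrite size_nseq.
- by [].
Qed.

Hint Resolve returns_powS returns_powSS returns_half_unary
  returns_pow_unary : run_db.

Lemma returns_cyc fuel k (x y : seq K) : (k <= fuel)%N ->
  size x = (p ^ k)%N -> size y = (p ^ k)%N ->
  returns f_cyc (Cons (unary K k) (Cons (poly_data x) (poly_data y)))
    (poly_data (cyc p fuel k x y)) (cyc_cost p k).
Proof.
have p_gt0 : (0 < p)%N by apply: ltnW.
elim: fuel k x y => [|fuel IHf] k x y.
  by rewrite leqn0 => /eqP->; apply: returns_cyc_small.
move=> le_k sx sy; rewrite [cyc _ _ _ _ _]/=; case: ifP => le_k4.
  exact: returns_cyc_small.
set h := k./2; set w := (p ^ h.+2)%N.
have le_hk : (h <= k)%N by rewrite /h; lia.
set prepare := fun x : seq K => map (pad w) (reshape (nseq (p ^ (k - h))%N (p ^ h)%N) x).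
rewrite -/(prepare x) -/(prepare y).
set F := mul_tree _ _ _ _ _ _ _.
have returns_prepare z : size z = (p ^ k)%N ->
    returns f_chunk (Cons (unary K (p ^ h)) (poly_data z))
      (mat_data (reshape (nseq (p ^ (k - h))%N (p ^ h)%N) z)) 0.
  by move=> sz; apply: returns_chunk_unary; rewrite subnK.
have shape_prepare z : size z = (p ^ k)%N -> shape (prepare z) = nseq (p ^ (k - h)) w.
  by move=> sz; rewrite shape_map_pad size_reshape size_nseq.
have size_leaf (a b : seq K) : size a = w -> size b = w -> size (cyc p fuel h.+2 a b) = w.
  by move=> _ sb; apply: size_cyc.
have shapeF : shape F = nseq (p ^ (k - h)) w.
  by apply: shape_mul_tree => //; apply: shape_prepare.
have sizeF : {in F, forall z, size z = w}.
  by move=> z z_in; move: (map_f size z_in); rewrite -/(shape F) shapeF mem_nseq => /andP[_ /eqP].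
have sizeF' : {in map (reduce p (p ^ h.+1)) F, forall z, size z = w}.
  by move=> _ /mapP[z /sizeF sz ->]; rewrite /w [RHS]expnS; apply: size_reduce; rewrite -expnS.
set t := overlap _ _; set cost := cyc_cost p h.+2.
have returns_tree : returns f_mt (Cons (Cons (unary K (p ^ h.+1)) (unary K h.+2))
    (Cons (unary K (k - h)) (Cons Nil (Cons (mat_data (prepare x)) (mat_data (prepare y))))))
    (mat_data F) (p ^ (k - h) * (cost + 3 * p * ((k - h) * w))).
  apply: (@returns_mul_tree _ _ _ _ _ size_leaf _ _ 0%N); try exact: shape_prepare.
  by move=> a b sa sb; apply: IHf => //; rewrite /h; lia.
have returns_red : returns f_redall (Cons (unary K (p ^ h.+1)) (mat_data F))
    (mat_data (map (reduce p (p ^ h.+1)) F)) ((3 * w).+1 * size F).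
  by rewrite /w [(p ^ _.+2)%N]expnS; apply: returns_redall => z /sizeF; rewrite -expnS.
have returns_over : returns f_overlap (Cons (unary K (p ^ h))
    (mat_data (map (reduce p (p ^ h.+1)) F))) (poly_data t) (w * size F).
  eapply returns_sub; [apply: (@returns_overlap _ _ _ w)|..].
  - by move=> z /sizeF' ->.
  - by rewrite size_nseq.
  - by rewrite size_map.
have size_F : size F = (p ^ (k - h))%N.
  by rewrite -(size_map size) -/(shape F) shapeF size_nseq.
run.
- rewrite size_nseq drop_nseq.
  have -> : (k - 4 = (k - 5).+1)%N by lia.
  rewrite [nseq _ _]/=; sym.
- rewrite drop_nseq !size_nseq; exact: returns_tree.
- by rewrite !size_nseq.
apply: leq_trans (cyc_costS _); last by lia.
rewrite -/h -/w -/cost size_F size_nseq.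
have w_gt0 : (0 < w)%N by rewrite expn_gt0 p_gt0.
have := geq_minl (size (take (p ^ k) t)) (size (drop (p ^ k) t)).
have := size_take_min (p ^ k) t.
have : (p ^ (k - h) * 1 <= p ^ (k - h) * w)%N by rewrite leq_mul2l w_gt0 orbT.
lia.
Qed.

End ConvCost.

(** * Fast convolution: correctness *)

Section Congruence.
Variable A : comNzRingType.
Implicit Types g a b : A.

(** A congruence modulo the ideal generated by [g]; the rings in question are
    polynomial rings over quotient rings that need not be domains. *)
Definition cong g a b := exists q, a = b + q * g.

Lemma cong_refl g a : cong g a a.
Proof. by exists 0; rewrite mul0r addr0. Qed.

Lemma cong_trans g a b c : cong g a b -> cong g b c -> cong g a c.
Proof. by move=> [q ->] [q' ->]; exists (q' + q); rewrite mulrDl addrA. Qed.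

Lemma cong_sym g a b : cong g a b -> cong g b a.
Proof. by move=> [q ->]; exists (- q); ring. Qed.

Lemma congD g a b c d : cong g a b -> cong g c d -> cong g (a + c) (b + d).
Proof. by move=> [q ->] [q' ->]; exists (q + q'); ring. Qed.

Lemma congM g a b c d : cong g a b -> cong g c d -> cong g (a * c) (b * d).
Proof. by move=> [q ->] [q' ->]; exists (q * d + b * q' + q * q' * g); ring. Qed.

Lemma cong_mull g c a b : cong g a b -> cong g (c * a) (c * b).
Proof. exact/congM/cong_refl. Qed.

Lemma cong_dvd g h c a b : cong g a b -> cong h (c * g) 0 ->
  cong h (c * a) (c * b).
Proof.
move=> [q ->] [q' e]; exists (q * q'); rewrite mulrDr mulrCA e add0r.
by rewrite mulrA.
Qed.

Lemma cong_sum (I : eqType) (s : seq I) g (a b : I -> A) :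
  {in s, forall i, cong g (a i) (b i)} ->
  cong g (\sum_(i <- s) a i) (\sum_(i <- s) b i).
Proof.
move=> ab; rewrite big_seq_cond [X in cong _ _ X]big_seq_cond.
elim/big_rec2: _ => [|i x z /andP[i_s _] IH]; first exact: cong_refl.
by apply: congD => //; apply: ab.
Qed.

End Congruence.

(** Powers of a root of the cyclotomic polynomial of prime order are again
    roots of it. *)
Lemma root_of_unity_sum (Q : comNzRingType) (p : nat) (z : Q) (r : nat) :
  prime p -> \sum_(j < p) z ^+ j = 0 -> (0 < r < p)%N ->
  \sum_(j < p) (z ^+ r) ^+ j = 0.
Proof.
move=> p_pr z0 /andP[r_gt0 r_lt].
have p_gt0 := prime_gt0 p_pr.
have zp : z ^+ p = 1.
  by apply/eqP; rewrite -subr_eq0 subrX1 z0 mulr0.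
pose h (j : 'I_p) : 'I_p := Ordinal (ltn_pmod (r * j) p_gt0).
have h_inj : injective h.
  suff lt_inj (i j : 'I_p) : (i < j)%N -> h i <> h j.
    move=> i j hij; apply: val_inj => /=.
    by case: (ltngtP (i : nat) j) => // [/lt_inj|/lt_inj]; rewrite hij.
  move=> lt_ij /(congr1 (@nat_of_ord p)) hij.
  have {hij}: (r * j == r * i %[mod p])%N by apply/eqP; symmetry; exact: hij.
  rewrite eqn_mod_dvd ?leq_mul2l ?(ltnW lt_ij) ?orbT // -mulnBr Euclid_dvdM //.
  case/orP; first by rewrite gtnNdvd.
  rewrite gtnNdvd // ?subn_gt0 //.
  exact: leq_ltn_trans (leq_subr _ _) (ltn_ord j).
rewrite -[RHS]z0 [RHS](reindex_inj h_inj) /=.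
apply: eq_bigr => j _; rewrite -exprM {1}(divn_eq (r * j) p).
by rewrite exprD mulnC exprM zp expr1n mul1r.
Qed.

Section PolyLists.
Variable R : nzRingType.
Implicit Types (s t : seq R).

Lemma Poly_cat s t : Poly (s ++ t) = Poly s + 'X^(size s) * Poly t.
Proof.
elim: s => [|a s IHs] /=; first by rewrite add0r mul1r.
rewrite !cons_poly_def IHs mulrDl addrAC exprSr -!mulrA.
by rewrite -(commr_polyX (Poly t)).
Qed.

Lemma Poly_nseq0 n : Poly (nseq n (0 : R)) = 0.
Proof. by elim: n => //= n ->; rewrite cons_poly_def mul0r add0r. Qed.

Lemma size_Poly_cat0 s n : (size (Poly (s ++ nseq n (0 : R)%R)) <= size s)%N.
Proof. by rewrite Poly_cat Poly_nseq0 mulr0 addr0 size_Poly. Qed.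

Lemma Poly_flatten r s : Poly (flatten (nseq r s)) =
  (\sum_(j < r) 'X^(size s * j)) * Poly s :> {poly R}.
Proof.
elim: r => [|r IHr] /=; first by rewrite big_ord0 mul0r.
rewrite Poly_cat IHr big_ord_recl muln0 mulrDl mul1r mulrA mulr_sumr.
congr (_ + _ * _); apply: eq_bigr => j _.
by rewrite -exprD mulnS.
Qed.

End PolyLists.

Section PolyField.
Variable K : fieldType.
Implicit Types (x y : seq K).

Lemma Poly_padd x y : Poly (padd x y) = Poly x + Poly y.
Proof.
elim: x y => [|a x IHx] [|b y] /=; rewrite ?add0r ?addr0 //.
by rewrite !cons_poly_def IHx polyCD; ring.
Qed.

Lemma Poly_comb a b x y : size x = size y ->
  Poly (comb a b x y) = a *: Poly x + b *: Poly y.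
Proof.
elim: x y => [|c x IHx] [|d y] //=; first by rewrite !scaler0 addr0.
move=> [sz]; rewrite !cons_poly_def IHx // polyCD !polyCM -!mul_polyC; ring.
Qed.

Lemma Poly_pad n x : (size x <= n)%N -> Poly (pad n x) = Poly x.
Proof.
move=> sz; rewrite /pad take_cat ltnNge sz /= take_nseq ?leq_subr //.
by rewrite Poly_cat Poly_nseq0 mulr0 addr0.
Qed.

(** Rotating is dividing by a power of ['X], modulo ['X^(size x) - 1]. *)
Lemma Poly_rot e x : (e <= size x)%N ->
  'X^e * Poly (rot e x) = Poly x + Poly (take e x) * ('X^(size x) - 1).
Proof.
move=> le_e; rewrite -{2}(cat_take_drop e x) !Poly_cat size_drop size_takel //.
by rewrite mulrDr mulrA -exprD subnKC //; ring.
Qed.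

Lemma Poly_rotr e x : (e <= size x)%N ->
  Poly (rotr e x) = 'X^e * Poly x - Poly (take e (rotr e x)) * ('X^(size x) - 1).
Proof.
move=> le_e; have := @Poly_rot e (rotr e x); rewrite size_rotr rotrK => -> //.
by ring.
Qed.

Lemma Poly_naive y x : (0 < size y)%N ->
  cong ('X^(size y) - 1) (Poly (naive y x)) (Poly x * Poly y).
Proof.
move=> sz_y; elim: x => [|a x IHx] /=.
  by rewrite Poly_nseq0 mul0r; apply: cong_refl.
rewrite -/(naive y x) Poly_comb ?size_rotr ?size_naive // scale1r.
rewrite Poly_rotr ?size_naive // expr1 cons_poly_def -mul_polyC.
have [q ->] := IHx; set t := Poly (take _ _).
by exists ('X * q - t); ring.
Qed.

End PolyField.

Section MulTree.

Variables (K : fieldType) (p : nat) (Q : comNzRingType).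
Variables (rho : {rmorphism {poly K} -> Q}) (m : nat).
Hypotheses (p_pr : prime p) (m_gt0 : (0 < m)%N).
Implicit Types (x : seq K) (F G : seq (seq K)).

Let p_gt0 := prime_gt0 p_pr.
Let w := (p * m)%N.
Let y := rho 'X.
Hypothesis cyclo : \sum_(j < p) (y ^+ m) ^+ j = 0.

Let val x := rho (Poly x).
Let biv F : {poly Q} := Poly (map val F).

Lemma cyclo_expr1 : y ^+ w = 1.
Proof. by apply/eqP; rewrite /w mulnC exprM -subr_eq0 subrX1 cyclo mulr0. Qed.

Lemma val_padd x1 x2 : val (padd x1 x2) = val x1 + val x2.
Proof. by rewrite /val Poly_padd rmorphD. Qed.

Lemma val_rot e x : size x = w -> (e <= w)%N -> y ^+ e * val (rot e x) = val x.
Proof.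
move=> sz le_e; rewrite /val /y -rmorphXn -rmorphM Poly_rot ?sz //.
by rewrite rmorphD rmorphM rmorphB rmorphXn cyclo_expr1 rmorph1 subrr mulr0 addr0.
Qed.

Lemma val_rotr e x : size x = w -> (e <= w)%N -> val (rotr e x) = y ^+ e * val x.
Proof.
move=> sz le_e; rewrite -{2}(rotrK e x) val_rot //.
  by rewrite size_rotr.
Qed.

Lemma biv_cons x F : biv (x :: F) = biv F * 'X + (val x)%:P.
Proof. by rewrite /biv /= cons_poly_def. Qed.

Lemma biv_cat F G : biv (F ++ G) = biv F + 'X^(size F) * biv G.
Proof. by rewrite /biv map_cat Poly_cat size_map. Qed.

Lemma biv_addl F G : biv (addl F G) = biv F + biv G.
Proof.
elim: F G => [|x F IHF] [|z G] /=; rewrite ?[biv [::]]/= ?add0r ?addr0 //.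
by rewrite !biv_cons IHF val_padd polyCD; ring.
Qed.

Lemma biv_suml l : biv (suml l) = \sum_(F <- l) biv F.
Proof.
elim: l => [|F l IHl]; first by rewrite big_nil.
by rewrite big_cons -IHl -biv_addl.
Qed.

Lemma biv_map_scale (f : seq K -> seq K) c F :
  {in F, forall x, val (f x) = c * val x} -> biv (map f F) = c%:P * biv F.
Proof.
elim: F => [|x F IHF] val_f; first by rewrite mulr0.
rewrite /= !biv_cons IHF; last by move=> z zF; apply: val_f; rewrite inE zF orbT.
by rewrite val_f ?mem_head // polyCM; ring.
Qed.

Lemma shape_mem r F : shape F = nseq r w -> {in F, forall x, size x = w}.
Proof.
by move=> sF x xF; have := map_f size xF; rewrite -/(shape F) sF mem_nseq => /andP[_ /eqP].
Qed.

Lemma shape_size r F : shape F = nseq r w -> size F = r.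
Proof. by move=> sF; rewrite -(size_map size) -/(shape F) sF size_nseq. Qed.

Lemma biv_rotr e r F : shape F = nseq r w -> (e <= w)%N ->
  biv (map (rotr e) F) = (y ^+ e)%:P * biv F.
Proof. by move=> sF le_e; apply: biv_map_scale => x /(shape_mem sF) sx; apply: val_rotr. Qed.

Let inv e := y ^+ (w - e).

Lemma invP e : (e <= w)%N -> y ^+ e * inv e = 1.
Proof. by move=> le_e; rewrite -exprD subnKC // cyclo_expr1. Qed.

Lemma biv_rot e r F : shape F = nseq r w -> (e <= w)%N ->
  biv (map (rot e) F) = (inv e)%:P * biv F.
Proof.
move=> sF le_e; apply: biv_map_scale => x /(shape_mem sF) sx.
by rewrite -(val_rot sx le_e) mulrA [inv e * _]mulrC invP // mul1r.
Qed.

(** The inverse transform, evaluated in a ring [Q] where rotations are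
    multiplications by powers of the root of unity [y]. *)
Lemma biv_combine u es n l : size es = size l -> l != [::] ->
  all (fun F => shape F == nseq n w) l -> all (fun e => e <= w)%N es ->
  biv (combine u es l) = \sum_(r < u) 'X^(n * r) *
     \sum_(eF <- zip es l) (inv eF.1 ^+ r)%:P * biv eF.2.
Proof.
elim: u l => [|u IHu] l sz l_n0 sl le_es; first by rewrite big_ord0.
rewrite big_ord_recl muln0 expr0 mul1r.
rewrite [combine _ _ _]/= biv_cat biv_suml (shape_size (shape_suml l_n0 sl)).
rewrite IHu ?size_rotzip ?shape_rotzip //; last first.
  by rewrite -size_eq0 size_rotzip // size_eq0.
congr (_ + _).
  rewrite -[in LHS](unzip2_zip (_ : size l <= size es)%N) ?sz // big_map.
  by apply: eq_bigr => eF _; rewrite expr0 mul1r.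
rewrite mulr_sumr; apply: eq_bigr => r _.
rewrite mulrA -exprD -mulnS; congr (_ * _).
have : all (fun eF => (eF.1 <= w)%N && (shape eF.2 == nseq n w)) (zip es l).
  elim: l es sz l_n0 sl le_es {IHu} => [|F l IHl] [|e es] //= [sz] _ /andP[-> sl].
  by case/andP=> -> le_es; case: l IHl sl sz => [|G l] IHl sl sz; [case: es sz {le_es}|apply: IHl].
have -> : zip es (rotzip es l) = [seq (eF.1, map (rot eF.1) eF.2) | eF <- zip es l].
  by elim: l es {sz l_n0 sl le_es IHu} => [|F l IHl] [|e es] //=; rewrite -IHl.
rewrite big_map => /allP all_ok; apply: eq_big_seq => -[e F] /all_ok /andP[/= le_e /eqP sF].
by rewrite (biv_rot sF) // mulrA -polyCM -exprSr.
Qed.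

Lemma big_exps (A : nmodType) u e (f : nat -> A) :
  \sum_(e' <- exps u m e) f e' = \sum_(j < u) f (e + j * m)%N.
Proof.
elim: u e => [|u IHu] e /=; first by rewrite big_nil big_ord0.
rewrite big_cons IHu big_ord_recl mul0n addn0; congr (_ + _).
by apply: eq_bigr => j _; congr f; rewrite lift0 mulSn; lia.
Qed.

Lemma mem_exps u e e' : e' \in exps u m e -> exists2 j, (j < u)%N & e' = (e + j * m)%N.
Proof.
elim: u e => //= u IHu e; rewrite inE => /orP[/eqP->|/IHu[j lt_j ->]].
  by exists 0%N; rewrite ?mul0n ?addn0.
by exists j.+1 => //; rewrite mulSn; lia.
Qed.

(** Reduction modulo [Z^n - y^e] is what evaluates the direct transform. *)
Lemma biv_horner e n l : (e <= w)%N ->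
  all (fun F => shape F == nseq n w) l ->
  cong ('X^n - (y ^+ e)%:P) (biv (flatten l)) (biv (horner_rot e l)).
Proof.
move=> le_e; elim: l => [|F l IHl] /= sl; first exact: cong_refl.
case/andP: sl => /eqP sF sl; rewrite biv_cat biv_addl (shape_size sF).
apply: congD; first exact: cong_refl.
rewrite -/(horner_rot e l).
have -> : biv (map (rotr e) (horner_rot e l)) = (y ^+ e)%:P * biv (horner_rot e l).
  have [->|l_n0] := eqVneq l [::]; first by rewrite mulr0.
  exact: biv_rotr (shape_horner_rot e l_n0 sl) le_e.
have [q ->] := IHl sl; exists (biv (horner_rot e l) + 'X^n * q); ring.
Qed.

(** Orthogonality of the characters of the cyclic group of order [p]. *)
Lemma root_inv_sum e r : (e <= m)%N -> (0 < r < p)%N ->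
  \sum_(j < p) inv (e + j * m) ^+ r = 0.
Proof.
move=> le_e r_bound.
rewrite (reindex_inj rev_ord_inj) /=.
under eq_bigr => j _.
  have -> : inv (e + (p - j.+1) * m) ^+ r = (y ^+ (m - e)) ^+ r * ((y ^+ m) ^+ r) ^+ j.
    rewrite /inv /w -!exprM -exprD; congr (_ ^+ _).
    have := ltn_ord j; move: (nat_of_ord j) => i lt_i.
    have -> : (p * m - (e + (p - i.+1) * m) = (m - e) + i * m)%N by nia.
    by ring.
  over.
by rewrite -mulr_sumr root_of_unity_sum ?mulr0.
Qed.

Variables (leaf : seq K -> seq K -> seq K) (kappa : Q).
Hypothesis size_leaf : forall x z, size x = w -> size z = w -> size (leaf x z) = w.
Hypothesis val_leaf : forall x z, size x = w -> size z = w ->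
  val (leaf x z) = kappa * (val x * val z).

(** The polynomials [Lam e'], of value [p] at the roots of [Z^n - y^e'] and [0] at
    those of the other factors of [Z^(p * n) - y^e], glue the products modulo the
    factors together; since they sum to [p] by orthogonality, the outcome is [p]
    times the product.  No inverse of [p] is involved, so that the argument is
    valid over any commutative ring. *)
Lemma biv_mul_tree s e F G :
  shape F = nseq (p ^ s) w -> shape G = nseq (p ^ s) w ->
  (e <= w)%N -> (p ^ s %| e)%N -> (p ^ s %| w)%N ->
  cong ('X^(p ^ s) - (y ^+ e)%:P) (biv (mul_tree p leaf m s e F G))
    ((p%:R ^+ s * kappa)%:P * (biv F * biv G)).
Proof.
have p_gt1 := prime_gt1 p_pr.
elim: s e F G => [|s IHs] e F G.
  case: F G => [|x [|? ?]] [|z [|? ?]] //= [sx] [sz] _ _ _.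
  rewrite !biv_cons val_leaf // mul0r !add0r mul1r -!polyCM; exact: cong_refl.
rewrite expnS => sF sG le_e dv_e dv_w.
set n := (p ^ s)%N; set e0 := (e %/ p)%N.
have e_eq : (p * e0 = e)%N by rewrite mulnC divnK //; apply: dvdn_trans dv_e; rewrite dvdn_mulr.
have le_e0 : (e0 <= m)%N by rewrite -(leq_pmul2l p_gt0) e_eq.
have dv_m : (n %| m)%N by rewrite -(dvdn_pmul2l p_gt0).
have dv_e0 : (n %| e0)%N by rewrite -(dvdn_pmul2l p_gt0) e_eq.
pose cut := @reshape (seq K) (nseq p n).
have scut H : shape H = nseq (p * n) w ->
    all (fun H => shape H == nseq n w) (cut H) by apply: shape_reshape.
have cutK H : shape H = nseq (p * n) w -> flatten (cut H) = H.
  by move=> sH; apply: reshapeKr; rewrite (shape_size sH) sumn_nseq mulnC.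
have sH e' H : shape H = nseq (p * n) w -> shape (horner_rot e' (cut H)) = nseq n w.
  move=> sH; apply: shape_horner_rot (scut H sH).
  by rewrite -size_eq0 size_reshape size_nseq -lt0n.
rewrite [mul_tree _ _ _ _ _ _ _]/= -/e0 -/n -/cut.
set es := exps p m e0.
have es_ok e' : e' \in es -> [/\ (e' <= w)%N, (n %| e')%N & y ^+ (p * e') = y ^+ e].
  move/mem_exps=> [j lt_j ->]; split.
  - by rewrite /w (leq_trans (_ : _ <= j.+1 * m)%N) ?leq_mul2r ?lt_j ?orbT // mulSn leq_add2r.
  - by rewrite dvdn_add ?dvdn_mull.
  - by rewrite mulnDr e_eq exprD mulnCA [(j * _)%N]mulnC exprM cyclo_expr1 expr1n mulr1.
set f := fun e' => mul_tree _ _ _ _ e' _ _.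
have f_shape e' : shape (f e') = nseq n w by apply: shape_mul_tree => //; apply: sH.
rewrite (@biv_combine _ _ n); first 1 last.
- by rewrite size_map.
- by rewrite -size_eq0 size_map size_exps -lt0n.
- by apply/allP => _ /mapP[e' _ ->]; apply/eqP.
- by apply/allP => e' /es_ok[].
have -> : zip es (map f es) = [seq (e', f e') | e' <- es].
  by elim: es {es_ok} => //= e' es ->.
(* The numerator of a Lagrange interpolation polynomial: the other factors of
   the binomial, normalized to take the value p. *)
pose Lam e' : {poly Q} := \sum_(r < p) ('X^n * (inv e')%:P) ^+ r.
have -> : \sum_(r < p) 'X^(n * r) *
     \sum_(eF <- [seq (e', f e') | e' <- es]) (inv eF.1 ^+ r)%:P * biv eF.2 =
    \sum_(e' <- es) Lam e' * biv (f e').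
  under [RHS]eq_bigr do rewrite mulr_suml.
  rewrite exchange_big /=; apply: eq_bigr => r _.
  rewrite big_map mulr_sumr; apply: eq_bigr => e' _.
  by rewrite exprMn -(exprM 'X n r) mulrA rmorphXn.
have Lam0 e' : e' \in es ->
    cong ('X^(p * n) - (y ^+ e)%:P) (Lam e' * ('X^n - (y ^+ e')%:P)) 0.
  move=> /es_ok[le_e' _ pe'].
  have inv_p : inv e' ^+ p * y ^+ e = 1.
    by rewrite -pe' mulnC exprM -exprMn [inv _ * _]mulrC invP // expr1n.
  exists ((y ^+ e')%:P * (inv e' ^+ p)%:P); rewrite add0r.
  have -> : 'X^n - (y ^+ e')%:P = (y ^+ e')%:P * ('X^n * (inv e')%:P - 1) :> {poly Q}.
    by rewrite mulrBr mulr1 mulrCA -polyCM invP // mulr1.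
  rewrite mulrCA [Lam e' * _]mulrC -subrX1 -mulrA; congr (_ * _).
  rewrite exprMn -(exprM 'X n p) mulrBr -polyCM inv_p mulnC; congr (_ - _).
  by rewrite [RHS]mulrC [X in _ = _ * X]polyC_exp.
apply: (@cong_trans _ _ _ (\sum_(e' <- es) Lam e' *
    ((p%:R ^+ s * kappa)%:P * (biv F * biv G)))).
  apply: cong_sum => e' e'_es; have [le_e' dv_e' _] := es_ok e' e'_es.
  apply: cong_dvd (Lam0 e' e'_es).
  apply: cong_trans (IHs _ _ _ _ _ le_e' dv_e' _) _; try exact: sH.
    exact: dvdn_trans dv_m (dvdn_mull _ _).
  apply: cong_mull; apply: congM; apply: cong_sym.
    by rewrite -{1}(cutK F) //; apply: biv_horner (scut F sF).
  by rewrite -{1}(cutK G) //; apply: biv_horner (scut G sG).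
rewrite -mulr_suml.
have -> : \sum_(e' <- es) Lam e' = p%:R.
  rewrite exchange_big /= (bigD1 (Ordinal p_gt0)) //=.
  under eq_bigr do rewrite expr0.
  rewrite big_const_seq count_predT size_exps iter_addr_0 big1 ?addr0 // => r r_n0.
  under eq_bigr do rewrite exprMn -polyC_exp.
  rewrite -mulr_sumr big_exps -raddf_sum /= root_inv_sum ?mulr0 //.
  by rewrite ltn_ord andbT lt0n.
rewrite exprS -(mulrA p%:R) [(p%:R * _)%:P]polyCM polyC_natr -!mulrA.
exact: cong_refl.
Qed.

End MulTree.

Section Cyc.

Variables (K : fieldType) (p : nat).
Hypothesis p_pr : prime p.
Implicit Types (x y : seq K) (F G H : seq (seq K)).

Let p_gt0 := prime_gt0 p_pr.
Let p_gt1 := prime_gt1 p_pr.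

Definition biPoly F : {poly {poly K}} := Poly (map (@Poly K) F).

Lemma biPoly_cons x F : biPoly (x :: F) = biPoly F * 'X + (Poly x)%:P.
Proof. by rewrite /biPoly /= cons_poly_def. Qed.

Lemma coef_biPoly F i : (biPoly F)`_i = Poly (nth [::] F i).
Proof.
rewrite coef_Poly; have [lt_i|le_i] := ltnP i (size F).
  by rewrite (nth_map [::]).
by rewrite !nth_default ?size_map.
Qed.

Lemma map_biPoly (Q : nzRingType) (rho : {rmorphism {poly K} -> Q}) F :
  map_poly rho (biPoly F) = Poly [seq rho (Poly x) | x <- F].
Proof.
apply/polyP=> i; rewrite coef_map coef_biPoly coef_Poly.
have [lt_i|le_i] := ltnP i (size F); first by rewrite (nth_map [::]).
by rewrite (nth_default [::]) // [RHS]nth_default ?size_map //= rmorph0.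
Qed.

Lemma size_biPoly F : (size (biPoly F) <= size F)%N.
Proof. by rewrite -(size_map (@Poly K) F) size_Poly. Qed.

Lemma size_coef_biPoly n F i :
  {in F, forall x, size (Poly x) <= n}%N -> (size ((biPoly F)`_i)%R <= n)%N.
Proof.
move=> sF; rewrite coef_biPoly; have [lt_i|le_i] := ltnP i (size F).
  by apply: sF; apply: mem_nth.
by rewrite nth_default // size_poly0.
Qed.

(** The remainder modulo ['X^r - 1], for polynomials of size at most [2 * r]. *)
Definition wrap (A : nzRingType) r (T : {poly A}) := take_poly r T + drop_poly r T.

Lemma wrapE (A : comNzRingType) r (T : {poly A}) :
  T = wrap r T + drop_poly r T * ('X^r - 1).
Proof. by rewrite -{1}(poly_take_drop r T) /wrap; ring. Qed.

(** An identity modulo [Phi] and ['X^r - 1] between polynomials in normal form for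
    ['X^r - 1] holds coefficientwise modulo [Phi]. *)
Lemma wrap_lift (Phi : {poly K}) r (kappa : K) (F G H : {poly {poly K}}) :
  Phi \is monic -> (1 < size Phi)%N -> (0 < r)%N ->
  (size F <= r)%N -> (size G <= r)%N -> (size H <= r)%N ->
  let rho := in_qpoly Phi in
  cong ('X^r - 1) (map_poly rho H)
    ((rho kappa%:P)%:P * (map_poly rho F * map_poly rho G)) ->
  forall i, exists q, H`_i = kappa *: (wrap r (F * G))`_i + q * Phi.
Proof.
move=> Phi_monic Phi_gt1 r_gt0 sF sG sH rho [V eqV] i.
set S := wrap r (F * G).
have sS : (size S <= r)%N.
  rewrite (leq_trans (size_polyD _ _)) // geq_max size_take_poly.
  rewrite size_drop_poly leq_subLR.
  apply: leq_trans (size_polyMleq F G) (leq_trans (leq_pred _) _).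
  exact: leq_add.
pose D := H - kappa%:P%:P * S.
have sD : (size D <= r)%N.
  rewrite (leq_trans (size_polyD _ _)) // geq_max sH size_polyN mul_polyC.
  exact: leq_trans (size_scale_leq _ _) sS.
have [V' eqD] : exists V', map_poly rho D = V' * ('X^r - 1).
  exists (V + (rho kappa%:P)%:P * map_poly rho (drop_poly r (F * G))).
  rewrite rmorphB rmorphM /= map_polyC /= eqV -rmorphM /=.
  rewrite {1}(wrapE r (F * G)) -/S rmorphD rmorphM /= rmorphB rmorph1 /= map_polyXn.
  by ring.
have V'0 : V' = 0.
  apply/eqP; apply: contraT => V'_n0.
  have sVD : size (map_poly rho D) = (size V' + r)%N.
    by rewrite eqD size_Mmonic ?monicXnsubC // size_XnsubC // addnS.
  have : (size (map_poly rho D) <= r)%N := leq_trans (size_poly _ _) sD.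
  by rewrite sVD -{2}[r]add0n leq_add2r leqn0 size_poly_eq0 (negPf V'_n0).
have : rho D`_i = 0.
  have <- : (map_poly rho D)`_i = rho D`_i := coef_map rho D i.
  by rewrite eqD V'0 mul0r coef0.
rewrite /D coefB coefCM mul_polyC => /(congr1 (@polyn K _))/=.
have -> : mk_monic Phi = Phi by rewrite /mk_monic Phi_gt1 Phi_monic.
move=> rem0; have := Pdiv.RingMonic.rdivp_eq Phi_monic (H`_i - kappa *: S`_i).
rewrite rem0 addr0 => eqH; exists (Pdiv.Ring.rdivp (H`_i - kappa *: S`_i) Phi).
by rewrite -eqH addrC subrK.
Qed.

(** The cyclotomic polynomial of order [p], at ['X^m]. *)
Definition cyclo m : {poly K} := \sum_(j < p) 'X^(m * j).

Lemma cycloE m : (0 < m)%N -> exists2 T : {poly K}, (size T <= m * p.-1)%N &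
  cyclo m = T + 'X^(m * p.-1).
Proof.
move=> m_gt0; rewrite /cyclo; case: (p) p_gt0 => // q _.
rewrite big_ord_recr /=; exists (\sum_(j < q) 'X^(m * j)) => //.
apply: (leq_trans (size_sum _ _ _)); apply/bigmax_leqP => j _.
by rewrite size_polyXn ltn_pmul2l.
Qed.

Lemma size_cyclo m : (0 < m)%N -> size (cyclo m) = (m * p.-1).+1.
Proof.
by move=> m_gt0; have [T sT ->] := cycloE m_gt0; rewrite addrC size_polyDl size_polyXn.
Qed.

Lemma cyclo_monic m : (0 < m)%N -> cyclo m \is monic.
Proof.
move=> m_gt0; have [T sT ->] := cycloE m_gt0.
by rewrite monicE addrC lead_coefDl ?lead_coefXn // size_polyXn.
Qed.

Lemma comb_cat (a b : K) x1 x2 y1 y2 : size x1 = size y1 ->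
  comb a b (x1 ++ x2) (y1 ++ y2) = comb a b x1 y1 ++ comb a b x2 y2.
Proof. by elim: x1 y1 => [|c x1 IH] [|d y1] //= [/IH->]. Qed.

Lemma comb_sub x : comb 1 (0 - 1) x x = nseq (size x) 0.
Proof. by elim: x => //= a x ->; congr (_ :: _); ring. Qed.

Lemma reduceP m x : size x = (p * m)%N ->
  (size (Poly (reduce p m x)) <= m * p.-1)%N /\
  exists q, Poly x = Poly (reduce p m x) + q * cyclo m.
Proof.
move=> sx; rewrite /reduce; set b := drop _ x.
have sb : size b = m.
  rewrite size_drop sx -mulnBl; have -> : (p - p.-1 = 1)%N by lia.
  exact: mul1n.
have srep : size (flatten (nseq p b)) = (p * m)%N.
  by rewrite size_flatten /shape map_nseq sumn_nseq sb mulnC.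
split; last first.
  exists (Poly b); rewrite Poly_comb ?sx ?srep // Poly_flatten sb -/(cyclo m).
  by rewrite scale1r sub0r scaleN1r; ring.
have -> : flatten (nseq p b) = flatten (nseq p.-1 b) ++ b.
  by rewrite -{1}(prednK p_gt0) -addn1 nseqD flatten_cat /= cats0.
rewrite -{1}(cat_take_drop (p.-1 * m) x) -/b comb_cat; last first.
  rewrite size_takel ?sx ?leq_mul2r ?leq_pred ?orbT //.
  by rewrite size_flatten /shape map_nseq sumn_nseq sb mulnC.
rewrite comb_sub; apply: leq_trans (size_Poly_cat0 _ _) _.
by rewrite size_comb size_takel ?sx ?leq_mul2r ?leq_pred ?orbT // mulnC geq_minl.
Qed.

Lemma Poly_overlap n F : {in F, forall x, n <= size x}%N ->
  Poly (overlap n F) = (biPoly F).['X^n].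
Proof.
elim: F => [|x F IHF] sF; first by rewrite horner0.
have sx : (n <= size x)%N by apply: sF; rewrite mem_head.
rewrite /= Poly_cat Poly_padd IHF; last by move=> z zF; apply: sF; rewrite inE zF orbT.
rewrite biPoly_cons !hornerE.
rewrite -[in RHS](cat_take_drop n x) Poly_cat size_takel //; ring.
Qed.

Lemma horner_flatten n F : {in F, forall x, size x = n} ->
  (biPoly F).['X^n] = Poly (flatten F).
Proof.
elim: F => [|x F IHF] sF; first by rewrite horner0.
rewrite /= biPoly_cons !hornerE IHF; last first.
  by move=> z zF; apply: sF; rewrite inE zF orbT.
by rewrite Poly_cat sF ?mem_head // addrC mulrC.
Qed.

Lemma size_overlap n w F : {in F, forall x, size x <= w}%N ->
  (size (overlap n F) <= n * size F + w)%N.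
Proof.
elim: F => [|x F IHF] sF //=.
rewrite size_cat size_padd size_take_min size_drop.
have := sF x (mem_head _ _); have := IHF (fun z zF => sF z (mem_behead (zF : z \in behead (x :: F)))).
by rewrite mulnS; case: (leqP (size x - n) (size (overlap n F))); lia.
Qed.

(** The number of radix [p] steps along one branch of the recursion of [cyc]: each
    contributes a factor [p]. *)
Fixpoint cyc_exp fuel k : nat :=
  if fuel isn't fuel'.+1 then 0%N else
  if (k <= 4)%N then 0%N else (k - k./2 + cyc_exp fuel' k./2.+2)%N.

(** Modulo the cyclotomic polynomial, ['X] is a root of unity and [biv_mul_tree]
    gives the product of the bivariate polynomials.  Both sides have small degree
    in ['X], so that the congruence is an equality, in which [Z] can be replaced
    by ['X^(p ^ h)]. *)
Lemma Poly_cyc fuel k x y : (k <= fuel)%N ->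
  size x = (p ^ k)%N -> size y = (p ^ k)%N ->
  cong ('X^(p ^ k) - 1) (Poly (cyc p fuel k x y))
    ((p%:R ^+ cyc_exp fuel k)%:P * (Poly x * Poly y)).
Proof.
elim: fuel k x y => [|fuel IHf] k x y.
  move=> _ sx sy; rewrite /= mul1r -sy; apply: Poly_naive.
  by rewrite sy expn_gt0 p_gt0.
move=> le_k sx sy; rewrite [cyc _ _ _ _ _]/= [cyc_exp _ _]/=.
case: ifP => le_k4.
  by rewrite expr0 mul1r -sy; apply: Poly_naive; rewrite sy expn_gt0 p_gt0.
set h := k./2; have le_hk : (h.+2 <= k)%N by rewrite /h; lia.
have le_hk' : (h <= k)%N by lia.
set m := (p ^ h.+1)%N; set r := (p ^ (k - h))%N; set n := (p ^ h)%N.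
have n_gt0 : (0 < n)%N by rewrite expn_gt0 p_gt0.
have m_gt0 : (0 < m)%N by rewrite expn_gt0 p_gt0.
have r_gt0 : (0 < r)%N by rewrite expn_gt0 p_gt0.
have wE : (p ^ h.+2 = p * m)%N by rewrite -expnS.
have mE : (m = p * n)%N by rewrite /m expnS.
have rnE : (p ^ k = r * n)%N by rewrite -expnD subnK.
set prepare := fun x : seq K => map (pad (p ^ h.+2)) (reshape (nseq r n) x).
rewrite -/(prepare x) -/(prepare y).
set F := mul_tree _ _ _ _ _ _ _.
have shape_prepare z : size z = (p ^ k)%N -> shape (prepare z) = nseq r (p * m).
  by move=> sz; rewrite shape_map_pad size_reshape size_nseq wE.
have sleaf (a b : seq K) : size a = (p * m)%N -> size b = (p * m)%N ->
    size (cyc p fuel h.+2 a b) = (p * m)%N.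
  by move=> _ sb; rewrite -wE in sb *; apply: size_cyc.
have shapeF : shape F = nseq r (p * m).
  by apply: shape_mul_tree => //; apply: shape_prepare.
have size_shape G : shape G = nseq r (p * m) -> size G = r.
  by move=> sG; rewrite -(size_map size) -/(shape G) sG size_nseq.
have sF : {in F, forall z, size z = (p * m)%N}.
  by move=> z z_in; move: (map_f size z_in); rewrite -/(shape F) shapeF mem_nseq => /andP[_ /eqP].
pose Phi := cyclo m.
pose rho : {rmorphism {poly K} -> {poly %/ Phi}} := in_qpoly Phi.
have sPhi : size Phi = (m * p.-1).+1 by apply: size_cyclo.
have Phi_monic : Phi \is monic by apply: cyclo_monic.
have Phi_gt1 : (1 < size Phi)%N by rewrite sPhi; nia.
have rho_cyclo : \sum_(j < p) (rho 'X ^+ m) ^+ j = 0.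
  rewrite -[RHS](_ : rho Phi = 0).
    rewrite [in RHS]/Phi /cyclo rmorph_sum; apply: eq_bigr => j _.
    by rewrite !rmorphXn exprM.
  apply: val_inj => /=.
  have -> : mk_monic Phi = Phi by rewrite /mk_monic Phi_gt1 Phi_monic.
  by rewrite Pdiv.RingMonic.rmodpp.
have val_leaf (a b : seq K) : size a = (p * m)%N -> size b = (p * m)%N ->
    rho (Poly (cyc p fuel h.+2 a b)) =
    rho (p%:R ^+ cyc_exp fuel h.+2)%:P * (rho (Poly a) * rho (Poly b)).
  rewrite -wE => sa sb; have [|q ->] := IHf h.+2 a b _ sa sb; first by lia.
  have root0 : rho ('X^(p ^ h.+2) - 1) = 0.
    rewrite wE mulnC exprM rmorphB rmorph1 (rmorphXn rho) (rmorphXn rho).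
    by rewrite subrX1 rho_cyclo mulr0.
  by rewrite (rmorphD rho) (rmorphM rho q) root0 mulr0 addr0 !(rmorphM rho).
have dv_s : (p ^ (k - h) %| p * m)%N.
  by rewrite -wE dvdn_exp2l //; rewrite /h; lia.
have := biv_mul_tree p_pr m_gt0 rho_cyclo sleaf val_leaf (s := k - h) (e := 0)
  (shape_prepare x sx) (shape_prepare y sy) (leq0n _) (dvdn0 _) dv_s.
rewrite -/F -/r expr0 -!map_biPoly.
set FF := biPoly _; set X := biPoly _; set Y := biPoly _ => lift.
set c := (p%:R : K) ^+ _.
have {lift} lift : cong ('X^r - 1) (map_poly rho FF)
    ((rho c%:P)%:P * (map_poly rho X * map_poly rho Y)).
  suff -> : rho c%:P = p%:R ^+ (k - h) * rho (p%:R ^+ cyc_exp fuel h.+2)%:P by [].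
  rewrite /c exprD polyCM (rmorphM rho); congr (_ * _).
  by rewrite rmorphXn /= polyC_natr (rmorphXn rho) (rmorph_nat rho).
have size_X z : size z = (p ^ k)%N -> (size (biPoly (prepare z)) <= r)%N.
  by move=> sz; rewrite -(size_shape _ (shape_prepare z sz)) size_biPoly.
have sFF : (size FF <= r)%N by rewrite -(size_shape _ shapeF) size_biPoly.
have {lift} coefF i : exists q, FF`_i = c *: (wrap r (X * Y))`_i + q * Phi.
  exact: (wrap_lift Phi_monic Phi_gt1 r_gt0 (size_X x sx) (size_X y sy) sFF lift).
have size_cut (z : seq K) : size z = (p ^ k)%N ->
    {in reshape (nseq r n) z, forall b, size b = n}.
  move=> sz b b_in; have sh : shape (reshape (nseq r n) z) = nseq r n.
    by apply: reshapeKl; rewrite sumn_nseq sz rnE mulnC.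
  by have := map_f size b_in; rewrite -/(shape _) sh mem_nseq => /andP[_ /eqP].
have le_nw : (n <= p ^ h.+2)%N by rewrite leq_exp2l // ltnW.
have prepareE z : size z = (p ^ k)%N ->
    biPoly (prepare z) = biPoly (reshape (nseq r n) z).
  move=> sz; rewrite /biPoly /prepare -map_comp; congr Poly.
  by apply/eq_in_map => b /(size_cut z sz) sb; rewrite /= Poly_pad ?sb.
have size_coef z i : size z = (p ^ k)%N -> (size ((biPoly (prepare z))`_i)%R <= n)%N.
  move=> sz; rewrite prepareE //; apply: size_coef_biPoly => b /(size_cut z sz) <-.
  exact: size_Poly.
have size_prod i : (size (((X * Y)%R)`_i)%R <= n + n)%N.
  rewrite coefM; apply: leq_trans (size_sum _ _ _) _; apply/bigmax_leqP => j _.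
  apply: leq_trans (size_polyMleq _ _) (leq_trans (leq_pred _) _).
  by apply: leq_add; apply: size_coef.
have le_nm : (n + n <= m * p.-1)%N by rewrite mE; nia.
have size_wrap i : (size ((wrap r (X * Y))`_i)%R <= m * p.-1)%N.
  apply: leq_trans le_nm; rewrite coefD coef_take_poly coef_drop_poly.
  rewrite (leq_trans (size_polyD _ _)) // geq_max size_prod andbT.
  by case: ifP => _; rewrite ?size_poly0.
have size_reduced i : (size ((biPoly (map (reduce p m) F))`_i)%R <= m * p.-1)%N.
  apply: size_coef_biPoly => _ /mapP[z /sF sz ->].
  by case: (reduceP sz).
have coefR i : (biPoly (map (reduce p m) F))`_i = c *: (wrap r (X * Y))`_i.
  have [q eq_q] : exists q, FF`_i = (biPoly (map (reduce p m) F))`_i + q * Phi.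
    rewrite !coef_biPoly; have [lt_i|le_i] := ltnP i (size F).
      rewrite (nth_map [::]) //.
      by have [_] := reduceP (sF _ (mem_nth [::] lt_i)).
    by exists 0; rewrite !nth_default ?size_map // mul0r addr0.
  have [q']:= coefF i; rewrite eq_q => /eqP.
  rewrite -subr_eq0 opprD addrACA -mulrBl.
  have [->|qq'] := eqVneq q q'.
    by rewrite subrr mul0r addr0 subr_eq0 => /eqP.
  rewrite addr_eq0 => /eqP/(congr1 (fun a : {poly K} => size a)).
  rewrite size_polyN size_Mmonic ?subr_eq0 // sPhi => eq_size.
  have : (size ((biPoly (map (reduce p m) F))`_i - c *: (wrap r (X * Y))`_i)%R <= m * p.-1)%N.
    rewrite (leq_trans (size_polyD _ _)) // geq_max size_reduced size_polyN.
    exact: leq_trans (size_scale_leq _ _) (size_wrap i).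
  rewrite eq_size addnS /= -{2}[(m * _)%N]add0n leq_add2r leqn0 size_poly_eq0.
  by rewrite subr_eq0 (negPf qq').
have {coefR} coefR : biPoly (map (reduce p m) F) = c%:P *: wrap r (X * Y).
  by apply/polyP => i; rewrite coefR coefZ mul_polyC.
set t := overlap _ _.
have sR : {in map (reduce p m) F, forall z, size z = (p * m)%N}.
  by move=> _ /mapP[z /sF sz ->]; apply: size_reduce.
have le_npm : (n <= p * m)%N by rewrite -wE.
have Poly_t : Poly t = c%:P * (wrap r (X * Y)).['X^n].
  by rewrite Poly_overlap ?coefR ?hornerZ // => z /sR ->.
have horner_prepare z : size z = (p ^ k)%N -> (biPoly (prepare z)).['X^n] = Poly z.
  move=> sz; rewrite prepareE // (horner_flatten (size_cut z sz)) reshapeKr //.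
  by rewrite sumn_nseq sz rnE mulnC.
apply: (@cong_trans _ _ _ (Poly t)); last first.
  apply: cong_sym; exists (c%:P * (drop_poly r (X * Y)).['X^n]).
  rewrite Poly_t -(horner_prepare x sx) -(horner_prepare y sy) -/X -/Y -hornerM.
  rewrite {1}(wrapE r (X * Y)) !hornerE /= -exprM mulrDr !mulrA.
  by rewrite [(n * r)%N]mulnC -rnE.
have size_t : (size t <= p ^ k + p ^ k)%N.
  apply: leq_trans (@size_overlap _ (p * m) _ _) _ => [z /sR ->//|].
  rewrite size_map size_shape // [(n * _)%N]mulnC -rnE leq_add2l -wE.
  by rewrite leq_exp2l.
rewrite Poly_pad ?size_padd ?Poly_padd; last first.
  by rewrite geq_max size_take_min geq_minl size_drop leq_subLR.
exists (- Poly (drop (p ^ k) t)).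
rewrite -{3}(cat_take_drop (p ^ k) t) Poly_cat.
have [le_t|lt_t] := leqP (p ^ k)%N (size t); first by rewrite size_takel //; ring.
by rewrite drop_oversize ?(ltnW lt_t) //=; ring.
Qed.

End Cyc.

(** * Linear algebra: the functions and their cost *)

Section LinModel.

Variables (K : fieldType) (p : nat).
Implicit Types (x y : seq K) (A L : seq (seq K)).

(** The [i]-th entry is the sum over [l] of [x_(i + l) * y_l], up to a power of
    [p]: a product with the reversal of [y], whose middle coefficients are kept. *)
Definition corr k x y : seq K :=
  take (size y) (drop (size y).-1
    (cyc p k k (pad (p ^ k) x) (pad (p ^ k) (rev y)))).

Fixpoint dot x y : K :=
  match x, y with a :: x', b :: y' => a * b + dot x' y' | _, _ => 0 end.

Definition mv x A := [seq dot r x | r <- A].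

Fixpoint kry u A x : seq (seq K) :=
  if u is u'.+1 then x :: kry u' A (mv x A) else [::].

Fixpoint pows u (t x : K) : seq K :=
  if u is u'.+1 then x :: pows u' t (t * x) else [::].

Fixpoint zipc x A : seq (seq K) :=
  match x, A with
  | [::], _ => [::]
  | a :: x', [::] => [:: a] :: zipc x' [::]
  | a :: x', r :: A' => (a :: r) :: zipc x' A'
  end.

Definition trans A := foldr zipc [::] A.

Fixpoint piv A : option (seq K * seq (seq K)) :=
  match A with
  | ((a :: _) as r) :: A' =>
    if a == 0 then omap (fun qB => (qB.1, r :: qB.2)) (piv A') else Some (r, A')
  | _ => None
  end.

Definition elim (r s : seq K) : seq K :=
  match r, s with a :: r', b :: s' => comb a (0 - b) s' r' | _, _ => [::] end.

(** [d] is the common pivot of the columns eliminated so far, which are not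
    stored, the reduced rows being [L].  The pivot row is scaled by [d], and all
    other rows by its pivot [a], so that the common pivot becomes [a * d]. *)
Fixpoint gj u (d : K) L A : option (K * seq (seq K)) :=
  if u isn't u'.+1 then Some (d, L) else
  if piv A is Some (((a :: b) as q), A') then
    gj u' (a * d) (map (elim q) L ++ [:: comb d 0 b b]) (map (elim q) A')
  else None.

Fixpoint ident u : seq (seq K) :=
  if u is u'.+1 then (1 :: nseq u' 0) :: map (cons 0) (ident u') else [::].

Definition divs (y : K) x := [seq a / y | a <- x].

(** First the entries of the powers of [M], from a row [x] of the Krylov vectors
    and a column [y] of the inverse; then their combinations by the coefficients
    [c] of the characteristic polynomial.  [ka] and [kd] remove the factors
    introduced by the correlations and by the elimination. *)
Definition entry k c ka kd x y : {poly K} :=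
  Poly (divs ka (corr k c (divs kd (corr k x y)))).

End LinModel.

Section LinCost.

Variables (K : fieldType) (v : K -> int) (src : nat -> seq K).
Variables (chi : {poly K}) (p : nat).
Hypotheses (p_gt1 : (1 < p)%N) (p_le3 : (p <= 3)%N).

Local Notation P := (prog p).
Local Notation evaluates := (evaluates v src chi P).
Local Notation returns := (returns v src chi P).
Local Notation dseq := (@data_of_seq K _).
Local Notation poly_data := (dseq (@Elt K)).
Local Notation mat_data := (dseq poly_data).

Hint Resolve evaluates_unary returns_app returns_catrev returns_take
  returns_drop returns_rot returns_mulu returns_pow returns_div returns_half
  returns_zeros returns_pad returns_comb returns_pow_unary : run_db.

Lemma returns_corr k (x y : seq K) :
  returns f_corr (Cons (unary K k) (Cons (poly_data x) (poly_data y)))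
    (poly_data (corr p k x y)) (cyc_cost p k).
Proof.
case: y => [|a y]; first by run; rewrite /corr take0.
run.
- by rewrite -(data_of_seq_nil (@Elt K)); apply: returns_catrev.
- by rewrite -/(rev (a :: y)) !size_nseq; apply: (@returns_cyc _ _ _ _ _ p_gt1 p_le3 k); rewrite ?size_pad.
- by rewrite /corr.
- by lia.
Qed.
Hint Resolve returns_corr : run_db.

Lemma returns_dot (x y : seq K) :
  returns f_dot (Cons (poly_data x) (poly_data y)) (Elt (dot x y)) (2 * size x).
Proof. by elim: x y => [|a x IHx] [|b y]; run; rewrite /=; lia. Qed.
Hint Resolve returns_dot : run_db.

Lemma returns_mv n (x : seq K) A : {in A, forall r, size r <= n}%N ->
  returns f_mv (Cons (poly_data x) (mat_data A)) (poly_data (mv x A))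
    (2 * n * size A).
Proof.
move=> sA; run_map (2 * n)%N => // r r_in l e; run_expr.
by rewrite !add0n leq_mul2l; apply: sA.
Qed.

Lemma returns_kry B (enc : B -> data K) n u A (x : seq K) :
  {in A, forall r, size r <= n}%N ->
  returns f_kry (Cons (dseq enc u) (Cons (mat_data A) (poly_data x)))
    (mat_data (kry (size u) A x)) (2 * n * size A * size u).
Proof.
move=> sA; elim: u x => [|z u IHu] x; run.
- exact: returns_mv sA.
- by [].
- by rewrite /=; lia.
Qed.

Lemma returns_pows B (enc : B -> data K) u t a :
  returns f_pows (Cons (dseq enc u) (Cons (Elt t) (Elt a)))
    (poly_data (pows (size u) t a)) (size u).
Proof.
elim: u a => [|z u IHu] a; by run; rewrite /=; lia.
Qed.
Hint Resolve returns_pows : run_db.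

Lemma returns_zipc (x : seq K) A :
  returns f_zipc (Cons (poly_data x) (mat_data A)) (mat_data (zipc x A)) 0.
Proof.
elim: x A => [|a x IHx] [|r A]; run.
- exact: (IHx [::]).
- by [].
- by [].
Qed.
Hint Resolve returns_zipc : run_db.

Lemma returns_trans A : returns f_trans (mat_data A) (mat_data (trans A)) 0.
Proof. by elim: A => [|r A IHA]; run. Qed.
Hint Resolve returns_trans : run_db.

Definition piv_data (o : option (seq K * seq (seq K))) : data K :=
  if o is Some (q, A) then Cons (poly_data q) (mat_data A) else Nil.

Lemma returns_piv A :
  returns f_piv (mat_data A) (piv_data (piv A)) (size A).
Proof.
elim: A => [|[|a r] A IHA]; [by run..|].
have [a0|a_n0] := eqVneq a 0; last first.
  run; first by rewrite (negPf a_n0); sym.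
    by rewrite /= (negPf a_n0).
  by [].
have sym_piv : piv ((a :: r) :: A) =
    omap (fun qB => (qB.1, (a :: r) :: qB.2)) (piv A) by rewrite /= a0 eqxx.
case: (piv A) IHA sym_piv => [[q B]|] IHA ->.
  run; first by rewrite a0 eqxx; sym.
    by rewrite a0.
  by rewrite /=; lia.
run; first by rewrite a0 eqxx; sym.
  by [].
by rewrite /=; lia.
Qed.
Hint Resolve returns_piv : run_db.

Lemma size_piv (A : seq (seq K)) q B : piv A = Some (q, B) -> size A = (size B).+1.
Proof.
elim: A q B => //= -[|a r] A IHA q B //; case: ifP => _; last by case=> _ <-.
by case: (piv A) IHA => //= -[q' B'] IHA [_ <-]; rewrite (IHA q' B').
Qed.

Lemma mem_piv (A : seq (seq K)) q B : piv A = Some (q, B) -> forall s, (s \in A) = (s \in q :: B).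
Proof.
elim: A q B => //= -[|a r] A IHA q B //; case: ifP => _; last by case=> -> ->.
case: (piv A) IHA => //= -[q' B'] IHA [<- <-] s.
by rewrite !inE (IHA _ _ erefl) inE orbCA.
Qed.

Lemma returns_elim n a r (A : seq (seq K)) : (size r <= n)%N -> {in A, forall s, s != [::]} ->
  returns f_elim (Cons (poly_data (a :: r)) (mat_data A))
    (mat_data (map (elim (a :: r)) A)) ((3 * n).+1 * size A).
Proof.
move=> sr A_ne; run_map (3 * n).+1%N => // -[|b s] /A_ne // _ l e; run_expr.
by have := geq_minr (size s) (size r); lia.
Qed.

Definition gj_data (o : option (K * seq (seq K))) : data K :=
  if o is Some (d, L) then Cons (Elt d) (mat_data L) else Nil.

(** A column is dropped at each step, so that all rows keep a common length. *)
Lemma gj_rows w d a b L A A' :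
  piv A = Some (a :: b, A') -> {in L ++ A, forall r : seq K, size r = w.+1} ->
  size b = w /\
  {in (map (elim (a :: b)) L ++ [:: comb d 0 b b]) ++ map (elim (a :: b)) A',
    forall r, size r = w}.
Proof.
move=> def_piv rows.
have rowsA : {in (a :: b) :: A', forall r, size r = w.+1}.
  by move=> s s_in; apply: rows; rewrite mem_cat (mem_piv def_piv) s_in orbT.
have sb : size b = w by have [] := rowsA (a :: b) (mem_head _ _).
have s_elim s : size s = w.+1 -> size (elim (a :: b) s) = w.
  by case: s => //= c s [ss]; rewrite size_comb sb ss minnn.
split=> // r; rewrite !mem_cat -orbA => /or3P[/mapP[s s_in ->]||/mapP[s s_in ->]].
- by apply: s_elim; apply: rows; rewrite mem_cat s_in.
- by rewrite inE => /eqP->; rewrite size_comb sb minnn.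
- by apply: s_elim; apply: rowsA; rewrite inE s_in orbT.
Qed.

Lemma returns_gj B (enc : B -> data K) w n u d L A :
  (size u <= w)%N -> (size L + size A)%N = n ->
  {in L ++ A, forall r, size r = w} ->
  returns f_gj (Cons (dseq enc u) (Cons (Elt d) (Cons (mat_data L) (mat_data A))))
    (gj_data (gj (size u) d L A)) (size u * (n * (3 * w + 2)).+1).
Proof.
elim: u w d L A => [|z u IHu] w d L A; first by move=> *; run.
case: w => // w; rewrite [size (z :: u)]/= ltnS => le_uw sLA rows.
rewrite [gj _ _ _ _]/=.
case def_piv: (piv A) => [[[|a b] A']|].
- run; first by rewrite def_piv; sym.
    by [].
   by rewrite -sLA mulSn; apply: leq_trans (leq_addr _ _); apply: leqW;
    rewrite !add0n !addn0 -[leqLHS]muln1 leq_mul ?leq_addl // addn2.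
- have sA := size_piv def_piv.
  have [sb rows'] := gj_rows d def_piv rows.
  have run_elim C : {in C, forall s, s \in L ++ A} ->
      returns f_elim (Cons (Cons (Elt a) (poly_data b)) (mat_data C))
        (mat_data (map (elim (a :: b)) C)) ((3 * w).+1 * size C).
    move=> sub_C; apply: returns_elim; first by rewrite sb.
    by move=> s /sub_C /rows; case: s.
  have run_L : returns f_elim (Cons (Cons (Elt a) (poly_data b)) (mat_data L))
        (mat_data (map (elim (a :: b)) L)) ((3 * w).+1 * size L).
    by apply: run_elim => s; rewrite mem_cat => ->.
  have run_A : returns f_elim (Cons (Cons (Elt a) (poly_data b)) (mat_data A'))
        (mat_data (map (elim (a :: b)) A')) ((3 * w).+1 * size A').
    by apply: run_elim => s; rewrite mem_cat (mem_piv def_piv) inE => ->; rewrite !orbT.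
  have run_app : returns f_app (Cons (mat_data (map (elim (a :: b)) L))
        (Cons (poly_data (comb d 0 b b)) Nil))
      (mat_data (map (elim (a :: b)) L ++ [:: comb d 0 b b])) 0.
    exact: (returns_app _ _ _ _ _ _ [:: _]).
  have run_gj := IHu w (a * d) (map (elim (a :: b)) L ++ [:: comb d 0 b b])
    (map (elim (a :: b)) A') le_uw.
  rewrite size_cat !size_map addn1 addSn -addnS -sA in run_gj.
  have {}run_gj := run_gj sLA rows'.
  run.
  + by rewrite def_piv; sym.
  + by [].
  + by rewrite sb minnn -sLA sA; nia.
- run; first by rewrite def_piv; sym.
    by [].
  by rewrite -sLA mulSn; apply: leq_trans (leq_addr _ _); apply: leqW;
    rewrite !add0n !addn0 -[leqLHS]muln1 leq_mul ?leq_addl // addn2.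
Qed.

Hint Resolve returns_gj : run_db.

Lemma returns_cons0 A : returns f_cons0 (Cons Nil (mat_data A))
  (mat_data (map (cons 0) A)) 0.
Proof. by run_map 0%N => // r _ l e; run_expr. Qed.
Hint Resolve returns_cons0 : run_db.

Lemma returns_ident B (enc : B -> data K) u :
  returns f_ident (dseq enc u) (mat_data (ident K (size u))) 0.
Proof. by elim: u => [|z u IHu]; run. Qed.
Hint Resolve returns_ident : run_db.

Lemma returns_divall y (x : seq K) : {in x, forall a, legal_div v false a y} ->
  returns f_divall (Cons (Elt y) (poly_data x)) (poly_data (divs y x)) (size x).
Proof.
move=> legal; rewrite -[size x]mul1n.
by run_map 1%N => // a /legal a_y l e; run_expr.
Qed.

Lemma returns_trim (x : seq K) :
  returns f_trim (poly_data x) (data_of_poly (Poly x)) (size x).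
Proof.
rewrite /data_of_poly; elim: x => [|a x IHx]; first by run; rewrite polyseq0.
rewrite /= polyseq_cons /nilp.
case def_t: (polyseq (Poly x)) IHx => [|b t] IHx /=.
  rewrite polyseqC; have [a0|a_n0] := eqVneq a 0.
    run; first by rewrite a0 eqxx; sym.
      by [].
    by rewrite /=; lia.
  run; first by rewrite (negPf a_n0); sym.
    by [].
  by rewrite /=; lia.
by run; rewrite /=; lia.
Qed.
Hint Resolve returns_trim : run_db.

Definition entry_data k (c : seq K) ka kd e :=
  Cons (unary K k) (Cons (poly_data c) (Cons (Elt ka) (Cons (Elt kd) e))).

Lemma size_corr_leq k (x y : seq K) : (size (corr p k x y) <= size y)%N.
Proof. by rewrite size_take_min geq_minl. Qed.

Lemma returns_outrow n k c ka kd x L :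
  {in L, forall y, [/\ (size y <= n)%N,
     {in corr p k x y, forall a, legal_div v false a kd} &
     {in corr p k c (divs kd (corr p k x y)), forall a, legal_div v false a ka}]} ->
  returns f_outrow (Cons (entry_data k c ka kd (poly_data x)) (mat_data L))
    (dseq (@data_of_poly K) [seq entry p k c ka kd x y | y <- L])
    ((2 * cyc_cost p k + 3 * n) * size L).
Proof.
move=> L_ok; run_map (2 * cyc_cost p k + 3 * n)%N => // y /L_ok[sy legal1 legal2] l e.
run_expr.
- exact: returns_divall.
- exact: returns_divall.
- by [].
- rewrite size_map; have := size_corr_leq k x y.
  have := size_corr_leq k c (divs kd (corr p k x y)); rewrite size_map.
  move=> le1 le2; have le3 := leq_trans le2 sy; have le4 := leq_trans le1 le3.
  rewrite !add0n.
  apply: (@leq_trans (cyc_cost p k + n + cyc_cost p k + n + n)); last by lia.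
  by rewrite !leq_add.
Qed.

Lemma returns_outmat n k c ka kd L A :
  {in A & L, forall x y, [/\ (size y <= n)%N,
     {in corr p k x y, forall a, legal_div v false a kd} &
     {in corr p k c (divs kd (corr p k x y)), forall a, legal_div v false a ka}]} ->
  returns f_outmat (Cons (entry_data k c ka kd (mat_data L)) (mat_data A))
    (dseq (dseq (@data_of_poly K)) [seq [seq entry p k c ka kd x y | y <- L] | x <- A])
    ((2 * cyc_cost p k + 3 * n) * size L * size A).
Proof.
move=> ok; run_map ((2 * cyc_cost p k + 3 * n) * size L)%N => // x x_in l e.
run_expr; first by apply: (@returns_outrow n) => y; apply: ok.
all: by [].
Qed.

End LinCost.

(** * Gauss-Jordan elimination without divisions *)

Section GaussJordan.

Variable K : fieldType.
Implicit Types (x y r s : seq K) (L A : seq (seq K)).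

Lemma dot_comb a b r s y : size r = size s ->
  dot (comb a b r s) y = a * dot r y + b * dot s y.
Proof.
elim: r s y => [|c r IHr] [|e s] //= y; first by rewrite !mulr0 addr0.
by case: y => [|f y] [sz]; rewrite ?mulr0 ?addr0 //= IHr //; ring.
Qed.

Lemma dot_cat r1 r2 y1 y2 : size r1 = size y1 ->
  dot (r1 ++ r2) (y1 ++ y2) = dot r1 y1 + dot r2 y2.
Proof.
elim: r1 y1 => [|a r1 IH] [|b y1] //= ; first by rewrite add0r.
by move=> [sz]; rewrite IH // addrA.
Qed.

Lemma dot0 r n : dot r (nseq n 0) = 0.
Proof. by elim: r n => [|a r IHr] [|n] //=; rewrite mulr0 add0r IHr. Qed.

Lemma dot_map (I : Type) (f g : I -> K) (l : seq I) :
  dot (map f l) (map g l) = \sum_(i <- l) f i * g i.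
Proof. by elim: l => [|i l IHl]; rewrite ?big_nil ?big_cons //= IHl. Qed.

(** The vector [y1 ++ y2] is orthogonal to all rows, if the rows of [L], which
    are already reduced, are understood to be preceded by the rows of the
    scalar matrix [d], and the rows of [A] by zeros. *)
Definition kernel d L A y1 y2 : bool :=
  all (fun ar => d * ar.1 + dot ar.2 y2 == 0) (zip y1 L) &&
  all (fun r => dot r y2 == 0) A.

Lemma piv_head A a b A' : piv A = Some (a :: b, A') -> a != 0.
Proof.
elim: A a b A' => //= -[|c r] A IHA a b A' //.
case: ifPn => c0; last by case=> <-.
by case def_p: (piv A) => [[[|e q] B]|] //= [<- _ _]; apply: (IHA e q B).
Qed.

Lemma piv_none w A : piv A = None -> {in A, forall r, size r = w.+1} ->
  {in A, forall r, head 0 r = 0}.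
Proof.
elim: A => // r A IHA; case: r => [|a r] /=.
  by move=> _ /(_ _ (mem_head _ _)).
case: ifPn => // /eqP a0; case: (piv A) IHA => // IHA _ sA s.
rewrite inE => /orP[/eqP->//|]; apply: IHA => // z z_in.
by apply: sA; rewrite inE z_in orbT.
Qed.

Lemma dot_elim a b c y r : size r = (size b).+1 ->
  dot (elim (a :: b) r) y =
  a * dot r (c :: y) - head 0 r * dot (a :: b) (c :: y).
Proof. by case: r => //= e r [sz]; rewrite dot_comb //; ring. Qed.

(** Row operations by nonzero scalars preserve the kernel.  The pivot row forces
    [q = 0] on both sides, and modulo [q = 0] each elimination multiplies the
    equation of a row by the nonzero pivot [a]. *)
Lemma kernel_step w d L A a b A' y1 c y : d != 0 ->
  {in L ++ A, forall r, size r = w.+1} -> size y1 = size L ->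
  piv A = Some (a :: b, A') ->
  kernel d L A y1 (c :: y) =
  kernel (a * d) (map (elim (a :: b)) L ++ [:: comb d 0 b b])
    (map (elim (a :: b)) A') (y1 ++ [:: c]) y.
Proof.
move=> d_n0 rows sy1 def_piv; have a_n0 := piv_head def_piv.
have rowsA : {in (a :: b) :: A', forall r, size r = w.+1}.
  by move=> s s_in; apply: rows; rewrite mem_cat (mem_piv def_piv) s_in orbT.
have [sb] := rowsA _ (mem_head _ _).
rewrite /kernel (eq_all_r (mem_piv def_piv)) zip_cat ?size_map // all_cat.
rewrite [all _ (_ :: A')]/= [all _ [:: _]]/= andbT !all_map.
set q := a * c + dot b y.
have -> : a * d * c + dot (comb d 0 b b) y = d * q.
  by rewrite dot_comb // /q; ring.
rewrite mulf_eq0 (negPf d_n0) /=.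
have [q0|] := eqVneq q 0; last by rewrite /= !andbF.
rewrite andbT /=; congr (_ && _).
  have : {in L, forall r, size r = w.+1} by move=> r rL; apply: rows; rewrite mem_cat rL.
  elim: L y1 sy1 {rows} => [|r L IHL] [|f y1] //= [sy1] rows.
  rewrite IHL //; last by move=> s sL; apply: rows; rewrite inE sL orbT.
  have sr : size r = (size b).+1 by rewrite sb; apply: rows; rewrite mem_head.
  rewrite (dot_elim a c y sr) -[dot (a :: b) (c :: y)]/q q0.
  have -> : a * d * f + (a * dot r (c :: y) - head 0 r * 0) =
            a * (d * f + dot r (c :: y)) by ring.
  by rewrite mulf_eq0 (negPf a_n0).
apply: eq_in_all => r rA' /=.
have sr : size r = (size b).+1 by rewrite sb; apply: rowsA; rewrite inE rA' orbT.
rewrite (dot_elim a c y sr) -[dot (a :: b) (c :: y)]/q q0.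
by rewrite mulr0 subr0 mulf_eq0 (negPf a_n0).
Qed.

(** The kernel determines what the elimination computes, without a trace of the
    row operations.  When no pivot is found, a kernel vector is built that has a
    [1] at the column where the elimination stops and zeros after it. *)
Lemma gjP w u d L A : d != 0 -> size A = u -> (u <= w)%N ->
  {in L ++ A, forall r, size r = w} ->
  if gj u d L A is Some (D, L') then
    [/\ D != 0, size L' = (size L + u)%N, {in L', forall r, size r = (w - u)%N} &
      forall y1 y2 z, size y1 = size L -> size y2 = u ->
        kernel d L A y1 (y2 ++ z) = kernel D L' [::] (y1 ++ y2) z]
  else exists y1 y2, [/\ size y1 = size L, size y2 = u, has (predC1 0) y2 &
    kernel d L A y1 (y2 ++ nseq (w - u) 0)].
Proof.
elim: u w d L A => [|u IHu] w d L A d_n0 sA le_uw rows.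
  case: A sA rows => // _; rewrite cats0 => rows; split=> //; first by rewrite addn0.
    by move=> r /rows; rewrite subn0.
  by move=> y1 [|//] z _ _; rewrite cats0.
case: w => // w in le_uw rows *; rewrite ltnS in le_uw; rewrite [gj _ _ _ _]/= subSS.
case def_piv: (piv A) => [[[|a b] A']|].
- have : [::] \in A by rewrite (mem_piv def_piv) mem_head.
  by move=> nilA; have := rows [::]; rewrite mem_cat nilA orbT => /(_ isT).
- have a_n0 := piv_head def_piv; have sA' := size_piv def_piv.
  have [sb rows'] := gj_rows d def_piv rows.
  have step y1 c y := @kernel_step w d L A a b A' y1 c y d_n0 rows ^~ def_piv.
  have ad_n0 : a * d != 0 by rewrite mulf_neq0.
  have := IHu w _ (map (elim (a :: b)) L ++ [:: comb d 0 b b]) (map (elim (a :: b)) A') ad_n0.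
  rewrite !size_map; have -> : size A' = u by move: sA; rewrite sA' => -[].
  move/(_ erefl le_uw rows'); case: gj => [[D L']|].
    rewrite size_cat size_map addn1 => -[D_n0 sL' rL' kerE]; split=> //.
      by rewrite sL' addSnnS.
    move=> y1 [//|c y2] z sy1 [sy2] /=; rewrite step // kerE ?size_cat ?sy1 ?addn1 //.
    by rewrite -catA.
  rewrite size_cat size_map addn1 => -[y1' [y2 [sy1' sy2 y2_n0 ker]]].
  case/lastP: y1' sy1' ker => // y1 c; rewrite size_rcons => -[sy1] ker.
  exists y1, (c :: y2); split=> //=; first by rewrite sy2.
    by rewrite y2_n0 orbT.
  by rewrite step //; rewrite -cats1 in ker.
exists [seq - (head 0 r / d) | r <- L], (1 :: nseq u 0).
rewrite size_map /= size_nseq oner_eq0; split=> //.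
have dot1 r : dot r (1 :: nseq u 0 ++ nseq (w - u) 0) = head 0 r.
  by case: r => //= e r; rewrite -nseqD dot0 mulr1 addr0.
rewrite /kernel; apply/andP; split.
  elim: L {rows} => //= r L ->; rewrite dot1 andbT.
  by rewrite mulrN mulrCA divff // mulr1 addNr.
apply/allP => r rA; rewrite dot1; apply/eqP.
by apply: piv_none def_piv _ _ rA => s sA'; apply: rows; rewrite mem_cat sA' orbT.
Qed.

End GaussJordan.

(** * Matrices as lists *)

Section Corr.

Variables (K : fieldType) (p : nat).
Hypothesis p_pr : prime p.
Implicit Types (x y : seq K).

Lemma cong_small N (a b : {poly K}) : (0 < N)%N ->
  (size a <= N)%N -> (size b <= N)%N -> cong ('X^N - 1) a b -> a = b.
Proof.
move=> N_gt0 sa sb [q eq_ab]; have [q0|q_n0] := eqVneq q 0.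
  by rewrite eq_ab q0 mul0r addr0.
have sab : (size (a - b)%R <= N)%N.
  by rewrite (leq_trans (size_polyD _ _)) // geq_max sa size_polyN.
move: sab; rewrite {1}eq_ab addrC addKr size_Mmonic ?monicXnsubC //.
rewrite size_XnsubC // addnS /= -{2}[N]add0n leq_add2r leqn0 size_poly_eq0.
by rewrite (negPf q_n0).
Qed.

(** The factor by which [cyc] multiplies a product.  The program obtains it as the
    first entry of the product of [1] by [1]. *)
Definition kappa k : K := p%:R ^+ cyc_exp k k.

Lemma Poly_cyc_exact k x y : (size x + size y <= p ^ k)%N ->
  Poly (cyc p k k (pad (p ^ k) x) (pad (p ^ k) y)) = (kappa k)%:P * (Poly x * Poly y).
Proof.
move=> sxy; have N_gt0 : (0 < p ^ k)%N by rewrite expn_gt0 prime_gt0.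
have sx : (size x <= p ^ k)%N := leq_trans (leq_addr _ _) sxy.
have sy : (size y <= p ^ k)%N := leq_trans (leq_addl _ _) sxy.
have := Poly_cyc p_pr (leqnn k) (size_pad (p ^ k) x) (size_pad (p ^ k) y).
rewrite !Poly_pad // -/(kappa k); apply: cong_small => //.
  by apply: leq_trans (size_Poly _) _; rewrite size_cyc ?size_pad.
rewrite mul_polyC; apply: leq_trans (size_scale_leq _ _) _.
apply: leq_trans (size_polyMleq _ _) _.
apply: leq_trans (leq_pred _) _; apply: leq_trans _ sxy.
by rewrite leq_add ?size_Poly.
Qed.

Lemma size_corr k x y : (size y + size y <= p ^ k)%N -> size (corr p k x y) = size y.
Proof.
move=> sy; rewrite size_takel // size_drop size_cyc ?size_pad //.
by rewrite leq_subRL; apply: leq_trans sy; rewrite ?leq_add2r ?leq_pred // -[leqLHS]addn0 leq_add ?leq_pred.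
Qed.

(** The length [p ^ k] exceeds the degree of the product, so that the cyclic
    product is the true product. *)
Lemma nth_corr k x y i : (size x + size y <= p ^ k)%N -> (i < size y)%N ->
  (corr p k x y)`_i = kappa k * \sum_(l < size y) x`_(i + l) * y`_l.
Proof.
move=> sxy lt_i; rewrite nth_take // nth_drop -coef_Poly Poly_cyc_exact ?size_rev //.
rewrite coefCM; congr (_ * _).
have -> : ((size y).-1 + i = i + (size y).-1)%N by rewrite addnC.
rewrite coefM -(big_mkord xpredT (fun j => (Poly x)`_j * (Poly (rev y))`_(i + (size y).-1 - j))).
rewrite (@big_cat_nat _ _ _ i) //=; last by lia.
rewrite big1_seq ?add0r; last first.
  move=> j; rewrite mem_index_iota => /andP[_ lt_j].
  rewrite [X in _ * X]coef_Poly [X in _ * X]nth_default ?mulr0 // size_rev.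
  by case: (size y) lt_i => // m _ /=; lia.
rewrite -{1}[i]add0n big_addn.
have -> : ((i + (size y).-1).+1 - i = size y)%N by lia.
rewrite big_mkord; apply: eq_bigr => l _.
have lt_l := ltn_ord l.
rewrite !coef_Poly [(l + i)%N]addnC; congr (_ * _).
rewrite nth_rev; first congr (nth _ _ _).
  by move: lt_i lt_l; move: (nat_of_ord l) => m; move: (size y) => s; lia.
by move: lt_i lt_l; move: (nat_of_ord l) => m; move: (size y) => s; lia.
Qed.

End Corr.

Section Tolist.

Variables (K : fieldType) (n : nat).
Implicit Types (x y : 'cV[K]_n) (M : 'M[K]_n).

Definition tolist x : seq K := [seq x i 0 | i <- enum 'I_n].
Definition rows M : seq (seq K) := [seq [seq M i j | j <- enum 'I_n] | i <- enum 'I_n].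

Lemma size_tolist x : size (tolist x) = n.
Proof. by rewrite size_map size_enum_ord. Qed.

Lemma nth_tolist x (i : 'I_n) : (tolist x)`_i = x i 0.
Proof. by rewrite (nth_map i) ?size_enum_ord // nth_ord_enum. Qed.

Lemma dot_tolist (f : 'I_n -> K) x :
  dot [seq f j | j <- enum 'I_n] (tolist x) = \sum_j f j * x j 0.
Proof. by rewrite dot_map big_enum. Qed.

Lemma mv_rows x M : mv (tolist x) (rows M) = tolist (M *m x).
Proof.
rewrite /mv -map_comp; apply: eq_map => i /=.
by rewrite dot_tolist mxE.
Qed.

Lemma kry_rows u M x :
  kry u (rows M) (tolist x) = [seq tolist (M ^+ k *m x) | k <- iota 0 u].
Proof.
elim: u x => //= u IHu x; rewrite expr0 mul1mx mv_rows IHu; congr (_ :: _).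
rewrite (iotaDl 1 0) -map_comp; apply: eq_map => k /=.
by rewrite exprSr mulmxA.
Qed.

Lemma pows_rows t : pows n t 1 = tolist (\col_i t ^+ i).
Proof.
have powsE u a : pows u t (t ^+ a) = [seq t ^+ k | k <- iota a u].
  by elim: u a => //= u IHu a; rewrite -exprS IHu.
rewrite -(expr0 t) powsE /tolist -val_enum_ord -map_comp.
by apply: eq_map => i /=; rewrite mxE.
Qed.

Lemma trans_tolist (s : seq 'cV[K]_n) : (s != [::]) || (n == 0%N) ->
  trans (map tolist s) = [seq [seq x i 0 | x <- s] | i <- enum 'I_n].
Proof.
have zip_map (I : Type) (r : seq I) (f : I -> K) (g : I -> seq K) :
    zipc (map f r) (map g r) = [seq f i :: g i | i <- r].
  by elim: r => //= i r ->.
have zip_nil (I : Type) (r : seq I) (f : I -> K) :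
    zipc (map f r) [::] = [seq [:: f i] | i <- r].
  by elim: r => //= i r ->.
elim: s => [|x [|y s] IHs] /=.
- by move/eqP=> n0; case: (enum _) (size_enum_ord n) => //=; rewrite n0.
- by rewrite zip_nil.
- by rewrite [zipc (tolist y) _]IHs // zip_map.
Qed.

Lemma ident_rows : ident K n = [seq tolist (delta_mx i 0) | i <- enum 'I_n].
Proof.
have identE u : ident K u = [seq [seq (j == i)%:R | j <- iota 0 u] | i <- iota 0 u].
  elim: u => //= u ->; congr (_ :: _).
    congr (_ :: _); rewrite (iotaDl 1 0) -map_comp.
    have zs a : nseq u 0 = [seq ((1 + j)%N == 0%N)%:R | j <- iota a u] :> seq K.
      by elim: (u) a => //= w IHw a; rewrite -IHw.
    exact: zs.
  by rewrite (iotaDl 1 0) -!map_comp; apply: eq_map => i /=; rewrite -map_comp.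
rewrite identE -val_enum_ord -map_comp; apply: eq_map => i /=.
rewrite -map_comp; apply: eq_map => j /=.
by rewrite mxE andbT.
Qed.

End Tolist.

(** * The adjugate of the characteristic matrix *)

Section Adjugate.

Variables (K : fieldType) (n : nat) (M : 'M[K]_n).

Local Notation chi := (char_poly M).

Lemma coef_char_poly_n : chi`_n = 1.
Proof.
have := char_poly_monic M; rewrite monicE lead_coefE size_char_poly /=.
by move/eqP.
Qed.

Lemma coef_char_poly_gt k : (n < k)%N -> chi`_k = 0.
Proof. by move=> lt_k; rewrite nth_default ?size_char_poly. Qed.

Lemma Cayley_Hamilton_sum : \sum_(t < n.+1) chi`_t *: M ^+ t = 0.
Proof.
case: n M => [|m] N; first exact: thinmx0.
rewrite -[RHS](Cayley_Hamilton N) -[in RHS](coefK (char_poly N)) poly_def.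
rewrite size_char_poly linear_sum; apply: eq_bigr => t _.
by rewrite linearZ rmorphXn /= horner_mx_X.
Qed.

(** Horner's coefficients for [chi] at [M], those of the quotient of [chi] by
    ['X - M]. *)
Definition adj_coef k : 'M[K]_n := \sum_(t < n) chi`_(k + t.+1) *: M ^+ t.

Lemma adj_coef0 k : (n <= k)%N -> adj_coef k = 0.
Proof.
move=> le_k; apply: big1 => t _.
by rewrite coef_char_poly_gt ?scale0r // addnS ltnS (leq_trans le_k) ?leq_addr.
Qed.

Lemma adj_coef_mul k : M *m adj_coef k = \sum_(t < n) chi`_(k + t.+1) *: M ^+ t.+1.
Proof.
rewrite mulmx_sumr; apply: eq_bigr => t _.
by rewrite -scalemxAr exprS.
Qed.

Lemma adj_coef_0 : M *m adj_coef 0 = - (chi`_0)%:M.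
Proof.
rewrite adj_coef_mul; have := Cayley_Hamilton_sum.
rewrite big_ord_recl expr0 -scalemx1 addrC => /eqP.
by rewrite addr_eq0 => /eqP.
Qed.

(** Equality of the coefficients of degree [k.+1] in [('X - M) * adj = chi]. *)
Lemma adj_coef_S k : adj_coef k - M *m adj_coef k.+1 = (chi`_k.+1)%:M.
Proof.
rewrite adj_coef_mul /adj_coef.
case: n M => [|m] N; first by apply/matrixP => -[].
rewrite big_ord_recl big_ord_recr /= expr0 addn1 -scalemx1.
rewrite [(char_poly N)`_(k.+1 + m.+1)]nth_default ?size_char_poly ?ltnS ?leq_addl //.
rewrite scale0r addr0 -addrA -sumrB big1 ?addr0 // => t _.
by rewrite /bump /= add1n addSnnS subrr.
Qed.

(** The right side is a right inverse of the characteristic matrix up to [chi],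
    and [chi] is not a zero divisor. *)
Lemma adj_char_poly_mx :
  \adj (char_poly_mx M) = \matrix_(i, j) \poly_(k < n) adj_coef k i j.
Proof.
set B := \matrix_(i, j) _.
have AB : char_poly_mx M *m B = chi%:M.
  apply/matrixP => i j; rewrite mulmxBl mul_scalar_mx !mxE.
  apply/polyP => k; rewrite coefB coefXM coef_sum.
  under eq_bigr do rewrite !mxE coefCM.
  have coefB_k l i' j' : (B i' j')`_l = adj_coef l i' j'.
    rewrite mxE coef_poly; case: ltnP => // le_l.
    by rewrite adj_coef0 // mxE.
  have -> : \sum_(j' < n) M i j' * (\poly_(k < n) adj_coef k j' j)`_k =
      (M *m adj_coef k) i j.
    rewrite mxE; apply: eq_bigr => j' _; rewrite -(coefB_k k) mxE.
    by [].
  case: k => [|k] /=.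
    by rewrite adj_coef_0 !mxE sub0r opprK coefMn.
  have := congr1 (fun A : 'M[K]_n => A i j) (adj_coef_S k).
  rewrite !mxE -{1}(coefB_k k) !mxE => ->.
  by rewrite coefMn.
have chi_n0 : chi != 0 by rewrite monic_neq0 ?char_poly_monic.
have := mulmxA (\adj (char_poly_mx M)) (char_poly_mx M) B.
rewrite AB mul_adj_mx mul_scalar_mx mul_mx_scalar -/(char_poly M) => /matrixP eqB.
apply/matrixP => i j; have := eqB i j; rewrite !mxE.
by move/(mulfI chi_n0).
Qed.

Lemma comatrixE i j : comatrix_mod_char_poly M i j = \poly_(k < n) adj_coef k i j.
Proof.
rewrite mxE adj_char_poly_mx mxE modp_small // size_char_poly ltnS.
exact: size_poly.
Qed.

End Adjugate.

(** * Integrality *)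

Section Integral.

Variables (K : fieldType) (v : K -> int).
Hypothesis hv : complete_discrete_valuation v.

Lemma val1 : v 1 = 0.
Proof.
have := valM hv (oner_neq0 K) (oner_neq0 K); rewrite mulr1 => /eqP.
by rewrite -subr_eq0 opprD addrA subrr sub0r oppr_eq0 => /eqP.
Qed.

Lemma valN x : x != 0 -> v (- x) = v x.
Proof.
move=> x_n0; have N1_n0 : -1 != 0 :> K by rewrite oppr_eq0 oner_eq0.
have := valM hv N1_n0 N1_n0; rewrite mulrNN mulr1 val1 => /esym/eqP.
rewrite -mulr2n mulrn_eq0 /= => /eqP vN1.
by rewrite -mulN1r (valM hv) // vN1 add0r.
Qed.

Lemma valint0 : integral v 0.
Proof. by rewrite /integral /val_ge eqxx. Qed.

Lemma valint1 : integral v 1.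
Proof. by rewrite /integral /val_ge val1 lexx orbT. Qed.

Lemma valintN x : integral v x -> integral v (- x).
Proof.
rewrite /integral /val_ge oppr_eq0; have [//|x_n0] := eqVneq x 0.
by rewrite valN.
Qed.

Lemma valintM x y : integral v x -> integral v y -> integral v (x * y).
Proof.
rewrite /integral /val_ge mulf_eq0.
have [//|x_n0] := eqVneq x 0; have [//|y_n0] := eqVneq y 0.
by move=> /= vx vy; rewrite (valM hv) // addr_ge0.
Qed.

Lemma valintD x y : integral v x -> integral v y -> integral v (x + y).
Proof.
rewrite /integral /val_ge.
have [->|x_n0] := eqVneq x 0; first by rewrite add0r.
have [->|y_n0] := eqVneq y 0; first by rewrite addr0 (negPf x_n0).
have [//|xy_n0] := eqVneq (x + y) 0 => /= vx vy.
by apply: le_trans (valD hv x_n0 y_n0 xy_n0); rewrite le_min vx vy.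
Qed.

Lemma valint_sum (I : Type) (r : seq I) (P : pred I) (F : I -> K) :
  (forall i, P i -> integral v (F i)) -> integral v (\sum_(i <- r | P i) F i).
Proof.
move=> intF; apply: (big_ind (fun x => integral v x)) => //.
  exact: valint0.
exact: valintD.
Qed.

Lemma valintX x k : integral v x -> integral v (x ^+ k).
Proof.
move=> x_int; elim: k => [|k IHk]; first by rewrite expr0 valint1.
by rewrite exprS valintM.
Qed.

Lemma valint_nat k : integral v k%:R.
Proof.
by elim: k => [|k IHk]; rewrite ?valint0 // -addn1 natrD valintD ?valint1.
Qed.

Definition mx_integral m n (M : 'M[K]_(m, n)) := forall i j, integral v (M i j).

Lemma mx_integralM m n l (A : 'M_(m, n)) (B : 'M_(n, l)) :
  mx_integral A -> mx_integral B -> mx_integral (A *m B).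
Proof.
by move=> A_int B_int i j; rewrite mxE; apply: valint_sum => k _; apply: valintM.
Qed.

Lemma mx_integralX n (M : 'M_n) k : mx_integral M -> mx_integral (M ^+ k).
Proof.
move=> M_int; elim: k => [|k IHk]; last by rewrite exprS; apply: mx_integralM.
by rewrite expr0 => i j; rewrite mxE; apply: valint_nat.
Qed.

Lemma char_poly_integral n (M : 'M_n) k : mx_integral M -> integral v (char_poly M)`_k.
Proof.
move=> M_int; move: k; pose S (q : {poly K}) := forall k, integral v q`_k.
have S_mul q r : S q -> S r -> S (q * r).
  move=> Sq Sr k; rewrite coefM; apply: valint_sum => i _.
  by apply: valintM; [apply: Sq|apply: Sr].
have S_nat m : S m%:R.
  by move=> k; rewrite -polyC_natr coefC; case: eqP => _; rewrite ?valint_nat ?valint0.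
have S_opp q : S q -> S (- q) by move=> Sq k; rewrite coefN; apply: valintN.
have S_add q r : S q -> S r -> S (q + r).
  by move=> Sq Sr k; rewrite coefD; apply: valintD.
rewrite -/(S (char_poly M)) /char_poly /determinant.
apply: (big_ind S); [exact: (S_nat 0%N)|exact: S_add|move=> s _].
apply: (S_mul _ _).
  by case: (perm.odd_perm s); [apply: S_opp|]; apply: (S_nat 1%N).
apply: (big_ind S); [exact: (S_nat 1%N)|exact: S_mul|move=> i _].
rewrite !mxE; apply: (S_add _ _); last first.
  apply: S_opp => k; rewrite coefC; case: eqP => _; [exact: M_int|exact: valint0].
case: (_ == _); last exact: (S_nat 0%N).
by move=> k; rewrite mulr1n coefX; apply: valint_nat.
Qed.

(** All divisions of the program are of this form.  [y] may be a nonunit: in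
    particular a power of the residue characteristic. *)
Lemma legal_exact_div y z : y != 0 -> integral v y -> integral v z ->
  legal_div v false (y * z) y.
Proof.
move=> y_n0 y_int z_int; rewrite /legal_div y_n0 /= valintM //= y_int.
by rewrite mulrAC divff // mul1r z_int orbT.
Qed.

Local Notation int_row := (all (integral v)).

Lemma valint_comb a b r s : integral v a -> integral v b ->
  int_row r -> int_row s -> int_row (comb a b r s).
Proof.
move=> a_int b_int; elim: r s => [|c r IHr] [|e s] //= /andP[c_int r_int] /andP[e_int s_int].
by rewrite IHr // andbT valintD ?valintM.
Qed.

Lemma valint_elim r s : int_row r -> int_row s -> int_row (elim r s).
Proof.
case: r s => [|a r] [|b s] //= /andP[a_int r_int] /andP[b_int s_int].
by rewrite valint_comb // sub0r valintN.
Qed.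

(** The elimination only adds and multiplies. *)
Lemma valint_gj u d L A D L' : integral v d ->
  all int_row L -> all int_row A -> gj u d L A = Some (D, L') ->
  integral v D /\ all int_row L'.
Proof.
elim: u d L A => [|u IHu] d L A d_int L_int A_int /=; first by case=> <- <-.
case def_piv: (piv A) => [[[|a b] A']|] //.
have : all int_row ((a :: b) :: A') by rewrite -(eq_all_r (mem_piv def_piv)).
case/andP=> ab_int A'_int; have /andP[a_int b_int] := ab_int.
have elim_int C : all int_row C -> all int_row (map (elim (a :: b)) C).
  by move=> C_int; rewrite all_map; apply: sub_all C_int => r; apply: valint_elim.
apply: IHu; rewrite ?valintM ?elim_int // all_cat elim_int //= andbT.
by rewrite valint_comb ?valint0.
Qed.

End Integral.

(** * One random trial *)

Section Krylov.

Variables (K : fieldType) (n : nat) (M : 'M[K]_n) (t : K).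

(** The vectors [(1, t, .., t^(n-1))] depend on one parameter, so that the bad
    ones are counted by the roots of a polynomial in one variable. *)
Definition krylov_vec k : 'cV[K]_n := M ^+ k *m \col_i t ^+ i.

Definition krylov : 'M[K]_n := \matrix_(i, k) krylov_vec k i 0.

Definition krylov_list u := [seq krylov_vec k | k <- iota 0 u].

Lemma krylov_listE u :
  kry u (rows M) (pows n t 1) = map (@tolist K n) (krylov_list u).
Proof. by rewrite pows_rows kry_rows -map_comp. Qed.

Lemma trans_krylov u : (0 < u)%N ->
  trans (kry u (rows M) (pows n t 1)) =
  [seq [seq krylov_vec k i 0 | k <- iota 0 u] | i <- enum 'I_n].
Proof.
move=> u_gt0; rewrite krylov_listE trans_tolist.
  by apply: eq_map => i; rewrite -map_comp.
by rewrite -size_eq0 size_map size_iota -lt0n u_gt0.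
Qed.

(** The rows of the Krylov matrix, followed by those of the identity, which record
    the row operations. *)
Definition augmented : seq (seq K) :=
  trans (take n (kry (n + n.+1) (rows M) (pows n t 1)) ++ ident K n).

Lemma augmentedE : augmented =
  [seq [seq krylov_vec k i 0 | k : 'I_n] ++ tolist (delta_mx i 0) | i <- enum 'I_n].
Proof.
rewrite /augmented krylov_listE -map_take -map_take take_iota.
rewrite (minn_idPl (leq_addr _ _)) ident_rows.
rewrite [X in _ ++ X](_ : _ = map (@tolist K n) [seq delta_mx i 0 | i <- enum 'I_n]).
  rewrite -map_cat trans_tolist; last first.
    rewrite -size_eq0 size_cat 2!size_map size_iota size_enum_ord.
    by rewrite addn_eq0 andbb orNb.
  apply: eq_map => i; rewrite map_cat; congr (_ ++ _).
    by rewrite -map_comp -val_enum_ord -map_comp.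
  by rewrite -[LHS]map_comp; apply: eq_map => j; rewrite /= !mxE !andbT eq_sym.
by rewrite -[RHS]map_comp.
Qed.

Lemma augmented_rows : {in augmented, forall r, size r = (n + n)%N}.
Proof.
move=> r; rewrite augmentedE => /mapP[i _ ->].
by rewrite size_cat size_tolist size_map size_enum_ord.
Qed.

Lemma size_augmented : size augmented = n.
Proof. by rewrite augmentedE size_map size_enum_ord. Qed.

(** The kernel of [krylov | 1] is the graph of [- krylov]; through [gjP] it is also
    the kernel of [D | N], whence [N *m krylov = D]. *)
Lemma kernel_augmented (c z : 'cV[K]_n) :
  kernel 1 [::] augmented [::] (tolist c ++ tolist z) = (krylov *m c + z == 0).
Proof.
rewrite /kernel /= augmentedE all_map.
transitivity (all (fun i => (krylov *m c + z) i 0 == 0) (enum 'I_n)).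
  apply: eq_all => i /=; rewrite dot_cat; last by rewrite size_tolist size_map size_enum_ord.
  rewrite !dot_tolist; congr (_ == _); rewrite [RHS]mxE; congr (_ + _).
    by rewrite [RHS]mxE; apply: eq_bigr => k _; rewrite [krylov _ _]mxE.
  rewrite (bigD1 i) //= mxE eqxx mul1r big1 ?addr0 // => j j_i.
  by rewrite mxE (negPf j_i) mul0r.
apply/allP/eqP => [z0|->].
  by apply/colP => i; rewrite [RHS]mxE; apply/eqP/z0; rewrite mem_enum.
by move=> i _; rewrite mxE.
Qed.

Lemma nth_rows (L : seq (seq K)) : size L = n -> {in L, forall r, size r = n} ->
  L = rows (\matrix_(l < n, j < n) (nth [::] L l)`_j).
Proof.
move=> sL rL; apply: (@eq_from_nth _ [::]) => [|l]; first by rewrite size_map size_enum_ord.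
rewrite sL => lt_l; pose l' := Ordinal lt_l.
rewrite (nth_map l') ?size_enum_ord // (nth_ord_enum l' l').
apply: (@eq_from_nth _ 0) => [|j]; first by rewrite size_map size_enum_ord rL // mem_nth ?sL.
rewrite rL ?mem_nth ?sL // => lt_j; pose j' := Ordinal lt_j.
by rewrite (nth_map j') ?size_enum_ord // (nth_ord_enum j' j') mxE.
Qed.

Lemma tolist_split (y : seq K) : size y = n -> y = tolist (\col_(i < n) y`_i).
Proof.
move=> sy; apply: (@eq_from_nth _ 0) => [|i]; first by rewrite size_tolist.
by rewrite sy => lt_i; rewrite (nth_tolist _ (Ordinal lt_i)) mxE.
Qed.

Lemma gj_krylov :
  match gj n 1 [::] augmented with
  | Some (D, L) => D != 0 /\ exists2 N : 'M_n, L = rows N & N *m krylov = D%:M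
  | None => \det krylov = 0
  end.
Proof.
have := gjP (L := [::]) (oner_neq0 K) size_augmented (leq_addr n n) augmented_rows.
case: gj => [[D L]|].
  case=> D_n0; rewrite addKn add0n => sL rL ker; split=> //.
  exists (\matrix_(l < n, j < n) (nth [::] L l)`_j); first exact: nth_rows.
  set N := \matrix_(_, _) _.
  have ker_N (c z : 'cV[K]_n) : krylov *m c + z = 0 -> D *: c + N *m z = 0.
    move/eqP; rewrite -kernel_augmented ker ?size_tolist //.
    rewrite /kernel andbT (nth_rows sL rL) -/N.
    rewrite /tolist /rows /= zip_map all_map => /allP all0.
    apply/colP => l; have := all0 l; rewrite mem_enum => /(_ isT)/= /eqP.
    by rewrite -/(tolist z) dot_tolist !mxE.
  apply/matrixP => i j.
  have := ker_N (delta_mx j 0) (- (krylov *m delta_mx j 0)) (subrr _).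
  rewrite mulmxN mulmxA => /eqP; rewrite subr_eq0 => /eqP/colP/(_ i).
  rewrite -colE !mxE andbT eq_sym => <-.
  by rewrite mulr_natr; case: (i == j).
case=> y1 [y2 [/size0nil-> sy2 y2_n0]].
rewrite addKn => ker.
have y2E := tolist_split sy2; set c := \col_i _ in y2E.
have zE : nseq n 0 = tolist (0 : 'cV[K]_n).
  by rewrite (tolist_split (size_nseq n 0)); congr tolist; apply/colP => i;
     rewrite !mxE nth_nseq if_same.
move: ker; rewrite y2E zE kernel_augmented addr0 => /eqP Pc.
rewrite -det_tr; apply/eqP/det0P; exists c^T; last first.
  by rewrite -trmx_mul Pc trmx0.
apply/negP => /eqP/(congr1 trmx); rewrite trmxK trmx0 => c0.
case/hasP: y2_n0 => a; rewrite y2E c0 => /mapP[i _ ->].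
by rewrite mxE /= eqxx.
Qed.

Lemma krylov_mul k : krylov_vec k = M ^+ k *m krylov_vec 0.
Proof. by rewrite /krylov_vec expr0 mul1mx. Qed.

(** The Hankel structure of the matrices [M ^+ b *m krylov]. *)
Lemma krylov_shift b (i l : 'I_n) : krylov_vec (b + l) i 0 = (M ^+ b *m krylov) i l.
Proof.
rewrite /krylov_vec exprD -mulmxA mxE [RHS]mxE.
by apply: eq_bigr => j _; rewrite [krylov _ _]mxE.
Qed.

(** Cayley-Hamilton applied to the vector: the coefficients of [chi] are the
    coordinates of [- krylov_vec n] in the Krylov basis. *)
Lemma krylov_char_poly :
  krylov_vec n = - (krylov *m \col_(l < n) (char_poly M)`_l).
Proof.
have := congr1 (mulmx^~ (krylov_vec 0)) (Cayley_Hamilton_sum M).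
rewrite mul0mx big_ord_recr /= coef_char_poly_n scale1r mulmxDl -krylov_mul.
move=> /eqP; rewrite addrC addr_eq0 => /eqP->; congr (- _).
apply/colP => i; rewrite mulmx_suml summxE mxE.
apply: eq_bigr => l _.
rewrite -scalemxAl -krylov_mul mxE [krylov _ _]mxE mulrC; congr (_ * _).
by rewrite mxE.
Qed.

End Krylov.

Lemma trans_rows (K : fieldType) n (N : 'M[K]_n) :
  trans (rows N) = [seq tolist (col j N) | j <- enum 'I_n].
Proof.
have -> : rows N = map (@tolist K n) [seq (row l N)^T | l <- enum 'I_n].
  rewrite -[RHS]map_comp; apply: eq_map => l /=.
  by apply: eq_map => j; rewrite !mxE.
rewrite trans_tolist; last first.
  by rewrite -size_eq0 size_map size_enum_ord orNb.
apply: eq_map => j; rewrite -map_comp; apply: eq_map => l.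
by rewrite /= !mxE.
Qed.

Section Trial.

Variables (K : fieldType) (v : K -> int) (src : nat -> seq K).
Variables (p n : nat) (M : 'M[K]_n).
Hypotheses (hv : complete_discrete_valuation v) (p_pr : prime p) (p_le3 : (p <= 3)%N).
Hypothesis p_n0 : p%:R != 0 :> K.
Hypothesis M_int : mx_integral v M.

Local Notation P := (prog p).
Local Notation chi := (char_poly M).
Local Notation returns := (returns v src chi P).
Local Notation dseq := (@data_of_seq K _).
Local Notation poly_data := (dseq (@Elt K)).
Local Notation mat_data := (dseq poly_data).

Lemma kappa_n0 k : kappa K p k != 0.
Proof. by rewrite expf_neq0. Qed.

Lemma kappa_int k : integral v (kappa K p k).
Proof. exact: (valintX hv _ (valint_nat hv p)). Qed.

Lemma head_kappa k : (1 < p ^ k)%N ->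
  head 0 (cyc p k k (pad (p ^ k) [:: 1]) (pad (p ^ k) [:: 1])) = kappa K p k.
Proof.
move=> N_gt1; rewrite -nth0 -coef_Poly Poly_cyc_exact //.
by rewrite /= cons_poly_def mul0r add0r !mulr1 coefC.
Qed.

Lemma divs_mull (y : K) s : y != 0 -> divs y (map ( *%R y) s) = s.
Proof.
move=> y_n0; rewrite /divs -map_comp -[RHS]map_id; apply: eq_map => a /=.
by rewrite mulrAC divff // mul1r.
Qed.

Section Entries.

Variables (t D : K) (N : 'M[K]_n) (k : nat).
Hypotheses (D_n0 : D != 0) (D_int : integral v D).
Hypothesis N_krylov : N *m krylov M t = D%:M.
Hypothesis k_big : (3 * n + 1 <= p ^ k)%N.

Lemma krylov_N : krylov M t *m N = D%:M.
Proof.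
have : (D^-1 *: N) *m krylov M t = 1%:M.
  by rewrite -scalemxAl N_krylov scale_scalar_mx mulVf.
move/mulmx1C; rewrite -scalemxAr => /(congr1 ( *:%R D)).
by rewrite scalerA divff // scale1r scale_scalar_mx mulr1.
Qed.

Let hankel i := [seq krylov_vec M t b i 0 | b <- iota 0 (n + n.+1)].
Let powers i j := [seq (M ^+ b) i j | b <- iota 0 n].

(** [M^b = (M^b V) V^-1], where [V] is the Krylov matrix, with [N = D V^-1]. *)
Lemma corr_hankel i j : corr p k (hankel i) (tolist (col j N)) =
  map ( *%R (kappa K p k * D)) (powers i j).
Proof.
have s_col := size_tolist (col j N).
apply: (@eq_from_nth _ 0) => [|b].
  by rewrite size_corr // s_col ?size_map ?size_iota //; lia.
rewrite size_corr // s_col; last by lia.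
move=> lt_b; rewrite nth_corr // ?s_col ?size_map ?size_iota //; last by lia.
rewrite -map_comp (nth_map 0%N) ?size_iota // nth_iota //= -mulrA; congr (_ * _).
transitivity ((M ^+ b *m krylov M t *m N) i j); last first.
  by rewrite -mulmxA krylov_N mul_mx_scalar mxE.
rewrite mxE; apply: eq_bigr => l _.
have lt_l := ltn_ord l.
rewrite (nth_map 0%N) ?size_iota; last by lia.
by rewrite nth_iota ?nth_tolist ?add0n ?krylov_shift ?[col _ _ _ _]mxE //; lia.
Qed.

Lemma char_list : behead (divs (0 - D) (mv (tolist (krylov_vec M t n)) (rows N))
  ++ [:: 1]) = [seq chi`_l.+1 | l <- iota 0 n].
Proof.
have -> : mv (tolist (krylov_vec M t n)) (rows N) =
    map ( *%R (0 - D)) (tolist (\col_(l < n) chi`_l)).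
  rewrite mv_rows krylov_char_poly mulmxN mulmxA N_krylov mul_scalar_mx.
  by rewrite -[RHS]map_comp; apply: eq_map => l; rewrite /= !mxE sub0r mulNr.
rewrite divs_mull ?sub0r ?oppr_eq0 //.
have -> : tolist (\col_(l < n) chi`_l) ++ [:: 1] = [seq chi`_l | l <- iota 0 n.+1].
  rewrite -(addn1 n) iotaD map_cat /= coef_char_poly_n; congr (_ ++ _).
  by rewrite -val_enum_ord -map_comp; apply: eq_map => l; rewrite /= mxE.
by rewrite /= (iotaDl 1 0) -map_comp.
Qed.

Lemma corr_char i j : corr p k [seq chi`_l.+1 | l <- iota 0 n] (powers i j) =
  map ( *%R (kappa K p k)) [seq adj_coef M b i j | b <- iota 0 n].
Proof.
have s_pow : size (powers i j) = n by rewrite size_map size_iota.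
apply: (@eq_from_nth _ 0) => [|b].
  by rewrite size_corr // s_pow ?size_map ?size_iota //; lia.
rewrite size_corr // s_pow; last by lia.
move=> lt_b; rewrite nth_corr // ?s_pow ?size_map ?size_iota //; last by lia.
rewrite -map_comp (nth_map 0%N) ?size_iota // nth_iota //=; congr (_ * _).
rewrite summxE; apply: eq_bigr => l _; have lt_l := ltn_ord l.
rewrite [RHS]mxE [X in _ * X](nth_map 0%N) ?size_iota // nth_iota //; congr (_ * _).
have [lt_bl|le_bl] := ltnP (b + l) n.
  by rewrite (nth_map 0%N) ?size_iota // nth_iota // addnS.
by rewrite nth_default ?size_map ?size_iota // coef_char_poly_gt // addnS ltnS.
Qed.

Lemma entryE i j : entry p k [seq chi`_l.+1 | l <- iota 0 n] (kappa K p k)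
    (kappa K p k * D) (hankel i) (tolist (col j N)) =
  comatrix_mod_char_poly M i j.
Proof.
rewrite /entry corr_hankel divs_mull ?mulf_neq0 ?kappa_n0 //.
rewrite corr_char divs_mull ?kappa_n0 // comatrixE.
apply/polyP => b; rewrite coef_Poly coef_poly; case: ltnP => [lt_b|le_b].
  by rewrite (nth_map 0%N) ?size_iota // nth_iota.
by rewrite nth_default ?size_map ?size_iota.
Qed.

Lemma adj_coef_int b : mx_integral v (adj_coef M b).
Proof.
move=> i j; rewrite summxE; apply: (valint_sum hv) => l _; rewrite mxE.
by apply: (valintM hv); [apply: char_poly_integral|apply: mx_integralX].
Qed.

Lemma legal_hankel i j :
  {in corr p k (hankel i) (tolist (col j N)),
     forall a, legal_div v false a (kappa K p k * D)}.
Proof.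
move=> a; rewrite corr_hankel => /mapP[_ /mapP[b _ ->] ->].
apply: (legal_exact_div hv); first by rewrite mulf_neq0 ?kappa_n0.
  by apply: (valintM hv) => //; apply: kappa_int.
exact: mx_integralX.
Qed.

Lemma legal_char i j :
  {in corr p k [seq chi`_l.+1 | l <- iota 0 n]
      (divs (kappa K p k * D) (corr p k (hankel i) (tolist (col j N)))),
     forall a, legal_div v false a (kappa K p k)}.
Proof.
rewrite corr_hankel divs_mull ?mulf_neq0 ?kappa_n0 // corr_char.
move=> a /mapP[_ /mapP[b _ ->] ->].
by apply: (legal_exact_div hv); rewrite ?kappa_n0 ?kappa_int //; apply: adj_coef_int.
Qed.

Lemma legal_char_list :
  {in mv (tolist (krylov_vec M t n)) (rows N), forall a, legal_div v false a (0 - D)}.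
Proof.
rewrite mv_rows krylov_char_poly mulmxN mulmxA N_krylov mul_scalar_mx.
move=> a /mapP[l _ ->]; rewrite sub0r !mxE -mulNr.
apply: (legal_exact_div hv); rewrite ?oppr_eq0 ?(valintN hv) //.
exact: char_poly_integral.
Qed.

End Entries.

(** A trial makes [2 n^2] products of polynomials, of cost [cyc_cost]; the
    constant absorbs the cubic linear algebra. *)
Definition trial_cost : nat := 3 ^ 9 * n.+1 ^ 3 * (trunc_log 2 n).+1 ^ 8.

Lemma cyc_cost_leq k : (p ^ k <= p * (3 * n + 1))%N ->
  (cyc_cost p k <= 3 ^ 7 * n.+1 * (trunc_log 2 n).+1 ^ 8)%N.
Proof.
move=> le_k; rewrite /cyc_cost; set L := trunc_log 2 n.
have lt_n : (n < 2 ^ L.+1)%N by apply: trunc_log_ltn.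
have le_kL : (k < L + 5)%N.
  rewrite -(@ltn_exp2l 2) //; apply: (@leq_ltn_trans (p ^ k)).
    by case: (k) => // k'; rewrite leq_exp2r ?prime_gt1.
  apply: leq_ltn_trans le_k _; rewrite (_ : L + 5 = L.+1 + 4)%N ?expnD; last by lia.
  by move: (2 ^ L.+1)%N lt_n => e; nia.
have le_max : (maxn (k - 3) 1 <= L.+1)%N by lia.
have le_max8 : (maxn (k - 3) 1 ^ 8 <= L.+1 ^ 8)%N by rewrite leq_exp2r.
apply: leq_mul => //.
have p4 : (p ^ 4 <= 81)%N by rewrite -[81%N]/(3 ^ 4)%N leq_exp2r.
move: (p ^ 4)%N (p ^ k)%N p4 le_k => a b le_a le_b.
have le_b' : (b <= 9 * n.+1)%N by nia.
apply: (@leq_trans (3 * 81 * (9 * n.+1))); first by rewrite leq_mul ?leq_mul.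
by rewrite mulnA leq_mul2r orbC.
Qed.

Hint Resolve evaluates_unary returns_app returns_catrev returns_take
  returns_drop returns_rot returns_mulu returns_pow returns_pow_unary returns_pad
  returns_pows returns_trans returns_ident : run_db.

Lemma trial_cost_leq k : (p ^ k <= p * (3 * n + 1))%N ->
  (n + 2 * n * n * (n + n.+1) + n * (n * (3 * (n + n) + 2)).+1 + cyc_cost p k +
   2 * n * n + n + (2 * cyc_cost p k + 3 * n) * n * n + 2 <= trial_cost)%N.
Proof.
move=> /cyc_cost_leq; rewrite /trial_cost.
have : (0 < (trunc_log 2 n).+1 ^ 8)%N by rewrite expn_gt0.
move: (_ ^ 8)%N (cyc_cost p k) => Y C Y_gt0 le_C.
have poly_part : (n + 2 * n * n * (n + n.+1) + n * (n * (3 * (n + n) + 2)).+1 +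
    2 * n * n + n + 3 * n * n * n + 2 <= 13 * n.+1 ^ 3)%N.
  by rewrite !expnS expn0; nia.
have cyc_part : (C + 2 * C * n * n <= 2 * n.+1 ^ 2 * (3 ^ 7 * n.+1 * Y))%N.
  apply: (@leq_trans (2 * n.+1 ^ 2 * C)); last by rewrite leq_mul2l le_C orbT.
  by rewrite !expnS expn0; nia.
apply: (@leq_trans (13 * n.+1 ^ 3 * Y + 2 * n.+1 ^ 2 * (3 ^ 7 * n.+1 * Y))).
  have : (13 * n.+1 ^ 3 * 1 <= 13 * n.+1 ^ 3 * Y)%N by rewrite leq_mul2l Y_gt0 orbT.
  by move: (13 * _)%N (13 * _ * Y)%N (2 * n.+1 ^ 2 * _)%N poly_part cyc_part => ? ? ? ? ? ?; lia.
have -> : (13 * n.+1 ^ 3 * Y + 2 * n.+1 ^ 2 * (3 ^ 7 * n.+1 * Y) =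
  (13 + 2 * 3 ^ 7) * (n.+1 ^ 3 * Y))%N by rewrite !expnS !expn0; ring.
by rewrite -[(_ * n.+1 ^ 3 * Y)%N]mulnA leq_mul2r orbC.
Qed.

Lemma size_rows (N : 'M[K]_n) : size (rows N) = n.
Proof. by rewrite size_map size_enum_ord. Qed.

(** The elimination fails exactly when the Krylov matrix is singular, and then the
    trial returns the empty tree. *)
Lemma returns_trial (t : K) : integral v t ->
  returns f_trial (Cons (mat_data (rows M)) (Elt t))
    (if \det (krylov M t) == 0 then Nil else
     Cons (data_of_matrix (@data_of_poly K) (comatrix_mod_char_poly M)) Nil)
    trial_cost.
Proof.
move=> t_int; have p_gt1 := prime_gt1 p_pr.
have row_n : {in rows M, forall r, size r <= n}%N.
  by move=> _ /mapP[i _ ->]; rewrite size_map size_enum_ord.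
have app_len A B (encA : A -> data K) (encB : B -> data K) x y :
    returns f_app (Cons (dseq encA x) (dseq encB y)) (dseq id (map encA x ++ map encB y)) 0.
  have eid C (enc : C -> data K) z : dseq enc z = dseq id (map enc z).
    by rewrite data_of_seq_map.
  by rewrite eid [dseq encB y]eid; apply: returns_app.
pose u1 := map (dseq (@Elt K)) (rows M) ++ map (fun=> Nil) (nseq 1 tt).
have app1 : returns f_app (Cons (mat_data (rows M)) (unary K 1)) (dseq id u1) 0.
  exact: app_len.
pose u2 := map (dseq (@Elt K)) (rows M) ++ map id u1.
have app2 : returns f_app (Cons (mat_data (rows M)) (dseq id u1)) (dseq id u2) 0.
  exact: app_len.
clear app_len.
have su2 : size u2 = (n + n.+1)%N.
  rewrite size_cat size_map size_rows size_map size_cat size_map size_rows.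
  by rewrite size_map size_nseq addn1.
pose W := kry (n + n.+1) (rows M) (pows n t 1).
have run_W : returns f_kry (Cons (dseq id u2) (Cons (mat_data (rows M))
    (poly_data (pows (size (rows M)) t 1)))) (mat_data W) (2 * n * n * (n + n.+1)).
  eapply returns_sub; [apply: returns_kry row_n => //|..].
    by rewrite su2 size_rows.
  by rewrite su2 size_rows.
have take_W : returns f_take (Cons (mat_data (rows M)) (mat_data W)) (mat_data (take n W)) 0.
  have := returns_take v src chi p poly_data poly_data (rows M) W.
  by rewrite size_rows.
have run_id : returns f_ident (mat_data (rows M)) (mat_data (ident K n)) 0.
  have := returns_ident v src chi p poly_data (rows M).
  by rewrite size_rows.
have run_aug : returns f_trans (mat_data (take n W ++ ident K n))
    (mat_data (augmented M t)) 0 by apply: returns_trans.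
have run_gj : returns f_gj (Cons (mat_data (rows M)) (Cons (Elt 1) (Cons Nil
    (mat_data (augmented M t))))) (gj_data (gj n 1 [::] (augmented M t)))
    (n * (n * (3 * (n + n) + 2)).+1).
  have := returns_gj v src chi p_gt1 p_le3 poly_data (w := n + n) (n := n)
    (u := rows M) 1 (L := [::]) (A := augmented M t).
  rewrite size_rows size_augmented leq_addr; apply=> //.
  exact: augmented_rows.
have := gj_krylov M t; case def_gj: (gj n 1 [::] (augmented M t)) run_gj => [[D L]|] run_gj; last first.
  move=> ->; rewrite eqxx; run.
  have k0 : (p ^ 0 <= p * (3 * n + 1))%N by rewrite expn0; nia.
  by rewrite size_rows; apply: leq_trans (trial_cost_leq k0); lia.
case=> D_n0 [N eqL N_krylov].
have det_n0 : \det (krylov M t) != 0.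
  apply/eqP => det0; have := congr1 (fun A : 'M_n => \det A) N_krylov.
  rewrite det_mulmx det0 mulr0 det_scalar => /esym/eqP.
  by rewrite expf_eq0 (negPf D_n0) andbF.
rewrite (negPf det_n0).
have [D_int _] : integral v D /\ all (all (integral v)) L.
  apply: (valint_gj hv) def_gj => //; first exact: valint1.
  rewrite augmentedE; apply/allP => _ /mapP[i _ ->]; rewrite all_cat; apply/andP; split.
    apply/allP => _ /mapP[l _ ->]; apply: mx_integralM => //.
      exact: mx_integralX.
    by move=> a b; rewrite mxE; apply: valintX.
  by apply/allP => _ /mapP[l _ ->]; rewrite mxE; apply: valint_nat.
have [k [run_k lt_k le_k]] := returns_log v src (char_poly M) p_gt1 poly_data (rows M ++ W).
have sW : size W = (n + n.+1)%N by rewrite /W krylov_listE !size_map size_iota.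
rewrite size_cat sW size_rows in lt_k le_k.
have k_big : (3 * n + 1 <= p ^ k)%N by lia.
have pk_gt1 : (1 < p ^ k)%N by lia.
have {}le_k : (p ^ k <= p * (3 * n + 1))%N by lia.
pose o := pad (p ^ k) [:: 1 : K].
have run_o : returns f_pad (Cons (unary K (p ^ k)) (Cons (Elt 1) Nil)) (poly_data o) 0.
  have := returns_pad v src chi p (fun _ : unit => Nil) (nseq (p ^ k) tt) [:: 1].
  by rewrite size_nseq.
have [ka' def_o] : exists ka', cyc p k k o o = kappa K p k :: ka'.
  have := head_kappa pk_gt1; rewrite -/o.
  have : (0 < size (cyc p k k o o))%N by rewrite size_cyc ?size_pad // ltnW.
  by case: (cyc p k k o o) => //= a ka' _ ->; exists ka'.
have run_ka : returns f_cyc (Cons (unary K k) (Cons (poly_data o) (poly_data o)))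
    (poly_data (kappa K p k :: ka')) (cyc_cost p k).
  by rewrite -def_o; apply: returns_cyc; rewrite ?size_pad.
have [W' def_W'] : exists W', drop n W = tolist (krylov_vec M t n) :: W'.
  rewrite /W krylov_listE -!map_drop drop_iota add0n addKn /=.
  by eexists.
have run_drop : returns f_drop (Cons (mat_data (rows M)) (mat_data W))
    (mat_data (tolist (krylov_vec M t n) :: W')) 0.
  have := returns_drop v src chi p poly_data poly_data (rows M) W.
  by rewrite size_rows def_W'.
have run_mv : returns f_mv (Cons (poly_data (tolist (krylov_vec M t n))) (mat_data L))
    (poly_data (mv (tolist (krylov_vec M t n)) L)) (2 * n * n).
  eapply returns_sub; [apply: (@returns_mv _ _ _ _ _ p_gt1 p_le3 n)|..] => //.
    by move=> r; rewrite eqL => /mapP[i _ ->]; rewrite size_map size_enum_ord.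
  by rewrite eqL size_map size_enum_ord.
pose cl := divs (0 - D) (mv (tolist (krylov_vec M t n)) L).
have s_cl : size cl = n by rewrite size_map size_map eqL size_rows.
have run_cl : returns f_divall (Cons (Elt (0 - D))
    (poly_data (mv (tolist (krylov_vec M t n)) L))) (poly_data cl) n.
  eapply returns_sub; [apply: returns_divall|..] => //.
    by rewrite eqL; apply: legal_char_list.
  by move: s_cl; rewrite /cl size_map => ->.
pose c := [seq (char_poly M)`_l.+1 | l <- iota 0 n].
have [c0 def_c] : exists c0, cl ++ [:: 1] = c0 :: c.
  have := char_list D_n0 N_krylov; rewrite -eqL -/cl -/c.
  by case: (cl) s_cl => [|c0 cl'] _ /= <-; eexists.
have run_c : returns f_app (Cons (poly_data cl) (Cons (Elt 1) Nil))
    (poly_data (c0 :: c)) 0.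
  by rewrite -def_c; apply: (returns_app _ _ _ _ _ _ [:: 1]).
pose hankel i := [seq krylov_vec M t b i 0 | b <- iota 0 (n + n.+1)].
have run_trW : returns f_trans (mat_data W) (mat_data (map hankel (enum 'I_n))) 0.
  have <- : trans W = map hankel (enum 'I_n) by rewrite trans_krylov // addnS.
  exact: returns_trans.
have run_trL : returns f_trans (mat_data L)
    (mat_data [seq tolist (col j N) | j <- enum 'I_n]) 0.
  by rewrite -trans_rows -eqL; apply: returns_trans.
have run_out : returns f_outmat
   (Cons (entry_data k c (kappa K p k) (kappa K p k * D)
            (mat_data [seq tolist (col j N) | j <- enum 'I_n]))
         (mat_data (map hankel (enum 'I_n))))
   (data_of_matrix (@data_of_poly K) (comatrix_mod_char_poly M))
   ((2 * cyc_cost p k + 3 * n) * n * n).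
  eapply returns_sub; [apply: (@returns_outmat _ _ _ _ _ p_gt1 p_le3 n)|..].
  - move=> _ _ /mapP[i _ ->] /mapP[j _ ->]; split; first by rewrite size_tolist.
      exact: legal_hankel.
    exact: legal_char.
  - rewrite /data_of_matrix; congr data_of_seq; rewrite -map_comp; apply: eq_map => i /=.
    by rewrite -map_comp; apply: eq_map => j /=; rewrite entryE.
  - have sz T (f : 'I_n -> T) : size (map f (enum 'I_n)) = n.
      by rewrite size_map size_enum_ord.
    by rewrite !sz.
run.
rewrite size_rows; apply: leq_trans (trial_cost_leq le_k).
by move: (cyc_cost p k) => CC; lia.
Qed.

End Trial.

(** * Genericity of cyclic vectors *)

Section IrreducibleFactors.

Variable K : fieldType.
Implicit Types (q r : {poly K}).

Lemma irreducible_factor q : (1 < size q)%N ->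
  exists2 f, irreducible_poly f & f %| q.
Proof.
have [n] := ubnP (size q); elim: n => // n IHn in q *; rewrite ltnS => le_q q_gt1.
case: (classic (irreducible_poly q)) => [|red_q]; first by exists q.
have [g [g_gt1 dv_g lt_g]] : exists g : {poly K}, [/\ (1 < size g)%N, g %| q & (size g < size q)%N].
  apply: NNPP => no_g; apply: red_q; split=> // g g_n1 dv_g.
  have q_n0 : q != 0 by rewrite -size_poly_gt0 ltnW.
  rewrite -dvdp_size_eqp // eqn_leq dvdp_leq //= leqNgt; apply/negP => lt_g.
  apply: no_g; exists g; split=> //.
  have : g != 0 by apply: contraNneq q_n0 => g0; rewrite g0 dvd0p in dv_g.
  by rewrite -size_poly_gt0; case: (size g) g_n1 => [|[]].
have [f irr_f dv_f] := IHn g (leq_trans lt_g le_q) g_gt1.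
by exists f => //; apply: dvdp_trans dv_g.
Qed.

Lemma irreducible_dvdM f q r : irreducible_poly f ->
  f %| q * r -> (f %| q) || (f %| r).
Proof.
move=> irr_f; case: (boolP (f %| q)) => //= ndv_q; rewrite Gauss_dvdpr //.
by rewrite irreducible_poly_coprime.
Qed.

Lemma irreducible_dvdX f q k : irreducible_poly f -> f %| q ^+ k -> f %| q.
Proof.
move=> irr_f; elim: k => [|k IHk].
  by rewrite expr0 dvdp1 => /eqP sf; have [] := irr_f; rewrite sf.
by rewrite exprS => /(irreducible_dvdM irr_f)/orP[|/IHk].
Qed.

(** Gauss lemma: an irreducible polynomial of [K[Y]] remains prime in
    [K[Y][X]]. *)
Lemma Gauss_content f (A B : {poly {poly K}}) : irreducible_poly f ->
  (forall s, f %| (A * B)`_s) ->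
  (forall d, f %| A`_d) \/ (forall e, f %| B`_e).
Proof.
move=> irr_f dv_AB.
case: (classic (forall d, f %| A`_d)) => [|/not_all_ex_not [d0 /negP Ad0]]; first by left.
case: (classic (forall d, f %| B`_d)) => [|/not_all_ex_not [e0 /negP Be0]]; first by right.
have exA : exists d, ~~ (f %| A`_d) by exists d0.
have exB : exists e, ~~ (f %| B`_e) by exists e0.
have [d Ad minA] := ex_minnP exA; have [e Be minB] := ex_minnP exB.
have := dv_AB (d + e)%N; rewrite coefM.
have lt_d : (d < (d + e).+1)%N by rewrite ltnS leq_addr.
rewrite (bigD1 (Ordinal lt_d)) //= addKn dvdp_addl; last first.
  apply: (big_ind (fun x => f %| x)) => [|x y|i i_d]; first exact: dvdp0.
    exact: dvdp_add.
  have [lt_id|le_di] := ltnP i d.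
    by apply: dvdp_mulr; apply: contraLR lt_id => /minA; rewrite -leqNgt.
  apply: dvdp_mull; have lt_di : (d < i)%N.
    by rewrite ltn_neqAle le_di andbT eq_sym; apply: contra i_d => /eqP eq_i; apply/eqP/val_inj.
  have : (d + e - i < e)%N by have := ltn_ord i; lia.
  by apply: contraLR => /minB; rewrite -leqNgt.
by move/(irreducible_dvdM irr_f); rewrite (negPf Ad) (negPf Be).
Qed.

End IrreducibleFactors.

Section Cyclic.

Variables (K : fieldType) (n : nat) (M : 'M[K]_n).

Local Notation chi := (char_poly M).
Local Notation B := (\adj (char_poly_mx M)).

Lemma discriminant_coprime : discriminant chi != 0 -> coprimep chi chi^`().
Proof.
rewrite /discriminant !mulf_eq0 !negb_or => /andP[_ /andP[_]].
rewrite resultant_eq0 -leqNgt coprimep_sym /coprimep => le1.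
have : gcdp chi^`() chi != 0.
  by rewrite gcdp_eq0 negb_and orbC monic_neq0 ?char_poly_monic.
by rewrite -size_poly_gt0; case: (size _) le1 => [|[]].
Qed.

(** A square factor of [chi] would divide its derivative. *)
Lemma square_free f : coprimep chi chi^`() -> irreducible_poly f -> ~~ (f * f %| chi).
Proof.
move=> cop irr_f; apply/negP => /dvdpP[q def_chi].
have [f_gt1 _] := irr_f.
have dv_chi : f %| chi by rewrite def_chi mulrA dvdp_mull.
have dv_chi' : f %| chi^`().
  rewrite def_chi !derivM; apply: dvdp_add; first by rewrite mulrA dvdp_mull.
  by apply: dvdp_mull; apply: dvdp_add; [apply: dvdp_mull|apply: dvdp_mulr].
have := coprimep_dvdl dv_chi' cop; rewrite coprimep_sym => /coprimep_dvdl-/(_ _ dv_chi).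
by rewrite coprimepp => /eqP sf; rewrite sf in f_gt1.
Qed.

(** If an irreducible factor of [chi] divided the adjugate, the determinant of
    the identity [(Y - M) * adj = chi] would show that it is a double factor. *)
Lemma adj_not_dvd f : coprimep chi chi^`() -> irreducible_poly f -> f %| chi ->
  exists i j, ~~ (f %| B i j).
Proof.
move=> cop irr_f /dvdpP[r def_chi]; apply: NNPP => no_ij.
have f_n0 : f != 0 by rewrite -size_poly_gt0; case: irr_f => /ltnW.
have dvB i j : f %| B i j.
  by apply/negPn/negP => ndv; apply: no_ij; exists i, j.
(* The determinant of (Y - M) C = (chi / f) shows that chi divides a power of
   chi / f. *)
pose C : 'M_n := \matrix_(i, j) (B i j %/ f).
have BC : B = f *: C by apply/matrixP => i j; rewrite [RHS]mxE [C i j]mxE mulrC divpK.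
have := mul_mx_adj (char_poly_mx M); rewrite -/chi BC -scalemxAr def_chi mulrC.
rewrite scalar_mxM mul_scalar_mx => /(congr1 (fun A : 'M_n => \det A)).
rewrite !detZ => /mulfI-/(_ (expf_neq0 _ f_n0)).
rewrite det_mulmx det_scalar -/chi => detE.
have dv_r : f %| r.
  apply: (@irreducible_dvdX _ f r n irr_f); rewrite -detE def_chi.
  by rewrite dvdp_mulr // dvdp_mull.
have := square_free cop irr_f; rewrite def_chi.
by rewrite dvdp_mul2r // dv_r.
Qed.

(** The Krylov matrix at a generic [t]. *)
Definition krylov_poly : 'M[{poly K}]_n :=
  \matrix_(i, k) \sum_(a < n) (M ^+ k) i a *: 'X^a.

Lemma krylov_polyE t : (\det krylov_poly).[t] = \det (krylov M t).
Proof.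
rewrite -/(horner_eval t _) -det_map_mx; congr (\det _); apply/matrixP => i k.
rewrite [LHS]mxE [krylov_poly i k]mxE [RHS]mxE [RHS]mxE /= /horner_eval horner_sum; apply: eq_bigr => a _.
by rewrite hornerZ hornerXn mxE.
Qed.

Lemma size_det_krylov_poly : (size (\det krylov_poly) <= (n * n.-1).+1)%N.
Proof.
apply: leq_trans (size_sum _ _ _) _; apply/bigmax_leqP => s _.
rewrite mulr_sign; set Q := \prod_i _.
suff sQ : (size Q <= (n * n.-1).+1)%N by case: ifP => _ //; rewrite size_polyN.
apply: leq_trans (size_poly_prod_leq _ _) _; rewrite card_ord.
have : (\sum_(i < n) size (krylov_poly i (s i)) <= \sum_(i < n) n)%N.
  apply: leq_sum => i _; rewrite mxE; apply: leq_trans (size_sum _ _ _) _.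
  apply/bigmax_leqP => a _; apply: leq_trans (size_scale_leq _ _) _.
  by rewrite size_polyXn.
rewrite sum_nat_const card_ord; move: (\sum_(i < n) size _)%N => T.
by case: (n) => [|m] /=; [rewrite !muln0|]; nia.
Qed.

(** Since [adj (Y - M) = chi], multiplying [adj] by [M] is multiplying it by [Y],
    modulo [chi]. *)
Lemma adj_eigen k : exists C : 'M[{poly K}]_n,
  B *m map_mx polyC (M ^+ k) = 'X^k *: B + chi *: C.
Proof.
elim: k => [|k [C IHk]].
  by exists 0; rewrite !expr0 map_scalar_mx mulmx1 scale1r scaler0 addr0.
have BM : B *m map_mx polyC M = 'X *: B - chi%:M.
  rewrite /char_poly -(mul_adj_mx (char_poly_mx M)) {3}/char_poly_mx mulmxBr.
  by rewrite mul_mx_scalar opprB addrC subrK.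
exists ('X *: C - map_mx polyC (M ^+ k)).
rewrite exprS map_mxM mulmxA BM mulmxBl -scalemxAl IHk mul_scalar_mx.
rewrite scalerDr [in RHS]exprS -scalerA scalerBr addrA; congr (_ + _ - _).
by rewrite !scalerA mulrC.
Qed.

(** Let [a_k(T)] be the coefficients of a linear relation between the columns.
    Multiplying the relation by the adjugate [B] of [Y - M] turns [M^k] into [Y^k],
    by [adj_eigen]: modulo [chi], the product of [A = sum_k a_k(T) Y^k] by
    [b_i = sum_e B_(i,e) T^e] is zero.  No irreducible factor of [chi] divides [B],
    hence by Gauss lemma all of them divide [A].  As [chi] is square-free of degree
    [n] and [A] has degree less than [n] in [Y], [A] vanishes. *)
Lemma det_krylov_poly_n0 : coprimep chi chi^`() -> \det krylov_poly != 0.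
Proof.
move=> cop; rewrite -det_tr; apply/det0P => -[a a_n0 a_ker].
pose A : {poly {poly K}} := \sum_(k < n) 'X^k *: map_poly polyC (a 0 k).
have coefA d : A`_d = \sum_(k < n) ((a 0 k)`_d)%:P * 'X^k.
  rewrite coef_sum; apply: eq_bigr => k _.
  by rewrite coefZ coef_map mulrC.
have sA d : (size (A`_d)%R <= n)%N.
  rewrite coefA; apply: leq_trans (size_sum _ _ _) _; apply/bigmax_leqP => k _.
  rewrite mul_polyC; apply: leq_trans (size_scale_leq _ _) _.
  by rewrite size_polyXn.
pose b i : {poly {poly K}} := \sum_(e < n) (B i e) *: 'X^e.
have coefb i (e : 'I_n) : (b i)`_e = B i e.
  rewrite coef_sum (bigD1 e) //= coefZ coefXn eqxx mulr1 big1 ?addr0 // => e' e'_e.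
  by rewrite coefZ coefXn val_eqE eq_sym (negPf e'_e) mulr0.
have [C eqC] := fin_all_exists (fun k : 'I_n => adj_eigen k).
have dvAb i s : chi %| (A * b i)`_s.
  pose lift : {rmorphism {poly K} -> {poly {poly K}}} := map_poly (@polyC K).
  pose Z := \sum_(k < n) lift (a 0 k) * \sum_(e < n) C k i e *: 'X^e.
  suff -> : A * b i = - (chi *: Z).
    by rewrite coefN coefZ dvdpNr dvdp_mulr.
  pose S := \sum_(k < n) lift (a 0 k) *
    \sum_(e < n) (B *m map_mx polyC (M ^+ k)) i e *: 'X^e.
  have S0 : S = 0.
    have -> : S = \sum_j (B i j)%:P * lift (\sum_(k < n) a 0 k * krylov_poly j k).
      rewrite /S; under [RHS]eq_bigr do rewrite rmorph_sum mulr_sumr.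
      rewrite [RHS]exchange_big /=; apply: eq_bigr => k _.
      under [RHS]eq_bigr do rewrite rmorphM mulrCA.
      rewrite -mulr_sumr; congr (_ * _).
      under [RHS]eq_bigr do rewrite [krylov_poly _ _]mxE rmorph_sum mulr_sumr.
      rewrite [RHS]exchange_big /=; apply: eq_bigr => e _.
      rewrite [(B *m _) i e]mxE scaler_suml; apply: eq_bigr => j _.
      rewrite [map_mx _ _ j e]mxE -mul_polyC polyCM -mulrA; congr (_ * _).
      by rewrite /lift /= map_polyZ map_polyXn /= mul_polyC.
    apply: big1 => j _; have /rowP/(_ j) := a_ker.
    rewrite [LHS]mxE [in RHS]mxE => a_ker_j.
    rewrite (eq_bigr (fun k => a 0 k * krylov_poly^T k j)); last first.
      by move=> k _; rewrite [in RHS]mxE.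
    by rewrite a_ker_j rmorph0 mulr0.
  rewrite -[RHS]add0r -S0 /S /Z scaler_sumr -sumrB /A mulr_suml.
  apply: eq_bigr => k _; rewrite eqC -scalerAl [in LHS]scalerAr [X in _ - X]scalerAr.
  rewrite -mulrBr -/(lift _); congr (_ * _); rewrite [X in _ - X]scaler_sumr -sumrB.
  rewrite /b scaler_sumr; apply: eq_bigr => e _.
  by rewrite [in RHS]mxE [('X^k *: B) i e]mxE [(chi *: C k) i e]mxE scalerDl !scalerA addrK.
have dvA f d : irreducible_poly f -> f %| chi -> f %| A`_d.
  move=> irr_f dv_f; have [i [e ndv]] := adj_not_dvd cop irr_f dv_f.
  have [|all_A|all_b] := @Gauss_content K f A (b i) irr_f.
  - by move=> s; apply: dvdp_trans dv_f (dvAb i s).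
  - exact: all_A.
  - by have := all_b e; rewrite coefb (negPf ndv).
have chi_n0 : chi != 0 by rewrite monic_neq0 ?char_poly_monic.
have A0 d : A`_d = 0.
  apply/eqP; apply: contraT => Ad_n0.
  (* An irreducible factor of chi / gcd (chi, A_d) would divide the gcd as well,
     and be a double factor of chi. *)
  pose g := gcdp chi A`_d; pose r := chi %/ g.
  have def_chi : chi = r * g by rewrite divpK // dvdp_gcdl.
  have g_n0 : g != 0 by rewrite gcdp_eq0 negb_and chi_n0.
  have r_n0 : r != 0 by apply: contraNneq chi_n0 => r0; rewrite def_chi r0 mul0r.
  have sr : (1 < size r)%N.
    have : (size g <= n)%N := leq_trans (leq_gcdpr _ Ad_n0) (sA d).
    have := size_char_poly M; rewrite def_chi size_mul //.
    move: (size g) (size r) => x y; lia.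
  have [f irr_f dv_r] := irreducible_factor sr.
  have dv_chi : f %| chi by rewrite def_chi dvdp_mulr.
  have dv_g : f %| g by rewrite dvdp_gcd dv_chi dvA.
  by have := square_free cop irr_f; rewrite def_chi dvdp_mul.
case/negP: a_n0; apply/eqP/rowP => k; apply/polyP => d.
rewrite mxE coef0; have := congr1 (fun q : {poly K} => q`_k) (A0 d).
rewrite coef0 coefA coef_sum (bigD1 k) //= coefCM coefXn eqxx mulr1.
rewrite big1 ?addr0 // => k' k'_k.
by rewrite coefCM coefXn val_eqE eq_sym (negPf k'_k) mulr0.
Qed.

Lemma singular_count (S : seq K) : coprimep chi chi^`() -> uniq S ->
  (count (fun t => \det (krylov M t) == 0%R) S <= n * n.-1)%N.
Proof.
move=> cop uniq_S; rewrite -size_filter -ltnS.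
apply: leq_trans size_det_krylov_poly.
apply: max_poly_roots (det_krylov_poly_n0 cop) _ (filter_uniq _ uniq_S).
by apply/allP => t; rewrite mem_filter => /andP[dt _]; rewrite /root krylov_polyE.
Qed.

End Cyclic.

(** * Retrying until success *)

Section Retry.

Variables (K : fieldType) (src : nat -> seq K).
Implicit Types (x : run K).

(** Costs, timeouts and total mass are all means of functions of the cost and
    outcome of a run. *)
Definition mean (f : nat -> outcome K -> rat) x : rat :=
  \sum_(y <- x) y.1.1 * f y.1.2 y.2.

Lemma average_costE x : average_cost x = mean (fun c _ => c%:R) x.
Proof. by []. Qed.

Lemma timeout_probabilityE x :
  timeout_probability x = mean (fun _ o => (is_timeout o)%:R) x.
Proof.
rewrite /timeout_probability big_mkcond; apply: eq_bigr => y _.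
by case: is_timeout; rewrite ?mulr1 ?mulr0.
Qed.

Lemma mean_delay f c x : mean f (delay c x) = mean (fun c' => f (c + c')%N) x.
Proof. by rewrite /mean /delay big_map; apply: eq_bigr => -[[w c'] o] _. Qed.

Lemma delay0 x : delay 0 x = x.
Proof. by rewrite /delay -[RHS]map_id; apply: eq_map => -[[w c] o]. Qed.

Lemma mean_draw f N (k : data K -> run K) : size (src N) = N -> (0 < N)%N ->
  mean f (bind (run_draw src N) k) =
  N%:R^-1 * \sum_(t <- src N) mean (fun c => f c.+1) (k (Elt t)).
Proof.
move=> sz; case: N sz => // N _ _; rewrite /mean /bind /run_draw -map_comp.
rewrite big_flatten big_map mulr_sumr; apply: eq_bigr => t _ /=.
by rewrite big_map mulr_sumr; apply: eq_bigr => -[[w c] o] _ /=; rewrite mulrA.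
Qed.

Definition only (r : data K) : run K -> Prop :=
  List.Forall (fun y => y.2 = Done r \/ y.2 = Timeout).

Lemma only_delay r c x : only r x -> only r (delay c x).
Proof. by move=> ok; apply/List.Forall_map; apply: List.Forall_impl ok => -[[]]. Qed.

Lemma only_draw r N (k : data K -> run K) :
  size (src N) = N -> (0 < N)%N ->
  (forall t, t \in src N -> only r (k (Elt t))) ->
  only r (bind (run_draw src N) k).
Proof.
move=> sz; case: N sz => // N _ _; rewrite /bind /run_draw -map_comp.
elim: (src N.+1) => [|t S IHS] ok_k /=; first exact: List.Forall_nil.
apply/List.Forall_app; split; last first.
  by apply: IHS => u uS; apply: ok_k; rewrite inE uS orbT.
apply/List.Forall_map; apply: List.Forall_impl (ok_k t (mem_head _ _)).
by move=> -[[]].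
Qed.

Lemma only_onth r x i y : only r x -> onth x i = Some y ->
  y.2 = Done r \/ y.2 = Timeout.
Proof.
by move=> ok; elim: ok i => [|z s z_ok _ IHs] [|i] //= => [[<-]|/IHs].
Qed.

Record loop_state (r : data K) (B q : rat) x : Prop := LoopState {
  loop_only : only r x;
  loop_mass : mean (fun _ _ => 1) x = 1;
  loop_cost : average_cost x <= B;
  loop_timeout : timeout_probability x <= q
}.

Lemma loop_state_timeout r B c : c%:R <= B -> loop_state r B 1 [:: (1, c, Timeout)].
Proof.
move=> cB; split; first by constructor; [right|constructor].
- by rewrite /mean big_seq1 mulr1.
- by rewrite /average_cost big_seq1 mul1r.
- by rewrite /timeout_probability big_mkcond big_seq1.
Qed.

Lemma sum_leq_count (S : seq K) (bad : pred K) (f : K -> rat) (a b : rat) :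
  (forall t, t \in S -> f t <= a + (if bad t then b else 0)) ->
  \sum_(t <- S) f t <= (size S)%:R * a + (count bad S)%:R * b.
Proof.
elim: S => [|t S IHS] ok; first by rewrite big_nil !mul0r addr0.
rewrite big_cons /= -addn1 !natrD.
have := ok t (mem_head _ _).
have := IHS (fun u uS => ok u (@mem_behead _ (t :: S) u uS)).
case: (bad t) => /=; lra.
Qed.

(** One more turn of the loop, [x] being the run that a failed trial falls back
    to.  The average cost is at most the cost [1 + A] of the draw and of the trial,
    plus half the average cost of [x]: the bound [2 * (1 + A)] is a fixed point.
    The timeout probability is halved as soon as no trial is cut off. *)
Lemma loop_step r (A N : nat) (bad : pred K) (k : data K -> run K) (q : rat)
    (cut : bool) x :
  size (src N) = N -> (0 < N)%N -> (2 * count bad (src N) <= N)%N ->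
  0 <= q <= 1 -> loop_state r (2 * A.+1)%:R q x ->
  (forall t, t \in src N -> exists2 c, (c <= A)%N &
     (cut /\ k (Elt t) = [:: (1, c, Timeout)]) \/
     k (Elt t) = delay c (if bad t then x else ret (Done r))) ->
  loop_state r (2 * A.+1)%:R (if cut then 1 else q / 2)
    (bind (run_draw src N) k).
Proof.
move=> sz N_gt0 few /andP[q_ge0 q_le1] [x_only x_mass x_cost x_time] ok_k.
have N_n0 : N%:R != 0 :> rat by rewrite pnatr_eq0 -lt0n.
have N_pos : 0 < N%:R :> rat by rewrite ltr0n.
have few' : (count bad (src N))%:R * 2 <= N%:R :> rat.
  by rewrite -natrM ler_nat mulnC.
have k_mass t : t \in src N -> mean (fun _ _ => 1) (k (Elt t)) = 1.
  move/ok_k => [c _ [[_ ->]|->]]; first by rewrite /mean big_seq1 mulr1.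
  rewrite mean_delay; case: (bad t) => //.
  by rewrite /mean big_seq1 mulr1.
have mean1 c (f : nat -> outcome K -> rat) o : mean f [:: (1, c, o)] = f c o.
  by rewrite /mean big_seq1 mul1r.
have costS c y : mean (fun _ _ => 1) y = 1 ->
    mean (fun c' _ => (c + c')%:R) y = c%:R + average_cost y.
  move=> y1; transitivity (c%:R * mean (fun _ _ => 1) y + average_cost y).
    rewrite average_costE /mean mulr_sumr -big_split; apply: eq_bigr => -[[w c'] o] _.
    by rewrite /= natrD; ring.
  by rewrite y1 mulr1.
split.
- apply: only_draw => // t /ok_k[c _ [[_ ->]|->]].
    by constructor; [right|constructor].
  apply: only_delay; case: (bad t) => //.
  by constructor; [left|constructor].
- rewrite mean_draw // (eq_big_seq _ k_mass) big_const_seq count_predT sz.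
  by rewrite iter_addr_0 mulVf.
- rewrite average_costE mean_draw // mulrC ler_pdivrMr //.
  have := @sum_leq_count (src N) bad
    (fun t => mean (fun c _ => c.+1%:R) (k (Elt t))) A.+1%:R (2 * A.+1)%:R.
  rewrite sz => le_sum; apply: le_trans (le_sum _) _; last first.
    rewrite natrM; have : 0 <= A.+1%:R :> rat by [].
    move: A.+1%:R few' => a few' a_ge0; nra.
  move=> t tN; have [c cA eq_k] := ok_k t tN.
  rewrite (costS 1%N _ (k_mass t tN)) average_costE.
  have : c%:R <= A%:R :> rat by rewrite ler_nat.
  have : 0 <= (2 * A.+1)%:R :> rat by [].
  rewrite -[A.+1%:R]natr1; case: eq_k => [[_ ->]|->].
    by rewrite mean1; case: (bad t); lra.
  rewrite mean_delay; case: (bad t).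
    by rewrite (costS c _ x_mass); lra.
  by rewrite mean1 addn0; lra.
- rewrite timeout_probabilityE mean_draw // mulrC ler_pdivrMr //.
  case: cut ok_k => ok_k.
    have := @sum_leq_count (src N) bad
      (fun t => mean (fun _ o => (is_timeout o)%:R) (k (Elt t))) 1 0.
    rewrite sz mulr0 addr0 mulrC; apply=> t /ok_k[c _ eq_k].
    rewrite if_same addr0; case: eq_k => [[_ ->]|->]; first by rewrite mean1.
    rewrite mean_delay; case: (bad t); last by rewrite mean1.
    by rewrite -timeout_probabilityE; lra.
  have := @sum_leq_count (src N) bad
    (fun t => mean (fun _ o => (is_timeout o)%:R) (k (Elt t))) 0 q.
  rewrite sz => le_sum; apply: le_trans (le_sum _) _; last by nra.
  move=> t /ok_k[c _ [[//]|->]]; rewrite mean_delay add0r.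
  case: (bad t); last by rewrite mean1.
  by rewrite -timeout_probabilityE.
Qed.

End Retry.

(** * The complete algorithm *)

Section Execution.

Variables (K : fieldType) (v : K -> int) (src : nat -> seq K).
Variables (p n : nat) (M : 'M[K]_n).
Hypotheses (hv : complete_discrete_valuation v) (p_pr : prime p) (p_le3 : (p <= 3)%N).
Hypotheses (p_n0 : p%:R != 0 :> K) (src_ok : random_source v src).
Hypotheses (M_int : mx_integral v M) (cop : coprimep (char_poly M) (char_poly M)^`()).

Local Notation P := (prog p).
Local Notation A := (trial_cost n).
Local Notation in_M := (data_of_seq (data_of_seq (@Elt K)) (rows M)).
Local Notation out_M := (data_of_matrix (@data_of_poly K) (comatrix_mod_char_poly M)).
Local Notation m fuel := (call v src (char_poly M) P fuel false f_main in_M).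

#[local] Hint Resolve returns_app returns_mulu : run_db.

(** At least twice the number [n * n.-1] of bad values, and positive for [n = 0]. *)
Definition sample_size : nat := (n * (n + n)).+1.

Definition sample_expr : expr :=
  ECons ENil (ECall f_mulu (ECons (EVar 0) (ECall f_app (ECons (EVar 0) (EVar 0))))).

Definition trial_expr : expr := ECall f_trial (ECons (EVar 1) (EVar 0)).

Definition retry_run fuel (d : data K) : run K :=
  eval v src (char_poly M) (call v src (char_poly M) P fuel) false [:: d; in_M]
    (ECase trial_expr (ECall f_main (EVar 1)) (EVar 0)).

Lemma main_unfold fuel : m fuel.+1 =
  bind (bind (eval v src (char_poly M) (call v src (char_poly M) P fuel) false
                [:: in_M] sample_expr)
          (fun d => run_draw src (data_size d)))
    (retry_run fuel).
Proof. by []. Qed.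

Lemma evaluates_sample : exists2 d, evaluates v src (char_poly M) P [:: in_M] sample_expr d 0
  & data_size d = sample_size.
Proof.
exists (Cons Nil (data_of_seq (data_of_seq (@Elt K))
   (flatten (nseq (size (rows M)) (rows M ++ rows M))))).
  by rewrite /sample_expr; eapply evaluates_sub; [sym|..].
rewrite /= data_size_seq size_flatten /shape map_nseq sumn_nseq size_cat size_rows.
by rewrite mulnC.
Qed.

Lemma retry_runE t : integral v t -> exists fuel0, forall fuel,
  exists2 c, (c <= A)%N &
    (~~ (fuel0 <= fuel)%N /\ retry_run fuel (Elt t) = [:: (1, c, Timeout)]) \/
    retry_run fuel (Elt t) =
      delay c (if \det (krylov M t) == 0 then m fuel else ret (Done out_M)).
Proof.
move=> t_int.
have [] : evaluates v src (char_poly M) P [:: Elt t; in_M] trial_expr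
    (if \det (krylov M t) == 0 then Nil else Cons out_M Nil) (0 + 0 + A).
  apply: evaluates_call (returns_trial src hv p_pr p_le3 p_n0 M_int t_int).
  by apply: evaluates_cons; apply: evaluates_var.
rewrite add0n => all_e [f0 lim_e]; exists f0 => fuel.
have halts c : eval v src (char_poly M) (call v src (char_poly M) P fuel) false
      [:: Elt t; in_M] trial_expr =
      [:: (1, c, Done (if \det (krylov M t) == 0 then Nil else Cons out_M Nil))] ->
    retry_run fuel (Elt t) =
      delay c (if \det (krylov M t) == 0 then m fuel else ret (Done out_M)).
  rewrite /retry_run /= => ->; rewrite bind_done; congr (delay _ _).
  case: (\det _ == 0); last by [].
  rewrite /ret bind_done; exact: delay0.
case: (leqP f0 fuel) => [le_f|_].
  by have [c cA /halts eq_c] := lim_e _ le_f; exists c; last by right.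
case: (all_e fuel) => -[c cA eq_c]; exists c => //.
  by right; apply: halts.
by left; split=> //; move: eq_c; rewrite /retry_run /= => ->.
Qed.

(** There are finitely many samples, hence a fuel that suffices for all of them. *)
Lemma uniform_fuel (S : seq K) (Q : K -> nat -> Prop) :
  (forall t, t \in S -> exists f0, forall f, (f0 <= f)%N -> Q t f) ->
  exists f0, forall t f, t \in S -> (f0 <= f)%N -> Q t f.
Proof.
elim: S => [|t S IHS] ok; first by exists 0%N.
have [f1 ok1] := ok t (mem_head _ _).
have [|f2 ok2] := IHS; first by move=> u uS; apply: ok; rewrite inE uS orbT.
exists (maxn f1 f2) => u f; rewrite inE geq_max => /orP[/eqP->|uS] /andP[le1 le2].
  exact: ok1.
exact: ok2.
Qed.

Lemma loop_main : exists fuel0, forall fuel (q : rat), 0 <= q <= 1 ->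
  loop_state out_M (2 * A.+1)%:R q (m fuel) ->
  loop_state out_M (2 * A.+1)%:R (if (fuel0 <= fuel)%N then q / 2 else 1) (m fuel.+1).
Proof.
have [d [all_d [f1 lim_d]] sz_d] := evaluates_sample.
have [src_size src_uniq /allP src_int] := src_ok sample_size.
pose late t f := exists2 c, (c <= A)%N & retry_run f (Elt t) =
  delay c (if \det (krylov M t) == 0 then m f else ret (Done out_M)).
have [f2 ok2] : exists f0, forall t f, t \in src sample_size -> (f0 <= f)%N -> late t f.
  apply: uniform_fuel => t /src_int/retry_runE[f0 ok]; exists f0 => f le_f.
  by have [c cA [[]|eq_c]] := ok f; [rewrite le_f|exists c].
have few : (2 * count (fun t => \det (krylov M t) == 0%R) (src sample_size) <= sample_size)%N.
  have := singular_count cop src_uniq; rewrite /sample_size.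
  by move: (count _ _) => c; move: cop => _; case: (n) => [|n'] /=; nia.
exists (maxn f1 f2) => fuel q q01 st.
have halts : eval v src (char_poly M) (call v src (char_poly M) P fuel) false
    [:: in_M] sample_expr = [:: (1, 0%N, Done d)] ->
    m fuel.+1 = bind (run_draw src sample_size) (retry_run fuel).
  by rewrite main_unfold => ->; rewrite bind_done delay0 sz_d.
have step cut : (~~ cut -> (f2 <= fuel)%N) ->
    loop_state out_M (2 * A.+1)%:R (if cut then 1 else q / 2)
      (bind (run_draw src sample_size) (retry_run fuel)).
  move=> cutP; apply: (loop_step src_size _ few q01 st) => // t tS.
  case: cut cutP => [_|/(_ isT) le_f].
    have [f0 /(_ fuel)[c cA [[_ eq_c]|eq_c]]] := retry_runE (src_int t tS).
      by exists c => //; left.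
    by exists c => //; right.
  by have [c cA eq_c] := ok2 t fuel tS le_f; exists c => //; right.
case: ifP => [|_].
  rewrite geq_max => /andP[le1 le2]; have [[|//] _ eq_d] := lim_d _ le1.
  by rewrite (halts eq_d); apply: (step false).
case: (all_d fuel) => -[[|//] _ eq_d].
  by rewrite (halts eq_d); apply: (step true).
by rewrite main_unfold eq_d; apply: loop_state_timeout.
Qed.

Lemma loop_state1 fuel : loop_state out_M (2 * A.+1)%:R 1 (m fuel).
Proof.
have [f0 step] := loop_main; elim: fuel => [|fuel IHf].
  exact: loop_state_timeout.
have [//|? ? ? le_q] := step fuel 1 _ IHf; split=> //; apply: le_trans le_q _.
by case: ifP; lra.
Qed.

(** Once the fuel suffices for one trial, each further unit of fuel halves the
    probability of a timeout. *)
Lemma main_correct :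
  [/\ almost_surely_terminates (fun fuel => m fuel),
      only_returns (fun fuel => m fuel) out_M
    & average_cost_le (fun fuel => m fuel) (2 * A.+1)%:R].
Proof.
split.
- have [f0 step] := loop_main.
  have small j : loop_state out_M (2 * A.+1)%:R (2^-1 ^+ j) (m (f0 + j)).
    elim: j => [|j IHj]; first by rewrite addn0; apply: loop_state1.
    rewrite addnS exprSr; have := step (f0 + j)%N _ _ IHj.
    rewrite leq_addr; apply; apply/andP; split; first exact: exprn_ge0.
    by apply: exprn_ile1; lra.
  move=> eps eps_gt0; have eps_ge0 := ltW eps_gt0.
  pose j := Num.bound eps^-1; exists (f0 + j)%N.
  apply: le_lt_trans (loop_timeout (small j)) _.
  have lt_j : eps^-1 < 2 ^+ j.
    apply: lt_le_trans (archi_boundP _) _; first by rewrite invr_ge0.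
    by rewrite -natrX ler_nat ltnW // ltn_expl.
  by rewrite exprVn invf_plt ?posrE ?exprn_gt0.
- move=> fuel i w c o /(only_onth (loop_only (loop_state1 fuel))).
  by [].
- by move=> fuel; apply: loop_cost (loop_state1 fuel).
Qed.

End Execution.

Lemma trial_cost_soft n : (1 < n)%N ->
  (2 * (trial_cost n).+1 <= 3 ^ 9 * 2 ^ 13 * (n ^ 3 * trunc_log 2 n ^ 8))%N.
Proof.
move=> n_gt1; have : (0 < trunc_log 2 n)%N by rewrite trunc_log_gt0.
rewrite /trial_cost; move: (trunc_log 2 n) => l l_gt0.
have le_n : (n.+1 ^ 3 <= 2 ^ 3 * n ^ 3)%N by rewrite -expnMn leq_exp2r //; lia.
have le_l : (l.+1 ^ 8 <= 2 ^ 8 * l ^ 8)%N by rewrite -expnMn leq_exp2r //; lia.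
have le_u := leq_mul le_n le_l.
have u_gt0 : (0 < n.+1 ^ 3 * l.+1 ^ 8)%N by rewrite muln_gt0 !expn_gt0.
have e_gt0 : (0 < 3 ^ 9)%N by rewrite expn_gt0.
rewrite -[(3 ^ 9 * _ * _)%N]mulnA -[(2 ^ 13)%N]/(2 ^ (2 + 3 + 8))%N !expnD.
move: (3 ^ 9)%N (n.+1 ^ 3 * _)%N (2 ^ 3)%N (2 ^ 8)%N (n ^ 3)%N (l ^ 8)%N e_gt0 u_gt0 le_u.
move=> e u a b c d e_gt0 u_gt0; rewrite -(leq_pmul2l e_gt0).
have : (0 < e * u)%N by rewrite muln_gt0 e_gt0.
have -> : (e * (2 ^ 2 * a * b) * (c * d) = 4 * (e * (a * c * (b * d))))%N by ring.
lia.
Qed.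

Lemma soft_O_cost : soft_O (fun n => (2 * (trial_cost n).+1)%:R) (fun n => n%:R ^+ 3).
Proof.
exists 8%N, (3 ^ 9 * 2 ^ 13)%:R, 2%N => n /trial_cost_soft.
move: (3 ^ 9 * 2 ^ 13)%N (2 * _)%N => C T le_T.
rewrite normr_nat ger0_norm; last by rewrite mulr_ge0 ?exprn_ge0.
by rewrite -[n%:R ^+ 3]natrX -[_%:R ^+ 8]natrX -!natrM ler_nat.
Qed.

(** If two is zero in [K] then three is one. *)
Lemma small_prime_neq0 (K : fieldType) :
  exists p, [/\ prime p, (p <= 3)%N & p%:R != 0 :> K].
Proof.
have [two0|two_n0] := eqVneq (2%:R : K) 0; last by exists 2%N.
by exists 3%N; split=> //; rewrite -natr1 two0 add0r oner_neq0.
Qed.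

Theorem theorem3p11 (K : fieldType) (v : K -> int) (src : nat -> seq K)
    (hv : complete_discrete_valuation v) (hsrc : random_source v src) :
  exists (P : program) (T : nat -> rat),
    soft_O T (fun n => n%:R ^+ 3) /\
    forall (n : nat) (M : 'M[K]_n),
      (forall i j, integral v (M i j)) ->
      discriminant (char_poly M) != 0 ->
      let execution := fun fuel : nat =>
        exec v src (char_poly M) P fuel (data_of_matrix (@Elt K) M) in
      [/\ almost_surely_terminates execution,
          only_returns execution
            (data_of_matrix (@data_of_poly K) (comatrix_mod_char_poly M))
        & average_cost_le execution (T n)].
Proof.
have [p [p_pr p_le3 p_n0]] := small_prime_neq0 K.
exists (prog p), (fun n => (2 * (trial_cost n).+1)%:R); split; first exact: soft_O_cost.
move=> n M M_int /discriminant_coprime cop.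
exact: (main_correct hv p_pr p_le3 p_n0 hsrc M_int cop).
Qed.
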